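(* The problem $\mathit{Sat}(\mathcal{B}c^\circ,\mathrm{RC}(\mathbb{R}^3))$ is NP-complete.
   Context: For a topological space $T$ and $X\subseteq T$, $\overline{X}$ is the closure and $X^\circ$ the interior of $X$; $X$ is regular closed if $X=\overline{X^\circ}$. $\mathrm{RC}(T)$ is the Boolean algebra of regular closed subsets of $T$ with $X+Y=X\cup Y$, $X\cdot Y=\overline{(X\cap Y)^\circ}$, $-X=\overline{T\setminus X}$, $0=\emptyset$, $1=T$. Terms are built from countably many variables and the constants $0,1$ using $+,\cdot,-$. $\mathcal{B}c^\circ$-formulas are built from atoms $\tau_1=\tau_2$ and $c^\circ(\tau)$ using $\wedge,\neg$. An interpretation $\mathfrak I$ over $\mathrm{RC}(T)$ maps variables to elements of $\mathrm{RC}(T)$, extended to terms via the Boolean operations; $\mathfrak I\models\tau_1=\tau_2$ iff $\tau_1^{\mathfrak I}=\tau_2^{\mathfrak I}$, and $\mathfrak I\models c^\circ(\tau)$ iff $(\tau^{\mathfrak I})^\circ$ is connected. $\mathit{Sat}(\mathcal{B}c^\circ,\mathrm{RC}(\mathbb{R}^3))$ is the problem of deciding, given a $\mathcal{B}c^\circ$-formula, whether some interpretation over $\mathrm{RC}(\mathbb{R}^3)$ satisfies it. *)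

(* Defs.v *)
From HB Require Import structures.
From Corelib Require Import PosDef.
From mathcomp Require Import all_boot all_order all_algebra.
From mathcomp Require Import all_classical all_reals all_analysis.
Import numFieldNormedType.Exports.

Set Implicit Arguments.
Unset Strict Implicit.
Unset Printing Implicit Defensive.

Local Open Scope classical_set_scope.

Section RegularClosed.
Variable T : topologicalType.
Implicit Types X Y : set T.

Definition regular_closed X : Prop := X = closure (interior X).

Definition rc_add X Y : set T := X `|` Y.
Definition rc_mul X Y : set T := closure (interior (X `&` Y)).
Definition rc_opp X : set T := closure (~` X).

End RegularClosed.

Inductive term : Type :=
| Var of nat
| Zero
| One
| Add of term & term
| Mul of term & term
| Opp of term.

Inductive formula : Type :=
| Equal of term & term
| IntConn of term
| And of formula & formula
| Not of formula.

Section Semantics.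
Variable T : topologicalType.

Record interpretation := Interpretation {
  val_var :> nat -> set T;
  val_varP : forall v, regular_closed (val_var v) }.

Fixpoint eval (I : interpretation) (t : term) : set T :=
  match t with
  | Var v => I v
  | Zero => set0
  | One => setT
  | Add t1 t2 => rc_add (eval I t1) (eval I t2)
  | Mul t1 t2 => rc_mul (eval I t1) (eval I t2)
  | Opp t1 => rc_opp (eval I t1)
  end.

(* The library's [connected] holds of the empty set, so c°(0) is true. *)
Fixpoint models (I : interpretation) (phi : formula) : Prop :=
  match phi with
  | Equal t1 t2 => eval I t1 = eval I t2
  | IntConn t => connected (interior (eval I t))
  | And phi1 phi2 => models I phi1 /\ models I phi2
  | Not phi1 => ~ models I phi1
  end.

Definition satisfiable (phi : formula) : Prop :=
  exists I : interpretation, models I phi.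

End Semantics.

(* [TVar] is followed by the binary expansion of the variable's index, written
   with the digits [TBit]; these differ from the constants [TZero], [TOne]. *)
Inductive token : Type :=
| TVar | TBit of bool | TZero | TOne | TAdd | TMul | TOpp
| TEqual | TIntConn | TAnd | TNot.

Definition nat_of_token (a : token) : nat :=
  match a with
  | TVar => 0 | TBit b => b.+1 | TZero => 3 | TOne => 4 | TAdd => 5
  | TMul => 6 | TOpp => 7 | TEqual => 8 | TIntConn => 9 | TAnd => 10
  | TNot => 11
  end.

Definition ord_of_token (a : token) : 'I_12 := inord (nat_of_token a).

Definition token_of_ord (i : 'I_12) : token :=
  nth TVar [:: TVar; TBit false; TBit true; TZero; TOne; TAdd; TMul; TOpp;
               TEqual; TIntConn; TAnd; TNot] i.

Lemma ord_of_tokenK : cancel ord_of_token token_of_ord.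
Proof.
by case=> [|[]|||||||||]; rewrite /token_of_ord /ord_of_token inordK.
Qed.

HB.instance Definition _ := Finite.copy token (can_type ord_of_tokenK).

(* Least significant digit first; 0 is the empty string of digits. *)
Fixpoint bits_of_positive (p : positive) : seq bool :=
  match p with
  | xH => [:: true]
  | xO q => false :: bits_of_positive q
  | xI q => true :: bits_of_positive q
  end.

Definition bits_of_nat (n : nat) : seq bool :=
  if bin_of_nat n is Npos p then bits_of_positive p else [::].

Fixpoint encode_term (t : term) : seq token :=
  match t with
  | Var v => TVar :: map TBit (bits_of_nat v)
  | Zero => [:: TZero]
  | One => [:: TOne]
  | Add t1 t2 => TAdd :: encode_term t1 ++ encode_term t2
  | Mul t1 t2 => TMul :: encode_term t1 ++ encode_term t2
  | Opp t1 => TOpp :: encode_term t1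
  end.

Fixpoint encode (phi : formula) : seq token :=
  match phi with
  | Equal t1 t2 => TEqual :: encode_term t1 ++ encode_term t2
  | IntConn t => TIntConn :: encode_term t
  | And phi1 phi2 => TAnd :: encode phi1 ++ encode phi2
  | Not phi1 => TNot :: encode phi1
  end.

Lemma bits_of_positive_inj : injective bits_of_positive.
Proof.
have ne p : bits_of_positive p <> [::] by case: p.
elim=> [p IH|p IH|] [q|q|] //= [].
- by move/IH->.
- by move/ne.
- by move/IH->.
- by move/esym/ne.
Qed.

Lemma bits_of_nat_inj : injective bits_of_nat.
Proof.
move=> m n; rewrite /bits_of_nat -{2}(bin_of_natK m) -{2}(bin_of_natK n).
case: (bin_of_nat m) (bin_of_nat n) => [|p] [|q] //.
- by case: q.
- by case: p.
- by move/bits_of_positive_inj->.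
Qed.

Definition bit_free (s : seq token) : bool :=
  if s is TBit _ :: _ then false else true.

Lemma encode_term_cat_inj t1 t2 s1 s2 : bit_free s1 -> bit_free s2 ->
  encode_term t1 ++ s1 = encode_term t2 ++ s2 -> t1 = t2 /\ s1 = s2.
Proof.
have bfe t s : bit_free (encode_term t ++ s) by case: t.
elim: t1 t2 s1 s2 => [v|||t IHt u IHu|t IHt u IHu|t IHt]
  [v'|||t' u'|t' u'|t'] s1 s2 b1 b2 //=.
- case=> E; have : bits_of_nat v = bits_of_nat v' /\ s1 = s2.
    elim: (bits_of_nat v) (bits_of_nat v') E => [|x l IH] [|x' l'] //=.
    + by move=> E; move: b1; rewrite E.
    + by move=> E; move: b2; rewrite -E.
    + by case=> -> /IH [-> ->].
  by case=> /bits_of_nat_inj -> ->.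
- by case.
- by case.
- by case; rewrite -!catA => /IHt [] // -> /IHu [] // -> ->.
- by case; rewrite -!catA => /IHt [] // -> /IHu [] // -> ->.
- by case=> /IHt [] // -> ->.
Qed.

Lemma encode_inj : injective encode.
Proof.
have bfe t s : bit_free (encode_term t ++ s) by case: t.
have bff f s : bit_free (encode f ++ s) by case: f.
have key f1 f2 s1 s2 : bit_free s1 -> bit_free s2 ->
    encode f1 ++ s1 = encode f2 ++ s2 -> f1 = f2 /\ s1 = s2.
  elim: f1 f2 s1 s2 => [t u|t|f IHf g IHg|f IHf] [t' u'|t'|f' g'|f'] s1 s2 b1 b2
    //= [].
  - rewrite -!catA => /encode_term_cat_inj [] // -> /encode_term_cat_inj [] //.
    by move=> -> ->.
  - by move=> /encode_term_cat_inj [] // -> ->.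
  - by rewrite -!catA => /IHf [] // -> /IHg [] // -> ->.
  - by move=> /IHf [] // -> ->.
by move=> f1 f2 E; have [] := key f1 f2 [::] [::] isT isT; rewrite ?cats0.
Qed.

Definition language (Sigma : Type) : Type := set (seq Sigma).

Definition Sat_Bc (T : topologicalType) : language token :=
  [set w | exists2 phi : formula, w = encode phi & satisfiable T phi].

Inductive direction : Type := Left | Stay | Right.

Definition option_of_direction (d : direction) : option bool :=
  match d with Left => Some false | Stay => None | Right => Some true end.

Definition direction_of_option (o : option bool) : direction :=
  match o with Some false => Left | None => Stay | Some true => Right end.

Lemma option_of_directionK : cancel option_of_direction direction_of_option.
Proof. by case. Qed.

HB.instance Definition _ :=
  Finite.copy direction (can_type option_of_directionK).

Section Tapes.
Variable A : Type.

(* A two-way infinite tape over [option A], [None] being the blank symbol.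
   [tleft] lists the cells to the left of the head, the nearest one first; all
   cells not listed are blank. *)
Record tape := Tape {
  tleft : seq (option A);
  thead : option A;
  tright : seq (option A) }.

Definition blank_tape : tape := Tape [::] None [::].

Definition tape_of_word (w : seq A) : tape :=
  if w is a :: w' then Tape [::] (Some a) (map Some w') else blank_tape.

Definition write (b : option A) (t : tape) : tape :=
  Tape (tleft t) b (tright t).

Definition shift (d : direction) (t : tape) : tape :=
  match d with
  | Left =>
      Tape (behead (tleft t)) (head None (tleft t)) (thead t :: tright t)
  | Stay => t
  | Right =>
      Tape (thead t :: tleft t) (head None (tright t)) (behead (tright t))
  end.

Fixpoint nonblank_prefix (s : seq (option A)) : seq A :=
  if s is Some a :: s' then a :: nonblank_prefix s' else [::].

(* The word read from the head rightwards up to the first blank. *)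
Definition word_of_tape (t : tape) : seq A :=
  nonblank_prefix (thead t :: tright t).

End Tapes.

Record machine (A : finType) := Machine {
  tapes : nat;  (* there are [tapes.+1] tapes *)
  state : finType;
  start : state;
  accepting : pred state;
  trans : state -> {ffun 'I_tapes.+1 -> option A} ->
    {set state * {ffun 'I_tapes.+1 -> option A * direction}} }.

Section Computations.
Variables (A : finType) (M : machine A).

Definition config : Type :=
  (state M * {ffun 'I_(tapes M).+1 -> tape A})%type.

Definition enabled (c : config) :
    {set state M * {ffun 'I_(tapes M).+1 -> option A * direction}} :=
  trans c.1 [ffun i => thead (c.2 i)].

Definition step (c c' : config) : Prop :=
  exists2 a, a \in enabled c &
    c' = (a.1, [ffun i => shift (a.2 i).2 (write (a.2 i).1 (c.2 i))]).

Fixpoint steps (k : nat) (c c' : config) : Prop :=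
  if k is k'.+1 then exists2 c1, step c c1 & steps k' c1 c' else c = c'.

Definition halted (c : config) : Prop := enabled c = finset.set0.

Definition initial (w : seq A) : config :=
  (start M,
   [ffun i => if i == ord0 then tape_of_word w else blank_tape A]).

Definition output (c : config) : seq A := word_of_tape (c.2 ord0).

Definition deterministic : Prop := forall q s, #|trans (m := M) q s| <= 1.

Definition accepts (w : seq A) : Prop :=
  exists k c, [/\ steps k (initial w) c, halted c & accepting c.1].

End Computations.

(* Every computation of [M] on (the image under [i] of) an input [w] makes at
   most [p (size w)] steps. *)
Definition runs_in_time (Sigma A : finType) (M : machine A) (i : Sigma -> A)
    (p : {poly nat}) : Prop :=
  forall (w : seq Sigma) k (c : config M),
    steps k (initial M (map i w)) c -> k <= p.[size w]%R.

(* The injection [i] presents the input alphabet [Sigma] as a part of the tape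
   alphabet; it never hits the blank symbol. *)
Definition NP (Sigma : finType) (L : language Sigma) : Prop :=
  exists (A : finType) (i : Sigma -> A) (M : machine A) (p : {poly nat}),
    [/\ injective i, runs_in_time M i p &
        forall w, L w <-> accepts M (map i w)].

Definition poly_time_computable (Sigma Sigma' : finType)
    (f : seq Sigma -> seq Sigma') : Prop :=
  exists (A : finType) (i : Sigma -> A) (o : Sigma' -> A) (M : machine A)
         (p : {poly nat}),
    [/\ injective i, injective o, deterministic M, runs_in_time M i p &
        forall w, exists k c,
          [/\ steps k (initial M (map i w)) c, halted c &
              output c = map o (f w)]].

Definition poly_reducible (Sigma Sigma' : finType)
    (L : language Sigma) (L' : language Sigma') : Prop :=
  exists2 f : seq Sigma -> seq Sigma',
    poly_time_computable f & forall w, L w <-> L' (f w).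

Definition NP_hard (Sigma : finType) (L : language Sigma) : Prop :=
  forall (Sigma' : finType) (L' : language Sigma'),
    NP L' -> poly_reducible L' L.

Definition NP_complete (Sigma : finType) (L : language Sigma) : Prop :=
  NP L /\ NP_hard L.

(* Main.v *)
(** Membership.  An interpretation is sampled at points in general position: a
    point for each failing equation and, for each term whose interior splits
    into two parts, points of both parts, a point outside the term, and points
    showing that every region with connected interior either leaves the term or
    meets only one of the parts.  Quadratically many points suffice.

    Conversely, a finite sample with these properties is realized by a variant
    of the lakes of Wada: disjoint connected open sets [U p], one for each
    sample point [p], such that every other point of the space is adherent
    either to all of them or exactly to those belonging to one of the regions
    required to be connected, the latter case occurring for every such region.
    A region of the second kind gets a connected interior, because all its [U p]
    meet at a point that is adherent to no other.  A region missing some sample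
    point is disconnected by any splitting of its sample points that splits no
    required region contained in it, because no other point of its interior
    joins the two parts.  A nondeterministic machine guesses the sample.

    Hardness.  A conjunction of equations is satisfiable over a nonempty space
    iff it is satisfiable in the two-element Boolean algebra, and the tableau of
    a nondeterministic computation can be written as such a conjunction.  Tape
    positions are taken relative to the heads, so that a cell depends only on
    the action performed and on three cells at the previous time.

    Polynomial-time functions are obtained from closure properties: programs act
    on serialized trees with four stacks, which are the tapes of a machine. *)

From HB Require Import structures.
From Corelib Require Import PosDef.
From mathcomp Require Import all_boot all_order all_algebra.
From mathcomp Require Import all_classical all_reals all_analysis.
Import numFieldNormedType.Exports.
From mathcomp Require Import zify ring lra.
Require Import Defs.

Set Implicit Arguments.
Unset Strict Implicit.
Unset Printing Implicit Defensive.

(** * Nondeterministic programs on four stacks *)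

Definition quad (X : Type) : Type := (X * X * X * X)%type.

Definition quad_nth X (s : quad X) (i : nat) : X :=
  let: (s0, s1, s2, s3) := s in nth s0 [:: s0; s1; s2; s3] i.

Definition quad_tab X (f : nat -> X) : quad X := (f 0, f 1, f 2, f 3).

Lemma quad_nth_tab X (f : nat -> X) (i : 'I_4) : quad_nth (quad_tab f) i = f i.
Proof. by case: i => -[|[|[|[|]]]]. Qed.

Lemma quad_tab_nth X (s : quad X) : quad_tab (quad_nth s) = s.
Proof. by case: s => -[[]]. Qed.

Inductive stack_op (A : Type) : Type := Keep | Pop | Push of A.
Arguments Keep {A}.
Arguments Pop {A}.

Definition option_of_stack_op A (o : stack_op A) : option (option A) :=
  match o with Keep => None | Pop => Some None | Push a => Some (Some a) end.

Definition stack_op_of_option A (o : option (option A)) : stack_op A :=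
  match o with None => Keep | Some None => Pop | Some (Some a) => Push a end.

Lemma option_of_stack_opK A :
  cancel (@option_of_stack_op A) (@stack_op_of_option A).
Proof. by case. Qed.

HB.instance Definition _ (A : finType) :=
  Finite.copy (stack_op A) (can_type (@option_of_stack_opK A)).

Definition apply_op A (o : stack_op A) (s : seq A) : seq A :=
  match o with Keep => s | Pop => behead s | Push a => a :: s end.

Lemma size_apply_op A (o : stack_op A) s : size (apply_op o s) <= (size s).+1.
Proof. by case: o => //=; rewrite size_behead; lia. Qed.

(* The quantifier over a nondeterministic bit: the demonic one requires all
   computations to behave well, the angelic one some computation. *)
Definition branches (demonic : bool) (P : bool -> Prop) : Prop :=
  if demonic then forall b, P b else exists b, P b.

Lemma branches_mono d (P P' : bool -> Prop) :
  (forall b, P b -> P' b) -> branches d P -> branches d P'.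
Proof. by case: d => /= PP'; [move=> H b; exact/PP'|case=> b /PP'; exists b]. Qed.

Lemma branches_const d (P : Prop) : P -> branches d (fun=> P).
Proof. by case: d => p //; exists true. Qed.

Lemma branches_exists d (P : bool -> Prop) : branches d P -> exists b, P b.
Proof. by case: d => // /(_ true); exists true. Qed.

Section Programs.
Variable A : finType.

Definition store : Type := quad (seq A).
Definition action : Type := quad (stack_op A).

Definition act (o : action) (s : store) : store :=
  quad_tab (fun i => apply_op (quad_nth o i) (quad_nth s i)).

Definition tops (s : store) : quad (option A) :=
  quad_tab (fun i => ohead (quad_nth s i)).

(* The Boolean argument of [delta] is a nondeterministic bit, and the next
   control state [None] is the exit. *)
Record program := Program {
  control : finType;
  entry : control;
  delta : control -> quad (option A) -> bool -> action * option control }.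

Definition det_prog (F : program) : Prop :=
  forall (q : control F) t, delta q t true = delta q t false.

(* Within [n] steps the program exits in a store satisfying [P]. *)
Fixpoint wp (F : program) (d : bool) n (q : option (control F)) (s : store)
    (P : store -> Prop) {struct n} : Prop :=
  if q is Some q0 then
    if n is n'.+1 then
      branches d (fun b =>
        let r := delta q0 (tops s) b in wp d n' r.2 (act r.1 s) P)
    else False
  else P s.

Definition runs F d s n P := @wp F d n (Some (entry F)) s P.

Lemma wp_mono F d n m q s (P P' : store -> Prop) : n <= m ->
  (forall s', P s' -> P' s') -> @wp F d n q s P -> wp d m q s P'.
Proof.
move=> + PP'; elim: n m q s => [|n IH] [|m] [q|] s //= nm; try exact: PP'.
by apply: branches_mono => b; apply: IH.
Qed.

Lemma runs_le F d n m s P : n <= m -> @runs F d s n P -> runs F d s m P.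
Proof. by move=> nm; apply: wp_mono. Qed.

Lemma runs_mono F d n s (P P' : store -> Prop) :
  (forall s', P s' -> P' s') -> @runs F d s n P -> runs F d s n P'.
Proof. by move=> PP'; apply: wp_mono. Qed.

Lemma wp_main_size F d n q s P : @wp F d n q s P ->
  exists2 s', P s' & size (quad_nth s' 0) <= size (quad_nth s 0) + n.
Proof.
elim: n q s => [|n IH] [q|] s //=; try by exists s; rewrite ?addn0 ?leq_addr.
case/branches_exists=> b /IH [s' Ps' le]; exists s' => //.
apply: leq_trans le _; rewrite addnS -addSn leq_add2r.
exact: size_apply_op.
Qed.

Definition keep_all : action := quad_tab (fun=> Keep).

Lemma act_keep_all s : act keep_all s = s.
Proof. exact: quad_tab_nth. Qed.

Definition prog_do (f : quad (option A) -> bool -> action) : program :=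
  @Program unit tt (fun _ t b => (f t b, None)).

Definition prog_seq (F G : program) : program :=
  @Program (control F + control G)%type (inl (entry F)) (fun q t b =>
    match q with
    | inl q => let r := delta q t b in
        (r.1, Some (if r.2 is Some q' then inl q' else inr (entry G)))
    | inr q => let r := delta q t b in (r.1, omap inr r.2)
    end).

Definition prog_if (c : quad (option A) -> bool) (F G : program) : program :=
  @Program (option (control F + control G)) None (fun q t b =>
    match q with
    | None => (keep_all, Some (Some (if c t then inl (entry F)
                                     else inr (entry G))))
    | Some (inl q) => let r := delta q t b in (r.1, omap (Some \o inl) r.2)
    | Some (inr q) => let r := delta q t b in (r.1, omap (Some \o inr) r.2)
    end).

Definition prog_while (c : quad (option A) -> bool) (F : program) : program :=
  @Program (option (control F)) None (fun q t b =>
    match q with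
    | None => (keep_all, if c t then Some (Some (entry F)) else None)
    | Some q => let r := delta q t b in (r.1, Some r.2)
    end).

Lemma det_do f : (forall t, f t true = f t false) -> det_prog (prog_do f).
Proof. by move=> ft q t /=; rewrite ft. Qed.

Lemma det_seq F G : det_prog F -> det_prog G -> det_prog (prog_seq F G).
Proof. by move=> dF dG [q|q] t /=; rewrite ?dF ?dG. Qed.

Lemma det_if c F G : det_prog F -> det_prog G -> det_prog (prog_if c F G).
Proof. by move=> dF dG [[q|q]|] t //=; rewrite ?dF ?dG. Qed.

Lemma det_while c F : det_prog F -> det_prog (prog_while c F).
Proof. by move=> dF [q|] t //=; rewrite dF. Qed.

Lemma runs_do f d s P :
  branches d (fun b => P (act (f (tops s) b) s)) -> runs (prog_do f) d s 1 P.
Proof. by []. Qed.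

Lemma runs_do_const o d s P : P (act (o (tops s)) s) ->
  runs (prog_do (fun t _ => o t)) d s 1 P.
Proof. by move=> H; apply/runs_do/branches_const. Qed.

(* A program run as a part of a larger one, whose control embeds the control
   of the part and whose exit from the part is [out]. *)
Lemma wp_embed F G d k m (inj : control F -> control G)
    (out : option (control G)) q s P :
  (forall q t b, delta (inj q) t b =
     ((delta q t b).1, if (delta q t b).2 is Some q' then Some (inj q') else out)) ->
  @wp F d k q s (fun s' => wp d m out s' P) ->
  wp d (k + m) (if q is Some q' then Some (inj q') else out) s P.
Proof.
move=> dG; elim: k q s => [|k IH] [q|] s //=.
  by apply: branches_mono => b; rewrite dG; apply: IH.
exact: (@wp_mono G d m (k.+1 + m) out s P P (leq_addl _ _)).
Qed.

Lemma runs_seq F G d s n m P :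
  runs F d s n (fun s' => runs G d s' m P) -> runs (prog_seq F G) d s (n + m) P.
Proof.
move=> H; pose out : option (control (prog_seq F G)) := Some (inr (entry G)).
apply: (@wp_embed F (prog_seq F G) d n m inl out (Some (entry F))) => [q t b|].
  by rewrite /=; case: (_.2).
apply: runs_mono H => s' H; rewrite -[m]addn0.
exact: (@wp_embed G (prog_seq F G) d m 0 inr None (Some (entry G))).
Qed.

Lemma runs_if (c : quad (option A) -> bool) F G d s n P :
  (if c (tops s) then runs F d s n P else runs G d s n P) ->
  runs (prog_if c F G) d s n.+1 P.
Proof.
move=> H; rewrite -[n]addn0.
change (branches d (fun=> @wp (prog_if c F G) d (n + 0) (Some (Some
  (if c (tops s) then inl (entry F) else inr (entry G)))) (act keep_all s) P)).
rewrite act_keep_all; apply: branches_const.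
case: ifP H => _ H.
- exact: (@wp_embed F (prog_if c F G) d n 0 (Some \o inl) None (Some (entry F))).
- exact: (@wp_embed G (prog_if c F G) d n 0 (Some \o inr) None (Some (entry G))).
Qed.

Lemma runs_while_exit (c : quad (option A) -> bool) F d s P :
  ~~ c (tops s) -> P s -> runs (prog_while c F) d s 1 P.
Proof.
move=> /negbTE cs Ps; change (branches d (fun=> @wp (prog_while c F) d 0
  (if c (tops s) then Some (Some (entry F)) else None) (act keep_all s) P)).
by rewrite cs act_keep_all; exact: branches_const.
Qed.

Lemma runs_while_iter (c : quad (option A) -> bool) F d s n m P :
  c (tops s) -> runs F d s n (fun s' => runs (prog_while c F) d s' m P) ->
  runs (prog_while c F) d s (n + m).+1 P.
Proof.
move=> cs H; change (branches d (fun=> @wp (prog_while c F) d (n + m)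
  (if c (tops s) then Some (Some (entry F)) else None) (act keep_all s) P)).
rewrite cs act_keep_all; apply: branches_const.
apply: (@wp_embed F (prog_while c F) d n m Some (Some None) (Some (entry F))) => //.
by move=> q t b /=; case: (_.2).
Qed.

End Programs.

Notation "F ;; G" := (prog_seq F G) (at level 60, right associativity).

(** * Turing machines executing programs *)

Section Performing.
Variables (A : finType) (M : machine A).

Definition heads (c : config M) : {ffun 'I_(tapes M).+1 -> option A} :=
  [ffun i => thead (c.2 i)].

Definition perform (c : config M)
    (a : state M * {ffun 'I_(tapes M).+1 -> option A * direction}) : config M :=
  (a.1, [ffun i => shift (a.2 i).2 (write (a.2 i).1 (c.2 i))]).

Lemma step_set1 (c c' : config M) a :
  enabled c = finset.set1 a -> step c c' <-> c' = perform c a.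
Proof.
move=> E; split=> [[b]|->]; first by rewrite E inE => /eqP ->.
by exists a; rewrite // E inE.
Qed.

Lemma halted_step (c c' : config M) : halted c -> ~ step c c'.
Proof. by move=> hc [a]; rewrite hc inE. Qed.

End Performing.

Section ProgramMachine.
Variables (A : finType) (F : program A) (acc : A).

Definition op_move (o : stack_op A) (a : option A) : option A * direction :=
  match o with
  | Keep => (a, Stay) | Pop => (None, Right) | Push _ => (a, Left)
  end.

Definition op_write (o : stack_op A) (a : option A) : option A * direction :=
  (if o is Push b then Some b else a, Stay).

Local Notation mstate := (option (option (control F) * option (action A))).
Local Notation mview := {ffun 'I_4 -> option A}.
Local Notation maction := (mstate * {ffun 'I_4 -> option A * direction})%type.

Definition quad_of_view (t : mview) : quad (option A) :=
  quad_tab (fun i => t (inord i)).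

Definition move_action (r : action A * option (control F)) (t : mview) : maction :=
  (Some (r.2, Some r.1), [ffun i : 'I_4 => op_move (quad_nth r.1 i) (t i)]).

Definition write_action (r : action A * option (control F)) (t : mview) : maction :=
  (Some (r.2, None), [ffun i : 'I_4 => op_write (quad_nth r.1 i) (t i)]).

Definition exit_action (t : mview) : maction := (None, [ffun i => (t i, Stay)]).

(* A program step takes two machine steps, the heads being moved first and the
   pushed symbols written afterwards.  The control [None] is entered from the
   exit when the main stack shows [acc]. *)
Definition machine_trans (q : mstate) (t : mview) : {set maction} :=
  if q is Some (q', o) then
    if o is Some o then finset.set1 (write_action (o, q') t)
    else if q' is Some q0 then
      [set move_action (delta q0 (quad_of_view t) b) t | b : bool]%SET
    else if t ord0 == Some acc then finset.set1 (exit_action t)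
    else finset.set0
  else finset.set0.

Definition machine_of : machine A :=
  @Machine A 3 mstate (Some (Some (entry F), None)) (pred1 None) machine_trans.

Implicit Types (c : config machine_of) (s : store A) (t : tape A).

Definition holds_stack t (w : seq A) : Prop :=
  exists k, thead t :: tright t = map Some w ++ nseq k None.

Lemma holds_stack_head t w : holds_stack t w -> thead t = ohead w.
Proof. by case: w => [|a w] [[|k]] //= [->]. Qed.

Lemma holds_stack_op t w o : holds_stack t w ->
  let m := op_move o (thead t) in let t' := shift m.2 (write m.1 t) in
  let m' := op_write o (thead t') in
  holds_stack (shift m'.2 (write m'.1 t')) (apply_op o w).
Proof.
case: t => l h r [k] /= E; case: o => [||a] /=; first by exists k.
- case: w E => [|b w] /=; last first.
    by case=> _ ->; case: w => [|c w]; [exists k.-1.+1|exists k]; case: k.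
  by case: k => [|k] // [_ ->]; exists k.-1.+1; case: k.
- by exists k; rewrite /= E.
Qed.

Definition represents c q s : Prop :=
  c.1 = Some (q, None) /\ forall i : 'I_4, holds_stack (c.2 i) (quad_nth s i).

Lemma quad_of_heads c q s : represents c q s -> quad_of_view (heads c) = tops s.
Proof.
case=> _ cs; rewrite /quad_of_view /tops /quad_tab !ffunE.
by rewrite !(holds_stack_head (cs _)) !inordK.
Qed.

Lemma enabled_running c q s : represents c (Some q) s ->
  enabled c = [set move_action (delta q (tops s) b) (heads c) | b : bool]%SET.
Proof. by move=> cs; rewrite -(quad_of_heads cs) /enabled cs.1. Qed.

Lemma enabled_exit c s : represents c None s -> enabled c =
  if ohead (quad_nth s 0) == Some acc then finset.set1 (exit_action (heads c))
  else finset.set0.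
Proof.
by case=> c1 c2; rewrite /enabled c1 /= !ffunE (holds_stack_head (c2 _)).
Qed.

Lemma perform_exit c : perform c (exit_action (heads c)) = (None, c.2).
Proof. by congr pair; apply/ffunP => i; rewrite !ffunE; case: (c.2 i). Qed.

Definition after_move c r : config machine_of := perform c (move_action r (heads c)).

Definition after_write c r : config machine_of :=
  perform (after_move c r) (write_action r (heads (after_move c r))).

Lemma step_after_move c c' r : step (after_move c r) c' <-> c' = after_write c r.
Proof.
apply: (@step_set1 _ machine_of _ _ (write_action r (heads (after_move c r)))).
by case: r.
Qed.

Lemma represents_after_write c q s r :
  represents c q s -> represents (after_write c r) r.2 (act r.1 s).
Proof.
case=> _ cs; split=> // i; rewrite quad_nth_tab.
by have := holds_stack_op (quad_nth r.1 i) (cs i); rewrite !ffunE.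
Qed.

Lemma initial_represents (w : seq A) :
  represents (initial machine_of w) (Some (entry F)) (w, [::], [::], [::]).
Proof.
split=> // i; rewrite ffunE; case: eqP => [->|/eqP].
  by case: w => [|a w] /=; [exists 1|exists 0; rewrite cats0].
by case: i => -[|[|[|[|]]]] // *; exists 1.
Qed.

Lemma det_machine : det_prog F -> deterministic machine_of.
Proof.
move=> dF [[[q|] [p|]]|] t //=; rewrite ?cards1 ?cards0 //.
  set a := move_action (delta q (quad_of_view t) true) t.
  apply: (@leq_trans #|finset.set1 a|); last by rewrite cards1.
  apply/subset_leq_card/fintype.subsetP => x /imsetP [b _ ->]; rewrite inE.
  by case: b; rewrite -?dF.
by case: ifP; rewrite ?cards1 ?cards0.
Qed.

Lemma exit_demonic s P c : P s -> represents c None s ->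
  forall k c', steps k c c' -> k <= 1 /\ (halted c' -> accepting c'.1 ->
    exists2 s', P s' & ohead (quad_nth s' 0) = Some acc).
Proof.
move=> Ps cs; have E := enabled_exit cs; case=> [|k] c' /=.
  by move<-; split=> // _; rewrite cs.1.
case: eqP E => [accs E|_ E] [c1 cc1]; last by case: (halted_step E cc1).
move/(step_set1 _ E): cc1 => ->; rewrite perform_exit.
case: k => [<-|k [c2 cc2]]; first by split=> // _ _; exists s.
by case: (@halted_step _ machine_of _ _ _ cc2).
Qed.

Lemma machine_demonic n c q s P : wp true n q s P -> represents c q s ->
  forall k c', steps k c c' -> k <= n.*2.+1 /\ (halted c' -> accepting c'.1 ->
    exists2 s', P s' & ohead (quad_nth s' 0) = Some acc).
Proof.
elim: n c q s => [|n IH] c [q|] s //.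
- exact: exit_demonic.
- move=> /= H cs [|k] c' /=; first by move<-; split=> //; rewrite cs.1.
  case=> _ [a + ->]; rewrite (enabled_running cs) => /imsetP [b _ ->].
  case: k => [|k] /=; first by move<-.
  case=> c2 /step_after_move -> /(IH _ _ _ (H b) (represents_after_write _ cs)).
  by case=> kn ?; split.
- move=> Ps cs k c' /(exit_demonic Ps cs) [k1 ?]; split=> //.
  exact: leq_trans k1 _.
Qed.

Lemma exit_angelic s P c : P s -> represents c None s -> exists k c' s',
  [/\ steps k c c', halted c', P s', holds_stack (c'.2 ord0) (quad_nth s' 0) &
      accepting c'.1 = (ohead (quad_nth s' 0) == Some acc)].
Proof.
move=> Ps cs; have := enabled_exit cs; have [accs|accs] := eqP => E.
- exists 1, (None, c.2), s; split=> //; last by rewrite accs eqxx.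
    by exists (None, c.2) => //; apply/(step_set1 _ E); rewrite perform_exit.
  exact: cs.2.
- exists 0, c, s; split=> //; first exact: cs.2.
  by rewrite cs.1 /=; apply/esym/eqP.
Qed.

Lemma machine_angelic n c q s P : wp false n q s P -> represents c q s ->
  exists k c' s', [/\ steps k c c', halted c', P s',
    holds_stack (c'.2 ord0) (quad_nth s' 0) &
    accepting c'.1 = (ohead (quad_nth s' 0) == Some acc)].
Proof.
elim: n c q s => [|n IH] c [q|] s //; try exact: exit_angelic.
case=> b H cs; set r := delta q (tops s) b in H.
have [k [c' [s' [st hc Ps top ac]]]] := IH _ _ _ H (represents_after_write r cs).
exists k.+2, c', s'; split=> //; exists (after_move c r).
  exists (move_action r (heads c)) => //.
  by rewrite (enabled_running cs); apply/imsetP; exists b.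
by exists (after_write c r) => //; apply/step_after_move.
Qed.

End ProgramMachine.

(** * Programs on serialized trees *)

Definition poly_bounded (q : nat -> nat) : Prop :=
  exists c, forall n, q n <= n.+2 ^ c.

Lemma leq_expn2r c m n : m <= n -> m ^ c <= n ^ c.
Proof. by move=> mn; elim: c => // c IH; rewrite !expnS leq_mul. Qed.

Lemma poly_bounded_id : poly_bounded id.
Proof. by exists 1 => n; rewrite expn1; lia. Qed.

Lemma poly_bounded_const k : poly_bounded (fun=> k).
Proof.
exists k => n; apply: leq_trans (ltnW (ltn_expl k (isT : 1 < 2))) _.
by rewrite leq_expn2r.
Qed.

Lemma poly_bounded_mul q r :
  poly_bounded q -> poly_bounded r -> poly_bounded (fun n => q n * r n).
Proof. by case=> c qc [e re]; exists (c + e) => n; rewrite expnD leq_mul. Qed.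

Lemma poly_bounded_add q r :
  poly_bounded q -> poly_bounded r -> poly_bounded (fun n => q n + r n).
Proof.
case=> c qc [e re]; exists (c + e).+1 => n.
have : n.+2 ^ c <= n.+2 ^ (c + e) by rewrite leq_pexp2l // leq_addr.
have : n.+2 ^ e <= n.+2 ^ (c + e) by rewrite leq_pexp2l // leq_addl.
by rewrite expnS; have := qc n; have := re n; nia.
Qed.

Lemma poly_bounded_comp q r : poly_bounded q -> poly_bounded r ->
  exists2 q', poly_bounded q' & forall n m, m <= r n -> q m <= q' n.
Proof.
case=> c qc [e re]; exists (fun n => n.+2 ^ (e.+2 * c)); first by eexists.
move=> n m mr; apply: leq_trans (qc m) _; rewrite expnM leq_expn2r //.
have : m <= n.+2 ^ e by apply: leq_trans (re n).
have : 0 < n.+2 ^ e by rewrite expn_gt0.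
by rewrite !expnS; nia.
Qed.

Lemma poly_bounded_homo q : poly_bounded q ->
  exists q', [/\ poly_bounded q', {homo q' : m n / m <= n} & forall n, q n <= q' n].
Proof.
case=> c qc; exists (fun n => n.+2 ^ c); split=> //; first by exists c.
by move=> m n mn; rewrite leq_expn2r.
Qed.

Ltac poly_bound := repeat first
  [ assumption | exact: poly_bounded_const | exact: poly_bounded_id
  | apply: poly_bounded_add | apply: poly_bounded_mul ].

Section Transfer.
Variable A : finType.

Lemma eq_quad_tab X (f g : nat -> X) :
  (forall i : 'I_4, f i = g i) -> quad_tab f = quad_tab g.
Proof.
move=> fg; rewrite /quad_tab; congr (_, _, _, _).
- exact: (fg (@Ordinal 4 0 isT)).
- exact: (fg (@Ordinal 4 1 isT)).
- exact: (fg (@Ordinal 4 2 isT)).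
- exact: (fg (@Ordinal 4 3 isT)).
Qed.

Definition prog_skip : program A := prog_do (fun _ _ => keep_all A).

Definition prog_push (a : A) : program A :=
  prog_do (fun _ _ => (Push a, Keep, Keep, Keep)).

Definition prog_pop : program A := prog_do (fun _ _ => (Pop, Keep, Keep, Keep)).

(* Stack [i] is emptied, its symbols being pushed onto the stacks of [D]. *)
Definition prog_move (i : nat) (D : seq nat) : program A :=
  prog_while (fun t => isSome (quad_nth t i)) (prog_do (fun t _ =>
    if quad_nth t i is Some a then
      quad_tab (fun j => if j == i then Pop else if j \in D then Push a else Keep)
    else keep_all A)).

Lemma runs_move i D d (s : store A) n P : i < 4 -> size (quad_nth s i) <= n ->
  P (quad_tab (fun j => if j == i then [::] else
       if j \in D then rev (quad_nth s i) ++ quad_nth s j else quad_nth s j)) ->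
  runs (prog_move i D) d s (2 * n + 1) P.
Proof.
move=> i4 sn Ps; apply: (runs_le (n := 2 * size (quad_nth s i) + 1)); first by lia.
have top s' : quad_nth (tops s') i = ohead (quad_nth s' i).
  exact: (quad_nth_tab _ (Ordinal i4)).
have [w Es] : exists w, quad_nth s i = w by exists (quad_nth s i).
elim: w s Es Ps {sn} => [|a w IH] s Es Ps; rewrite Es.
  apply: runs_while_exit; first by rewrite top Es.
  move: Ps; congr P; rewrite -[RHS]quad_tab_nth; apply: eq_quad_tab => j.
  by case: eqP => [->|_] //; case: ifP; rewrite ?Es.
rewrite /= mulnS -addnA; apply: (@runs_while_iter _ _ _ _ _ 1); rewrite ?top ?Es //.
apply: runs_do_const; rewrite top Es /=; set s' := act _ s.
have Es' : quad_nth s' i = w.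
  by rewrite (quad_nth_tab _ (Ordinal i4)) (quad_nth_tab _ (Ordinal i4)) /= eqxx Es.
rewrite -Es'; apply: IH => //.
move: Ps; congr P; apply: eq_quad_tab => j; rewrite !quad_nth_tab Es Es'.
by case: eqP => // _; case: ifP => // _; rewrite rev_cons cat_rcons.
Qed.

End Transfer.
Arguments prog_skip {A}.
Arguments prog_pop {A}.
Arguments prog_move {A}.

Ltac det_program := repeat first
  [ assumption | apply: det_seq | apply: det_if | apply: det_while
  | by apply: det_do ].

Inductive tree (L : Type) : Type := Leaf of L | Node of tree L & tree L.

Section Trees.
Variable L : finType.
Local Arguments quad_tab X f /.
Local Notation symbol := (option L).

Fixpoint serialize (x : tree L) : seq symbol :=
  match x with
  | Leaf l => [:: Some l]
  | Node x1 x2 => None :: serialize x1 ++ serialize x2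
  end.

Definition tree_size x := size (serialize x).

Lemma tree_size_gt0 x : 0 < tree_size x. Proof. by case: x. Qed.

Lemma tree_size_node x1 x2 :
  tree_size (Node x1 x2) = (tree_size x1 + tree_size x2).+1.
Proof. by rewrite /tree_size /= size_cat. Qed.

Definition main_store (w : seq symbol) : store symbol := (w, [::], [::], [::]).

(* [K] holds of the tree obtained by relabelling the leaves by [h], which is
   controlled by nondeterministic bits. *)
Fixpoint relabel (d : bool) (h : bool -> L -> L) x (K : tree L -> Prop) : Prop :=
  match x with
  | Leaf l => branches d (fun b => K (Leaf (h b l)))
  | Node x1 x2 => relabel d h x1 (fun y1 => relabel d h x2 (fun y2 => K (Node y1 y2)))
  end.

Lemma relabel_mono d h x (K K' : tree L -> Prop) : (forall y, K y -> K' y) ->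
  relabel d h x K -> relabel d h x K'.
Proof.
elim: x K K' => [l|x1 IH1 x2 IH2] K K' KK' /=.
  by apply: branches_mono => b; apply: KK'.
by apply: IH1 => y1; apply: IH2 => y2; apply: KK'.
Qed.

Lemma relabel_id d x (K : tree L -> Prop) : K x -> relabel d (fun=> id) x K.
Proof.
elim: x K => [l|x1 IH1 x2 IH2] K Kx /=; first exact: branches_const.
exact/IH1/IH2.
Qed.

(* The serialization of the tree on the main stack is moved to stack 1, in
   reverse; stack 3 counts the subtrees still to be read. *)
Definition prog_relabel (h : bool -> L -> L) : program symbol :=
  prog_do (fun _ _ => (Keep, Keep, Keep, Push None)) ;;
  prog_while (fun t => isSome (quad_nth t 3)) (prog_do (fun t b =>
    match quad_nth t 0 with
    | Some None => (Pop, Push None, Keep, Push None)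
    | Some (Some l) => (Pop, Push (Some (h b l)), Keep, Pop)
    | None => (Keep, Keep, Keep, Pop)
    end)).

Lemma runs_relabel d h x w r1 r2 P :
  relabel d h x (fun y => P (w, rev (serialize y) ++ r1, r2, [::])) ->
  runs (prog_relabel h) d (serialize x ++ w, r1, r2, [::]) (2 * tree_size x + 2) P.
Proof.
rewrite /prog_relabel; set loop := prog_while _ _ => H.
have subtree y w' r1' c m :
    relabel d h y (fun z => runs loop d (w', rev (serialize z) ++ r1', r2, c) m P) ->
    runs loop d (serialize y ++ w', r1', r2, None :: c) (2 * tree_size y + m) P.
  elim: y w' r1' c m => [l|y1 IH1 y2 IH2] w' r1' c m /= K.
    exact: (@runs_while_iter _ _ _ _ _ 1 m).
  have -> : 2 * tree_size (Node y1 y2) + m =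
      (1 + (2 * tree_size y1 + (2 * tree_size y2 + m))).+1.
    by rewrite tree_size_node; lia.
  rewrite -catA; apply: runs_while_iter => //; apply: runs_do.
  apply: (@branches_mono d (fun=> runs loop d (serialize y1 ++ serialize y2 ++ w',
    None :: r1', r2, None :: None :: c)
    (2 * tree_size y1 + (2 * tree_size y2 + m)) P)) => //.
  apply: branches_const; apply: IH1; move: K.
  apply: relabel_mono => z1 K; apply: IH2; move: K; apply: relabel_mono => z2.
  by rewrite rev_cons rev_cat cat_rcons -catA.
apply: (runs_le (n := 1 + (2 * tree_size x + 1))); first by lia.
apply: runs_seq; apply: runs_do_const; apply: subtree.
by move: H; apply: relabel_mono => y Py; apply: runs_while_exit.
Qed.

Definition prog_take : program symbol := prog_relabel (fun=> id).

Definition prog_dup : program symbol :=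
  prog_take ;; prog_move 1 [:: 0; 2] ;; prog_move 2 [:: 3] ;; prog_move 3 [:: 0].

Definition prog_swap : program symbol :=
  prog_take ;; prog_move 1 [:: 2] ;; prog_take ;;
  prog_move 2 [:: 3] ;; prog_move 3 [:: 0] ;; prog_move 1 [:: 0].

Definition prog_drop : program symbol := prog_take ;; prog_move 1 [::].

Definition prog_insert (a : symbol) : program symbol :=
  prog_take ;; prog_push a ;; prog_move 1 [:: 0].

Fixpoint prog_push_word (w : seq symbol) : program symbol :=
  if w is a :: w' then prog_push_word w' ;; prog_push a else prog_skip.

Lemma det_push_word w : det_prog (prog_push_word w).
Proof. by elim: w => [|a w IH] /=; det_program. Qed.

Lemma runs_push a d w P :
  P (main_store (a :: w)) -> runs (prog_push a) d (main_store w) 1 P.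
Proof. by move=> H; apply: runs_do_const. Qed.

Lemma runs_pop d w P :
  P (main_store (behead w)) -> runs prog_pop d (main_store w) 1 P.
Proof. by move=> H; apply: runs_do_const. Qed.

Lemma runs_push_word v d w P : P (main_store (v ++ w)) ->
  runs (prog_push_word v) d (main_store w) (size v).+1 P.
Proof.
elim: v P => [|a v IH] P Pvw; first exact: runs_do_const.
by rewrite -addn1; apply: runs_seq; apply: IH; apply: runs_push.
Qed.

Lemma runs_take d x w r1 r2 P : P (w, rev (serialize x) ++ r1, r2, [::]) ->
  runs prog_take d (serialize x ++ w, r1, r2, [::]) (2 * tree_size x + 2) P.
Proof. by move=> H; apply: runs_relabel; apply: relabel_id. Qed.

Lemma runs_dup d x w P : P (main_store (serialize x ++ serialize x ++ w)) ->
  runs prog_dup d (main_store (serialize x ++ w)) (8 * tree_size x + 5) P.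
Proof.
set n := tree_size x => H.
apply: (runs_le (n := (2 * n + 2) + ((2 * n + 1) + ((2 * n + 1) + (2 * n + 1))))).
  by lia.
apply: runs_seq; apply: runs_take; rewrite cats0.
apply: runs_seq; apply: runs_move; rewrite //= ?size_rev // revK cats0.
apply: runs_seq; apply: runs_move; rewrite //= ?size_rev // cats0.
by apply: runs_move; rewrite //= ?size_rev // revK.
Qed.

Lemma runs_swap d x y w P : P (main_store (serialize y ++ serialize x ++ w)) ->
  runs prog_swap d (main_store (serialize x ++ serialize y ++ w))
    (8 * tree_size x + 4 * tree_size y + 8) P.
Proof.
set n := tree_size x; set m := tree_size y => H.
apply: (runs_le (n := (2 * n + 2) + ((2 * n + 1) + ((2 * m + 2) +
  ((2 * n + 1) + ((2 * n + 1) + (2 * m + 1))))))); first by lia.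
apply: runs_seq; apply: runs_take; rewrite cats0.
apply: runs_seq; apply: runs_move; rewrite //= ?size_rev // revK cats0.
apply: runs_seq; apply: runs_take; rewrite cats0.
apply: runs_seq; apply: runs_move; rewrite //= ?size_rev // cats0.
apply: runs_seq; apply: runs_move; rewrite //= ?size_rev // revK.
by apply: runs_move; rewrite //= ?size_rev // revK.
Qed.

Lemma runs_drop d x w P : P (main_store w) ->
  runs prog_drop d (main_store (serialize x ++ w)) (4 * tree_size x + 3) P.
Proof.
set n := tree_size x => H.
apply: (runs_le (n := (2 * n + 2) + (2 * n + 1))); first by lia.
apply: runs_seq; apply: runs_take; rewrite cats0.
by apply: runs_move; rewrite //= size_rev.
Qed.

Lemma runs_insert a d x w P : P (main_store (serialize x ++ a :: w)) ->
  runs (prog_insert a) d (main_store (serialize x ++ w)) (4 * tree_size x + 4) P.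
Proof.
set n := tree_size x => H.
apply: (runs_le (n := (2 * n + 2) + (1 + (2 * n + 1)))); first by lia.
apply: runs_seq; apply: runs_take; rewrite cats0.
apply: runs_seq; apply: runs_do_const.
by apply: runs_move; rewrite //= ?size_rev // revK.
Qed.

End Trees.
Arguments prog_take {L}.
Arguments prog_dup {L}.
Arguments prog_swap {L}.
Arguments prog_drop {L}.

(** * Polynomial-time functions *)

Section Encodings.
Variable Sigma : finType.

Definition label : finType := ((unit + bool) + (Sigma + token))%type.
Definition nil_label : label := inl (inl tt).
Definition bool_label (b : bool) : label := inl (inr b).
Definition letter_label (a : Sigma) : label := inr (inl a).
Definition token_label (a : token) : label := inr (inr a).

Class encodable (X : Type) := tree_of : X -> tree label.

Fixpoint tree_of_list X (eX : encodable X) (s : seq X) : tree label :=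
  if s is x :: s' then Node (tree_of x) (tree_of_list eX s') else Leaf nil_label.

#[global] Instance encodable_unit : encodable unit := fun _ => Leaf nil_label.
#[global] Instance encodable_bool : encodable bool := fun b => Leaf (bool_label b).
#[global] Instance encodable_letter : encodable Sigma :=
  fun a => Leaf (letter_label a).
#[global] Instance encodable_token : encodable token :=
  fun a => Leaf (token_label a).
#[global] Instance encodable_pair X Y (eX : encodable X) (eY : encodable Y) :
  encodable (X * Y) := fun p => Node (tree_of p.1) (tree_of p.2).
#[global] Instance encodable_seq X (eX : encodable X) : encodable (seq X) :=
  tree_of_list eX.
#[global] Instance encodable_nat : encodable nat := fun n => tree_of (nseq n tt).
#[global] Instance encodable_term : encodable term :=
  fun t => tree_of (encode_term t).

Definition enc_size X (eX : encodable X) (x : X) : nat := tree_size (tree_of x).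

Definition stored X (eX : encodable X) (x : X) (w : seq (option label)) :=
  main_store (serialize (tree_of x) ++ w).

Definition computes X Y (eX : encodable X) (eY : encodable Y)
    (F : program (option label)) (q : nat -> nat) (f : X -> Y) : Prop :=
  forall d x w P, P (stored eY (f x) w) -> runs F d (stored eX x w) (q (enc_size eX x)) P.

Definition polytime X Y (eX : encodable X) (eY : encodable Y) (f : X -> Y) : Prop :=
  exists F q, [/\ det_prog F, poly_bounded q & computes eX eY F q f].

End Encodings.
Arguments tree_of {Sigma X encodable} x.
Arguments enc_size {Sigma X eX} x.
Arguments stored {Sigma X eX} x w.
Arguments computes {Sigma X Y eX eY} F q f.
Arguments polytime {Sigma X Y eX eY} f.

Section Basic.
Variable Sigma : finType.
Local Notation encodable := (encodable Sigma).
Local Notation polytime := (@polytime Sigma _ _ _ _).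
Local Notation enc_size := (@enc_size Sigma _ _).

Lemma enc_size_gt0 X (eX : encodable X) (x : X) : 0 < enc_size x.
Proof. exact: tree_size_gt0. Qed.

Lemma enc_size_nil X (eX : encodable X) : enc_size ([::] : seq X) = 1.
Proof. by []. Qed.

Lemma enc_size_cons X (eX : encodable X) (x : X) s :
  enc_size (x :: s) = (enc_size x + enc_size s).+1.
Proof. exact: tree_size_node. Qed.

Lemma enc_size_pair X Y (eX : encodable X) (eY : encodable Y) (x : X) (y : Y) :
  enc_size (x, y) = (enc_size x + enc_size y).+1.
Proof. exact: tree_size_node. Qed.

Lemma enc_size_bool (b : bool) : enc_size b = 1. Proof. by []. Qed.

Lemma enc_size_nat n : enc_size n = n.*2.+1.
Proof.
elim: n => // n IH; rewrite (_ : enc_size n.+1 = enc_size (tt :: nseq n tt)) //.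
rewrite enc_size_cons (_ : enc_size (nseq n tt) = enc_size n) // IH.
by rewrite (_ : enc_size tt = 1) //; lia.
Qed.

Lemma ltn_size_enc_size X (eX : encodable X) (s : seq X) : size s < enc_size s.
Proof.
elim: s => // x s IH; rewrite enc_size_cons /=.
by have := enc_size_gt0 eX x; lia.
Qed.

Lemma enc_size_take X (eX : encodable X) k (s : seq X) :
  enc_size (take k s) <= enc_size s.
Proof.
elim: s k => [|x s IH] [|k] //=; rewrite ?enc_size_nil ?enc_size_cons //.
by rewrite ltnS leq_add2l.
Qed.

Lemma enc_size_drop X (eX : encodable X) k (s : seq X) :
  enc_size (drop k s) <= enc_size s.
Proof.
elim: s k => [|x s IH] [|k] //=; rewrite enc_size_cons.
by have := IH k; lia.
Qed.

Lemma enc_size_behead X (eX : encodable X) (s : seq X) :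
  enc_size (behead s) <= enc_size s.
Proof. by rewrite -drop1 enc_size_drop. Qed.

Lemma enc_size_cat X (eX : encodable X) (s t : seq X) :
  enc_size (s ++ t) <= enc_size s + enc_size t.
Proof.
elim: s => [|x s IH]; first by rewrite leq_addl.
by rewrite cat_cons !enc_size_cons; lia.
Qed.

Section Elimination.
Variables (X Y : Type) (eX : encodable X) (eY : encodable Y).

Lemma polytimeE (f : X -> Y) : polytime f -> exists F q,
  [/\ det_prog F, poly_bounded q, {homo q : m n / m <= n}, computes F q f &
      forall x, enc_size (f x) <= enc_size x + q (enc_size x)].
Proof.
case=> F [q0 [dF pq0 comp0]].
have [q [pq mq q0q]] := poly_bounded_homo pq0.
have comp : computes F q f.
  by move=> d x w P Pf; apply: runs_le (q0q _) _; apply: comp0.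
exists F, q; split=> // x.
have [s' <-] := wp_main_size (comp true x [::] (eq _) erefl).
by rewrite /= !cats0.
Qed.

Lemma polytime_enc_size (f : X -> Y) : polytime f -> exists q,
  [/\ poly_bounded q, {homo q : m n / m <= n} &
      forall x, enc_size (f x) <= q (enc_size x)].
Proof.
case/polytimeE=> F [q [_ pq mq _ size_f]]; exists (fun n => n + q n); split=> //.
- by poly_bound.
- by move=> m n mn; apply: leq_add => //; apply: mq.
Qed.

Lemma eq_polytime (f g : X -> Y) : f =1 g -> polytime f -> polytime g.
Proof. by move=> /funext ->. Qed.

End Elimination.

Section Composition.
Variables (X Y Z : Type) (eX : encodable X) (eY : encodable Y) (eZ : encodable Z).

(* Functions whose values have the same code need not be distinguished. *)
Lemma polytime_recode (f : X -> Y) (g : X -> Z) :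
  (forall x, tree_of (f x) = tree_of (g x)) -> polytime g -> polytime f.
Proof.
move=> fg [F [q [dF pq comp]]]; exists F, q; split=> // d x w P.
by rewrite /stored fg; apply: comp.
Qed.

Lemma polytime_id : polytime (fun x : X => x).
Proof.
exists prog_skip, (fun=> 1); split; [by det_program|exact: poly_bounded_const|].
by move=> d x w P H; apply: runs_do_const.
Qed.

Lemma polytime_const (y : Y) : polytime (fun _ : X => y).
Proof.
exists (prog_drop ;; prog_push_word (serialize (tree_of y))),
  (fun n => (4 * n + 3) + (enc_size y).+1); split.
- by apply: det_seq; [det_program|exact: det_push_word].
- by poly_bound.
by move=> d x w P H; apply: runs_seq; apply: runs_drop; apply: runs_push_word.
Qed.

Lemma polytime_comp (g : Y -> Z) (f : X -> Y) :
  polytime g -> polytime f -> polytime (fun x => g (f x)).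
Proof.
move=> [G [r [dG pr compG]]] /polytimeE [F [q [dF pq mq compF size_f]]].
have [r' pr' rr'] := poly_bounded_comp pr (poly_bounded_add poly_bounded_id pq).
exists (F ;; G), (fun n => q n + r' n); split; [by det_program|by poly_bound|].
move=> d x w P H; apply: runs_seq; apply: compF.
by apply: runs_le (rr' _ _ (size_f x)) _; apply: compG.
Qed.

Lemma polytime_pair (f : X -> Y) (g : X -> Z) :
  polytime f -> polytime g -> polytime (fun x => (f x, g x)).
Proof.
move=> [F [q [dF pq compF]]] /polytimeE [G [r [dG pr mr compG size_g]]].
exists (prog_dup ;; G ;; prog_swap ;; F ;; prog_push None),
  (fun n => (8 * n + 5) + (r n + ((8 * (n + r n) + 4 * n + 8) + (q n + 1)))).
split; [by det_program|by poly_bound|].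
move=> d x w P H; apply: runs_seq; apply: runs_dup.
apply: runs_seq; apply: compG.
apply: runs_seq; apply: (runs_le (n := 8 * enc_size (g x) + 4 * enc_size x + 8)).
  by have := size_g x; lia.
apply: runs_swap; apply: runs_seq; apply: compF; apply: runs_push.
by move: H; rewrite /stored /= -catA.
Qed.

End Composition.

Section Projections.
Variables (X Y Z : Type) (eX : encodable X) (eY : encodable Y) (eZ : encodable Z).

Lemma polytime_fst (f : X -> Y * Z) : polytime f -> polytime (fun x => (f x).1).
Proof.
apply: (polytime_comp (g := fst)); exists (prog_pop ;; prog_swap ;; prog_drop),
  (fun n => 1 + ((12 * n + 8) + (4 * n + 3))).
split; [by det_program|by poly_bound|move=> d [y z] w P Py].
have size_yz := enc_size_pair eY eZ y z; rewrite /stored /= -catA.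
apply: runs_seq; apply: runs_pop => /=.
apply: runs_seq; apply: (runs_le (n := 8 * enc_size y + 4 * enc_size z + 8)).
  by lia.
apply: runs_swap; apply: (runs_le (n := 4 * enc_size z + 3)); first by lia.
exact: runs_drop.
Qed.

Lemma polytime_snd (f : X -> Y * Z) : polytime f -> polytime (fun x => (f x).2).
Proof.
apply: (polytime_comp (g := snd)); exists (prog_pop ;; prog_drop),
  (fun n => 1 + (4 * n + 3)).
split; [by det_program|by poly_bound|move=> d [y z] w P Pz].
have size_yz := enc_size_pair eY eZ y z; rewrite /stored /= -catA.
apply: runs_seq; apply: runs_pop => /=.
apply: (runs_le (n := 4 * enc_size y + 3)); first by lia.
exact: runs_drop.
Qed.

Lemma polytime_comp2 W (eW : encodable W) (g : Y -> Z -> W) (a : X -> Y) (b : X -> Z) :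
  polytime (fun p => g p.1 p.2) -> polytime a -> polytime b ->
  polytime (fun x => g (a x) (b x)).
Proof. by move=> pg pa pb; exact: (polytime_comp pg (polytime_pair pa pb)). Qed.

End Projections.

Section Branching.
Variables (X Y Z : Type) (eX : encodable X) (eY : encodable Y) (eZ : encodable Z).

(* The branch is chosen by the root label of the code of [l x], which is then
   left on the main stack above the input. *)
Lemma polytime_branch (l : X -> Z) (c : option (label Sigma) -> bool) (f : X -> Y)
    (F G : program (option (label Sigma))) qF qG :
  polytime l -> det_prog F -> det_prog G -> poly_bounded qF -> poly_bounded qG ->
  (forall d x w P, P (stored (f x) w) ->
     let s := main_store
       (serialize (tree_of (l x)) ++ serialize (tree_of x) ++ w) in
     let n := enc_size (l x) + enc_size x in
     if c (head None (serialize (tree_of (l x))))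
     then runs F d s (qF n) P else runs G d s (qG n) P) ->
  polytime f.
Proof.
move=> /polytimeE [K [q [dK pq mq compK size_l]]] dF dG pF pG H.
have pn : poly_bounded (fun n => (n + n) + q n) by poly_bound.
have [qF' pF' leF] := poly_bounded_comp pF pn.
have [qG' pG' leG] := poly_bounded_comp pG pn.
pose test (t : quad (option (option (label Sigma)))) :=
  if quad_nth t 0 is Some a then c a else false.
exists (prog_dup ;; K ;; prog_if test F G),
  (fun n => (8 * n + 5) + (q n + (1 + (qF' n + qG' n)))).
split; [by det_program|by poly_bound|move=> d x w P Pf].
apply: runs_seq; apply: runs_dup; apply: runs_seq; apply: compK.
rewrite add1n; apply: runs_if.
rewrite (_ : test _ = c (head None (serialize (tree_of (l x))))); last first.
  by rewrite /stored; case: (tree_of (l x)).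
have le : enc_size (l x) + enc_size x <= (enc_size x + enc_size x) + q (enc_size x).
  by have := size_l x; lia.
have := H d x w P Pf; case: ifP => _; apply: runs_le.
  by apply: leq_trans (leq_addr _ _); apply: leF.
by apply: leq_trans (leq_addl _ _); apply: leG.
Qed.

End Branching.

Section Conditionals.
Variables (X Y Z : Type) (eX : encodable X) (eY : encodable Y) (eZ : encodable Z).

Lemma polytime_if (b : X -> bool) (f g : X -> Y) :
  polytime b -> polytime f -> polytime g -> polytime (fun x => if b x then f x else g x).
Proof.
move=> pb /polytimeE [F [q [dF pq mq compF _]]] /polytimeE [G [r [dG pr mr compG _]]].
apply: (@polytime_branch _ _ _ _ _ _ b (pred1 (Some (bool_label Sigma true))) _
  (prog_pop ;; F) (prog_pop ;; G) (fun n => 1 + q n) (fun n => 1 + r n)) => //;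
  try by [det_program | poly_bound].
move=> d x w P; case: (b x) => Pf /=; apply: runs_seq; apply: runs_pop => /=.
  by apply: (runs_le (n := q (enc_size x))); [apply: mq; lia|apply: compF].
by apply: (runs_le (n := r (enc_size x))); [apply: mr; lia|apply: compG].
Qed.

Lemma polytime_list_case (l : X -> seq Z) (f : X -> Y) (g : Z -> seq Z -> X -> Y) :
  polytime l -> polytime f -> polytime (fun p => g p.1.1 p.1.2 p.2) ->
  polytime (fun x => if l x is z :: s then g z s x else f x).
Proof.
move=> pl /polytimeE [F [q [dF pq mq compF _]]] /polytimeE [G [r [dG pr mr compG _]]].
have [r' pr' rr'] := poly_bounded_comp pr
  (poly_bounded_add poly_bounded_id (poly_bounded_const 1)).
apply: (@polytime_branch _ _ _ _ _ _ l (pred1 None) _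
  (prog_push None ;; G) (prog_pop ;; F) (fun n => 1 + r' n) (fun n => 1 + q n)) => //;
  try by [det_program | poly_bound].
move=> d x w P; case: (l x) => [|z s] Pf /=.
  apply: runs_seq; apply: runs_pop => /=.
  by apply: (runs_le (n := q (enc_size x))); [apply: mq; lia|apply: compF].
apply: runs_seq; apply: runs_push.
pose p := (z, s, x); have size_p : enc_size p = (enc_size (z :: s) + enc_size x).+1.
  by rewrite !enc_size_pair enc_size_cons.
apply: (runs_le (n := r (enc_size p))); first by apply: rr'; lia.
rewrite (_ : None :: _ = serialize (tree_of p) ++ w); first exact: compG.
by rewrite /= -!catA.
Qed.

End Conditionals.

Section FoldLeft.
Variables (Y S : Type) (eY : encodable Y) (eS : encodable S) (h : Y -> S -> S).
Variables (H : program (option (label Sigma))) (q : nat -> nat).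
Hypothesis compH : computes H q (fun p : Y * S => h p.1 p.2).
Hypothesis q_homo : {homo q : m n / m <= n}.

Local Notation fold := (foldl (fun s y => h y s)).

(* From the node of a nonempty list [y :: l] above the state [s] to the list
   [l] above the state [h y s]. *)
Definition fold_body : program (option (label Sigma)) :=
  prog_pop ;; prog_swap ;; prog_insert None ;; prog_swap ;; H ;; prog_swap.

Definition fold_loop : program (option (label Sigma)) :=
  prog_while (fun t => quad_nth t 0 == Some None) fold_body.

(* Bound for lists of size at most [n] and states of size at most [m]. *)
Definition fold_cost n m : nat :=
  1 + ((12 * n + 8) + ((4 * n + 4) + ((8 * n + 4 * (n + m + 1) + 8) +
    (q (n + m + 1) + (8 * m + 4 * n + 8))))).

Lemma runs_fold_body n m d y (l : seq Y) (s : S) w P :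
  enc_size (y :: l) <= n -> enc_size s <= m -> enc_size (h y s) <= m ->
  P (main_store (serialize (tree_of l) ++ serialize (tree_of (h y s)) ++ w)) ->
  runs fold_body d (main_store
    (serialize (tree_of (y :: l)) ++ serialize (tree_of s) ++ w)) (fold_cost n m) P.
Proof.
rewrite enc_size_cons => yl_n sm hm Ps.
apply: runs_seq; apply: runs_pop; rewrite [behead _]/= -catA.
apply: runs_seq; apply: (runs_le (n := 8 * enc_size y + 4 * enc_size l + 8)).
  by lia.
apply: runs_swap; apply: runs_seq.
apply: (runs_le (n := 4 * enc_size l + 4)); first by lia.
apply: runs_insert.
pose p := (y, s); have size_p := enc_size_pair eY eS y s.
rewrite (_ : None :: _ = serialize (tree_of p) ++ w); last by rewrite /= -catA.
apply: runs_seq; apply: (runs_le (n := 8 * enc_size l + 4 * enc_size p + 8)).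
  by rewrite /p; lia.
apply: runs_swap; apply: runs_seq.
apply: (runs_le (n := q (enc_size p))); first by apply: q_homo; rewrite /p; lia.
apply: compH; apply: (runs_le (n := 8 * enc_size (h y s) + 4 * enc_size l + 8)).
  by lia.
exact: runs_swap.
Qed.

Lemma runs_fold_loop n m d (l : seq Y) (s : S) w P :
  enc_size l <= n -> (forall k, enc_size (fold s (take k l)) <= m) ->
  P (main_store (Some (nil_label Sigma) :: serialize (tree_of (fold s l)) ++ w)) ->
  runs fold_loop d (main_store (serialize (tree_of l) ++ serialize (tree_of s) ++ w))
    (size l * (fold_cost n m).+1 + 1) P.
Proof.
elim: l s => [|y l IH] s ln sm Ps; first exact: runs_while_exit.
rewrite (_ : _ * _ + 1 =
  (fold_cost n m + (size l * (fold_cost n m).+1 + 1)).+1); last first.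
  by rewrite /= mulSn; lia.
apply: runs_while_iter => //; apply: runs_fold_body => //.
- by have := sm 0; rewrite take0.
- by have := sm 1; rewrite /= take0.
apply: IH => //; first by move: ln; rewrite enc_size_cons; lia.
by move=> k; have := sm k.+1.
Qed.

End FoldLeft.

Lemma polytime_foldl_pair Y S (eY : encodable Y) (eS : encodable S)
    (h : Y -> S -> S) (B : nat -> nat) : poly_bounded B ->
  (forall s l, enc_size (foldl (fun s y => h y s) s l) <= B (enc_size s + enc_size l)) ->
  polytime (fun p : Y * S => h p.1 p.2) ->
  polytime (fun p : S * seq Y => foldl (fun s y => h y s) p.1 p.2).
Proof.
move=> /poly_bounded_homo [C [pC mC BC]] B_fold /polytimeE [H [q [dH pq mq compH _]]].
have [q' pq' qq'] := poly_bounded_comp pq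
  (poly_bounded_add (poly_bounded_add poly_bounded_id pC) (poly_bounded_const 1)).
pose cost n := 1 + ((12 * n + 8) + ((4 * n + 4) + ((8 * n + 4 * (n + C n + 1) + 8) +
  (q' n + (8 * C n + 4 * n + 8))))).
exists (prog_pop ;; prog_swap ;; fold_loop H ;; prog_pop),
  (fun n => 1 + ((12 * n + 8) + ((n * (1 + cost n) + 1) + 1))).
split; [by rewrite /fold_loop /fold_body; det_program|by rewrite /cost; poly_bound|].
move=> d [s l] w P Ps; set n := enc_size (s, l).
have En : n = (enc_size s + enc_size l).+1 by rewrite /n enc_size_pair.
apply: runs_seq; apply: runs_pop; rewrite [behead _]/= -catA.
apply: runs_seq; apply: (runs_le (n := 8 * enc_size s + 4 * enc_size l + 8)).
  by lia.
apply: runs_swap; apply: runs_seq.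
apply: (runs_le (n := size l * (fold_cost q n (C n)).+1 + 1)).
  rewrite leq_add2r leq_mul //; first by have := ltn_size_enc_size eY l; lia.
  rewrite add1n ltnS /fold_cost /cost.
  by have := qq' n (n + C n + 1) (leqnn _); lia.
apply: (runs_fold_loop compH mq) => //; [by lia| |exact: runs_pop].
move=> k; apply: leq_trans (B_fold _ _) _; apply: leq_trans (BC _) _.
by apply: mC; have := enc_size_take eY k l; lia.
Qed.

Section Folds.
Variables (X Y S : Type) (eX : encodable X) (eY : encodable Y) (eS : encodable S).

Lemma polytime_foldl (h : X -> S -> Y -> S) (i : X -> S) (l : X -> seq Y)
    (B : nat -> nat) : poly_bounded B ->
  (forall x s t, enc_size (foldl (h x) s t) <= B (enc_size x + enc_size s + enc_size t)) ->
  polytime (fun p : X * S * Y => h p.1.1 p.1.2 p.2) -> polytime i -> polytime l ->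
  polytime (fun x => foldl (h x) (i x) (l x)).
Proof.
move=> pB hB ph pi pl; have {pB} [C [pC mC BC]] := poly_bounded_homo pB.
pose g (y : Y) (a : X * S) := (a.1, h a.1 a.2 y).
have fold_g x s t : foldl (fun a y => g y a) (x, s) t = (x, foldl (h x) s t).
  by elim: t s => //= y t IH s; rewrite IH.
apply: (eq_polytime (f := fun x => (foldl (fun a y => g y a) (x, i x) (l x)).2)).
  by move=> x; rewrite fold_g.
apply: polytime_snd; apply: (polytime_comp
  (g := fun p : X * S * seq Y => foldl (fun a y => g y a) p.1 p.2)
  (f := fun x => (x, i x, l x))); last first.
  by do !apply: polytime_pair => //; exact: polytime_id.
apply: (@polytime_foldl_pair _ _ _ _ g (fun n => n + C n + 1)).
- by poly_bound.
- case=> x s t; rewrite fold_g !enc_size_pair.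
  have := leq_trans (hB x s t) (BC _).
  have : C (enc_size x + enc_size s + enc_size t) <=
    C ((enc_size x + enc_size s).+1 + enc_size t) by apply: mC; lia.
  by lia.
- pose k (p : Y * (X * S)) := (p.2.1, p.2.2, p.1).
  have pk : polytime k.
    have ps : polytime (fun p : Y * (X * S) => p.2).
      exact: polytime_snd (polytime_id _).
    apply: polytime_pair; last exact: polytime_fst (polytime_id _).
    by apply: polytime_pair; [exact: polytime_fst ps|exact: polytime_snd ps].
  apply: polytime_pair; first exact: polytime_fst (polytime_fst pk).
  exact: polytime_comp ph pk.
Qed.

(* Special case of a state growing at each step by an amount that depends only
   on the environment and on the element read. *)
Lemma polytime_foldl_step (h : X -> S -> Y -> S) (i : X -> S) (l : X -> seq Y)
    (r : nat -> nat) : poly_bounded r ->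
  (forall x s y, enc_size (h x s y) <= enc_size s + r (enc_size x + enc_size y)) ->
  polytime (fun p : X * S * Y => h p.1.1 p.1.2 p.2) -> polytime i -> polytime l ->
  polytime (fun x => foldl (h x) (i x) (l x)).
Proof.
move=> pr hr; have {pr} [q [pq mq rq]] := poly_bounded_homo pr.
have {}hr x s y : enc_size (h x s y) <= enc_size s + q (enc_size x + enc_size y).
  by apply: leq_trans (hr x s y) _; rewrite leq_add2l.
apply: (polytime_foldl (B := fun n => n + n * q n)) => [|x s t]; first by poly_bound.
set n := enc_size x + enc_size s + enc_size t.
have grow t' s' : enc_size t' <= enc_size t ->
    enc_size (foldl (h x) s' t') <= enc_size s' + enc_size t' * q n.
  elim: t' s' => [|y t' IH] s' /=; first by rewrite leq_addr.
  rewrite enc_size_cons => le; apply: leq_trans (IH _ _) _; first by lia.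
  have : q (enc_size x + enc_size y) <= q n by apply: mq; rewrite /n; lia.
  by have := hr x s' y; rewrite mulSn mulnDl; lia.
apply: leq_trans (grow t s (leqnn _)) _; apply: leq_add; first by rewrite /n; lia.
by rewrite leq_mul2r; apply/orP; right; rewrite /n; lia.
Qed.

End Folds.
End Basic.

(** * Polynomial-time operations on lists and numbers *)

Ltac polytime_struct := lazymatch goal with
  | |- polytime (fun x => x) => exact: polytime_id
  | |- polytime (fun _ => ?y) => exact: polytime_const
  | |- polytime (@fst _ _) => apply: (polytime_fst (f := fun x => x))
  | |- polytime (@snd _ _) => apply: (polytime_snd (f := fun x => x))
  | |- polytime (fun x => fst (@?f x)) => apply: (polytime_fst (f := f))
  | |- polytime (fun x => snd (@?f x)) => apply: (polytime_snd (f := f))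
  | |- polytime (fun x => (@?f x, @?g x)) => apply: (polytime_pair (f := f) (g := g))
  end.

Ltac polytime_hyp := match goal with
  | H : polytime ?g |- polytime (fun x => ?g (@?f x)) => apply: (polytime_comp H)
  | H : polytime (fun p => ?g p.1 p.2) |- polytime (fun x => ?g (@?a x) (@?b x)) =>
      apply: (polytime_comp2 H)
  end.

Ltac polytime_list := fail.
Ltac polytime_fun := fail.
Ltac polytime_term := fail.

Ltac polytime := repeat (cbv beta; first
  [ assumption | polytime_struct | polytime_term | polytime_list | polytime_fun
  | polytime_hyp | apply: polytime_if ]).

Section FiniteDomain.
Variable Sigma : finType.
Local Notation encodable := (encodable Sigma).
Local Notation polytime := (@polytime Sigma _ _ _ _).

Lemma polytime_relabel X Y (eX : encodable X) (eY : encodable Y) (f : X -> Y)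
    (h : label Sigma -> label Sigma) :
  (forall x, exists2 l, tree_of x = Leaf l & tree_of (f x) = Leaf (h l)) ->
  polytime f.
Proof.
move=> fh; exists (prog_do (fun t _ => if quad_nth t 0 is Some (Some l)
    then (Pop, Push (Some (h l)), Keep, Keep) else keep_all _) ;; prog_move 1 [:: 0]),
  (fun=> 1 + (2 * 1 + 1)); split; [by det_program|exact: poly_bounded_const|].
move=> d x w P; have [l] := fh x; rewrite /stored => -> -> Pw.
by apply: runs_seq; apply: runs_do_const; apply: runs_move.
Qed.

Lemma polytime_fin (X : finType) Y (eX : encodable X) (eY : encodable Y)
    (lx : X -> label Sigma) (h : X -> Y) :
  injective lx -> (forall x, tree_of x = Leaf (lx x)) -> polytime h.
Proof.
move=> lx_inj lxE; case E: (enum X) => [|x0 s].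
  apply: (polytime_relabel (h := id)) => x.
  by have := mem_enum X x; rewrite E.
apply: (eq_polytime
  (f := fun x => foldr (fun y r => if x == y then h y else r) (h x0) (enum X))).
  move=> x; have : x \in enum X by rewrite mem_enum.
  by elim: (enum X) => //= y l IH; rewrite inE; case: eqP => [->|_].
elim: (enum X) => [|y l IH] /=; first exact: polytime_const.
apply: polytime_if => //; last exact: polytime_const.
apply: (polytime_relabel (h := fun l => bool_label Sigma (l == lx y))) => x.
by exists (lx x); [exact: lxE|rewrite (inj_eq lx_inj)].
Qed.

Section Leaves.
Variables (X Y : Type) (eX : encodable X) (eY : encodable Y).

Lemma polytime_of_bool (h : bool -> Y) (f : X -> bool) :
  polytime f -> polytime (fun x => h (f x)).
Proof.
by apply: polytime_comp; apply: (@polytime_fin _ _ _ _ (bool_label Sigma)) => // a b [].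
Qed.

Lemma polytime_of_letter (h : Sigma -> Y) (f : X -> Sigma) :
  polytime f -> polytime (fun x => h (f x)).
Proof.
by apply: polytime_comp; apply: (@polytime_fin _ _ _ _ (@letter_label Sigma)) => // a b [].
Qed.

Lemma polytime_of_token (h : token -> Y) (f : X -> token) :
  polytime f -> polytime (fun x => h (f x)).
Proof.
by apply: polytime_comp; apply: (@polytime_fin _ _ _ _ (token_label Sigma)) => // a b [].
Qed.

Lemma polytime_eqb (f g : X -> bool) :
  polytime f -> polytime g -> polytime (fun x => f x == g x).
Proof.
move=> pf pg; apply: (eq_polytime (f := fun x => if f x then g x else ~~ g x)).
  by move=> x; case: (f x) (g x) => [] [].
by polytime.
Qed.

End Leaves.
End FiniteDomain.

Section Lists.
Variable Sigma : finType.
Local Notation encodable := (encodable Sigma).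
Local Notation polytime := (@polytime Sigma _ _ _ _).
Local Notation enc_size := (@enc_size Sigma _ _).
Variables (X Y : Type) (eX : encodable X) (eY : encodable Y).

Lemma polytime_cons (y : X -> Y) (s : X -> seq Y) :
  polytime y -> polytime s -> polytime (fun x => y x :: s x).
Proof.
by move=> py ps; apply: (polytime_recode (g := fun x => (y x, s x))) => //; polytime.
Qed.

Lemma polytime_rev (s : X -> seq Y) : polytime s -> polytime (fun x => rev (s x)).
Proof.
move=> ps; apply: (eq_polytime (f := fun x => foldl (fun t y => y :: t) [::] (s x))).
  by move=> x; rewrite /rev; elim: (s x) [::] => //=.
apply: (polytime_foldl_step (h := fun _ t y => y :: t) (r := fun n => n + 1)).
- by poly_bound.
- by move=> x t y; rewrite enc_size_cons; lia.
- by apply: (polytime_recode (g := fun p => (p.2, p.1.2))) => //; polytime.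
- by polytime.
- by [].
Qed.

Lemma polytime_foldr S (eS : encodable S) (h : X -> Y -> S -> S)
    (i : X -> S) (l : X -> seq Y) (r : nat -> nat) : poly_bounded r ->
  (forall x y s, enc_size (h x y s) <= enc_size s + r (enc_size x + enc_size y)) ->
  polytime (fun p : X * Y * S => h p.1.1 p.1.2 p.2) -> polytime i -> polytime l ->
  polytime (fun x => foldr (h x) (i x) (l x)).
Proof.
move=> pr hr ph pi pl.
apply: (eq_polytime (f := fun x => foldl (fun s y => h x y s) (i x) (rev (l x)))).
  by move=> x; rewrite foldl_rev.
apply: (polytime_foldl_step (h := fun x s y => h x y s) (r := r)) => //.
  apply: (polytime_comp (f := fun p : X * S * Y => (p.1.1, p.2, p.1.2)) ph).
  by polytime.
exact: polytime_rev.
Qed.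

Lemma polytime_cat (s t : X -> seq Y) :
  polytime s -> polytime t -> polytime (fun x => s x ++ t x).
Proof.
move=> ps pt; apply: (eq_polytime (f := fun x => foldr cons (t x) (s x))).
  by move=> x; elim: (s x) => //= y u ->.
apply: (polytime_foldr (h := fun _ => cons) (r := fun n => n + 1)) => //.
- by poly_bound.
- by move=> x y u; rewrite enc_size_cons; lia.
- by apply: (polytime_recode (g := fun p => (p.1.2, p.2))) => //; polytime.
Qed.

End Lists.

Ltac polytime_list ::= lazymatch goal with
  | |- polytime (fun x => @?y x :: @?s x) => apply: (polytime_cons (y := y) (s := s))
  | |- polytime (fun x => rev (@?s x)) => apply: (polytime_rev (s := s))
  | |- polytime (fun x => @?s x ++ @?t x) => apply: (polytime_cat (s := s) (t := t))
  end.

Section ListIterators.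
Variable Sigma : finType.
Local Notation encodable := (encodable Sigma).
Local Notation polytime := (@polytime Sigma _ _ _ _).
Local Notation enc_size := (@enc_size Sigma _ _).
Variables (X Y Z : Type) (eX : encodable X) (eY : encodable Y) (eZ : encodable Z).

Lemma polytime_map (F : X -> Y -> Z) (s : X -> seq Y) :
  polytime (fun p => F p.1 p.2) -> polytime s ->
  polytime (fun x => [seq F x y | y <- s x]).
Proof.
move=> pF ps; have [q [pq mq size_F]] := polytime_enc_size pF.
have [q' pq' qq'] := poly_bounded_comp pq
  (poly_bounded_add poly_bounded_id (poly_bounded_const 1)).
apply: (polytime_foldr (h := fun x y t => F x y :: t) (i := fun=> [::])
  (r := fun n => q' n + 1)) => //.
- by poly_bound.
- move=> x y t; rewrite enc_size_cons.
  have : enc_size (F x y) <= q' (enc_size x + enc_size y).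
    apply: leq_trans (size_F (x, y)) _; apply: qq'.
    by rewrite enc_size_pair addn1.
  by lia.
- by polytime.
- by polytime.
Qed.

Lemma polytime_flatten (s : X -> seq (seq Y)) :
  polytime s -> polytime (fun x => flatten (s x)).
Proof.
move=> ps; apply: (polytime_foldr (h := fun _ => cat) (i := fun=> [::]) (r := id)) => //.
- exact: poly_bounded_id.
- by move=> x t u; apply: leq_trans (enc_size_cat _ _ _) _; lia.
- by polytime.
- by polytime.
Qed.

Lemma polytime_filter (a : X -> Y -> bool) (s : X -> seq Y) :
  polytime (fun p => a p.1 p.2) -> polytime s ->
  polytime (fun x => [seq y <- s x | a x y]).
Proof.
move=> pa ps; apply: (polytime_foldr (h := fun x y t => if a x y then y :: t else t)
  (i := fun=> [::]) (r := fun n => n + 1)) => //.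
- by poly_bound.
- by move=> x y t; case: (a x y); rewrite ?enc_size_cons; lia.
- by polytime.
- by polytime.
Qed.

Lemma polytime_foldl_bool (h : X -> bool -> Y -> bool) (i : X -> bool) (s : X -> seq Y) :
  polytime (fun p : X * bool * Y => h p.1.1 p.1.2 p.2) -> polytime i -> polytime s ->
  polytime (fun x => foldl (h x) (i x) (s x)).
Proof. by apply: (polytime_foldl_step (r := fun=> 0)); first exact: poly_bounded_const. Qed.

Lemma polytime_has (a : X -> Y -> bool) (s : X -> seq Y) :
  polytime (fun p => a p.1 p.2) -> polytime s -> polytime (fun x => has (a x) (s x)).
Proof.
move=> pa ps; apply: (eq_polytime (f := fun x => foldl (fun b y => b || a x y) false (s x))).
  move=> x; rewrite -[RHS]orFb; elim: (s x) false => [|y t IH] b /=; first by rewrite orbF.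
  by rewrite IH orbA.
by apply: (polytime_foldl_bool (h := fun x b y => b || a x y)); polytime.
Qed.

Lemma polytime_nonempty (s : X -> seq Y) :
  polytime s -> polytime (fun x => 0 < size (s x)).
Proof.
move=> ps; apply: (eq_polytime (f := fun x => has xpredT (s x))).
  by move=> x; rewrite has_predT.
by apply: (polytime_has (a := fun _ _ => true)); polytime.
Qed.

Lemma polytime_all (a : X -> Y -> bool) (s : X -> seq Y) :
  polytime (fun p => a p.1 p.2) -> polytime s -> polytime (fun x => all (a x) (s x)).
Proof.
move=> pa ps; apply: (eq_polytime (f := fun x => ~~ has (fun y => ~~ a x y) (s x))).
  by move=> x; rewrite has_predC negbK.
have pn : polytime (fun x => has (fun y => ~~ a x y) (s x)).
  by apply: (polytime_has (a := fun x y => ~~ a x y)); polytime.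
by polytime.
Qed.

Lemma polytime_behead (s : X -> seq Y) : polytime s -> polytime (fun x => behead (s x)).
Proof.
move=> ps; apply: (eq_polytime (f := fun x => if s x is _ :: t then t else [::])).
  by move=> x; case: (s x).
by apply: (polytime_list_case (g := fun _ t _ => t)); polytime.
Qed.

End ListIterators.

Section Naturals.
Variable Sigma : finType.
Local Notation encodable := (encodable Sigma).
Local Notation polytime := (@polytime Sigma _ _ _ _).
Variables (X Y : Type) (eX : encodable X) (eY : encodable Y).

Lemma polytime_nseq (k : X -> nat) (y : X -> Y) :
  polytime k -> polytime y -> polytime (fun x => nseq (k x) (y x)).
Proof.
move=> pk py; apply: (eq_polytime (f := fun x => [seq y x | _ <- nseq (k x) tt])).
  by move=> x; rewrite map_nseq.
apply: (polytime_map (F := fun x _ => y x)); first by polytime.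
exact: polytime_recode pk.
Qed.

Lemma polytime_size (s : X -> seq Y) : polytime s -> polytime (fun x => size (s x)).
Proof.
move=> ps; apply: (polytime_recode (g := fun x => [seq tt | _ <- s x])).
  by move=> x; rewrite /tree_of /encodable_nat; congr tree_of; elim: (s x) => //= y t ->.
by apply: (polytime_map (F := fun _ _ => tt)); polytime.
Qed.

Lemma polytime_drop (k : X -> nat) (s : X -> seq Y) :
  polytime k -> polytime s -> polytime (fun x => drop (k x) (s x)).
Proof.
move=> pk ps; apply: (eq_polytime
  (f := fun x => foldl (fun t (_ : unit) => behead t) (s x) (nseq (k x) tt))).
  move=> x; elim: (k x) (s x) => [|n IH] t /=; first by rewrite drop0.
  by rewrite IH -drop1 drop_drop addn1.
apply: (polytime_foldl_step (h := fun _ t _ => behead t) (r := fun=> 0)).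
- exact: poly_bounded_const.
- by move=> x t _; rewrite addn0 enc_size_behead.
- by apply: polytime_behead; polytime.
- by [].
- exact: polytime_recode pk.
Qed.

End Naturals.

Ltac polytime_list ::= lazymatch goal with
  | |- polytime (fun x => @?y x :: @?s x) => apply: (polytime_cons (y := y) (s := s))
  | |- polytime (fun x => rev (@?s x)) => apply: (polytime_rev (s := s))
  | |- polytime (fun x => @?s x ++ @?t x) => apply: (polytime_cat (s := s) (t := t))
  | |- polytime (fun x => flatten (@?s x)) => apply: (polytime_flatten (s := s))
  | |- polytime (fun x => 0 < size (@?s x)) => apply: (polytime_nonempty (s := s))
  | |- polytime (fun x => behead (@?s x)) => apply: (polytime_behead (s := s))
  | |- polytime (fun x => size (@?s x)) => apply: (polytime_size (s := s))
  | |- polytime (fun x => drop (@?k x) (@?s x)) => apply: (polytime_drop (k := k) (s := s))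
  | |- polytime (fun x => nseq (@?k x) (@?y x)) => apply: (polytime_nseq (k := k) (y := y))
  | |- polytime (fun x => has (@?a x) (@?s x)) => apply: (polytime_has (a := a) (s := s))
  | |- polytime (fun x => all (@?a x) (@?s x)) => apply: (polytime_all (a := a) (s := s))
  | |- polytime (fun x => map (@?F x) (@?s x)) => apply: (polytime_map (F := F) (s := s))
  | |- polytime (fun x => seq.filter (@?a x) (@?s x)) => apply: (polytime_filter (a := a) (s := s))
  end.

Section Arithmetic.
Variable Sigma : finType.
Local Notation encodable := (encodable Sigma).
Local Notation polytime := (@polytime Sigma _ _ _ _).
Local Notation enc_size := (@enc_size Sigma _ _).
Variables (X Y : Type) (eX : encodable X) (eY : encodable Y).

Lemma polytime_addn (a b : X -> nat) :
  polytime a -> polytime b -> polytime (fun x => a x + b x).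
Proof.
move=> pa pb; apply: (eq_polytime (f := fun x => size (nseq (a x) tt ++ nseq (b x) tt))).
  by move=> x; rewrite size_cat !size_nseq.
by polytime.
Qed.

Lemma polytime_muln (a b : X -> nat) :
  polytime a -> polytime b -> polytime (fun x => a x * b x).
Proof.
move=> pa pb.
apply: (eq_polytime (f := fun x => size (flatten (nseq (a x) (nseq (b x) tt))))).
  by move=> x; rewrite size_flatten /shape map_nseq size_nseq sumn_nseq mulnC.
by polytime.
Qed.

Lemma polytime_succ (a : X -> nat) : polytime a -> polytime (fun x => (a x).+1).
Proof.
move=> pa; apply: (eq_polytime (f := fun x => a x + 1)).
  by move=> x; rewrite addn1.
by apply: polytime_addn; polytime.
Qed.

Lemma polytime_nth (y0 : Y) (s : X -> seq Y) (k : X -> nat) :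
  polytime s -> polytime k -> polytime (fun x => nth y0 (s x) (k x)).
Proof.
move=> ps pk.
apply: (eq_polytime (f := fun x => if drop (k x) (s x) is y :: _ then y else y0)).
  by move=> x; elim: (k x) (s x) => [|n IH] [|y t] //=.
by apply: (polytime_list_case (g := fun y _ _ => y)); polytime.
Qed.

Lemma polytime_horner (p : {poly nat}) (n : X -> nat) :
  polytime n -> polytime (fun x => p.[n x])%R.
Proof.
move=> pn; rewrite /horner; elim: (polyseq p) => [|a s IH] /=; first by polytime.
apply: (polytime_addn (b := fun=> a)); last by polytime.
exact: polytime_muln.
Qed.

Lemma foldl_cons_size n (s : seq nat) :
  foldl (fun t (_ : unit) => size t :: t) s (nseq n tt) = rev (iota (size s) n) ++ s.
Proof.
elim: n s => // n IH s /=; rewrite IH /= rev_cons cat_rcons.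
by rewrite -addn1.
Qed.

(* The list is counted down by its own length. *)
Lemma polytime_iota0 (n : X -> nat) : polytime n -> polytime (fun x => iota 0 (n x)).
Proof.
move=> pn; apply: (eq_polytime (f := fun x =>
  rev (foldl (fun t (_ : unit) => size t :: t) [::] (nseq (n x) tt)))).
  by move=> x; rewrite foldl_cons_size cats0 revK.
apply: polytime_rev; apply: (polytime_foldl (h := fun _ t _ => size t :: t)
  (B := fun m => m + m * (4 * m + 4))); [by poly_bound| |by polytime..].
move=> x s t; set m := enc_size x + enc_size s + enc_size t.
have grow t' s' : size s' + size t' <= m -> enc_size
    (foldl (fun s (_ : unit) => size s :: s) s' t') <= enc_size s' + size t' * (4 * m + 4).
  elim: t' s' => [|y t' IH] s' /= le; first by rewrite leq_addr.
  apply: leq_trans (IH _ _) _; first by move: le => /=; lia.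
  by rewrite enc_size_cons enc_size_nat; move: le => /=; nia.
have := ltn_size_enc_size (encodable_nat Sigma) s.
have := ltn_size_enc_size (encodable_unit Sigma) t => size_t size_s.
apply: leq_trans (grow t s _) _; first by rewrite /m; lia.
apply: leq_add; first by rewrite /m; lia.
by rewrite leq_mul2r; apply/orP; right; rewrite /m; lia.
Qed.

Lemma polytime_eq_bits (a b : X -> seq bool) :
  polytime a -> polytime b -> polytime (fun x => a x == b x).
Proof.
move=> pa pb.
pose test (s : bool * seq bool) (y : bool) :=
  if s.2 is z :: r then (s.1 && (z == y), r) else (false, [::]).
pose accept (s : bool * seq bool) := if s.2 is _ :: _ then false else s.1.
have testP c r s : accept (foldl test (c, r) s) = c && (s == r).
  elim: s r c => [|y s IH] [|z r] c; rewrite /= ?IH //= ?andbF ?andbT //.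
  by rewrite eqseq_cons andbA [y == z]eq_sym.
apply: (eq_polytime (f := fun x => accept (foldl test (true, b x) (a x)))).
  by move=> x; rewrite testP.
have pt : polytime (fun x => foldl test (true, b x) (a x)).
  apply: (polytime_foldl_step (h := fun _ => test) (r := fun=> 0)) => //.
  - exact: poly_bounded_const.
  - by move=> x [c [|z r]] y; rewrite /test /= !enc_size_pair ?enc_size_cons ?enc_size_bool; lia.
  - apply: (polytime_list_case (g := fun z r p => (p.1.2.1 && (z == p.2), r))); try by polytime.
    have pz : polytime (fun p : bool * seq bool * (X * (bool * seq bool) * bool) =>
        p.1.1 == p.2.2) by apply: polytime_eqb; polytime.
    by polytime.
  - by polytime.
by apply: (polytime_list_case (g := fun _ _ _ => false)); polytime.
Qed.

End Arithmetic.

Lemma polytime_iota Sigma X (eX : encodable Sigma X) (m n : X -> nat) :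
  polytime m -> polytime n -> polytime (fun x => iota (m x) (n x)).
Proof.
move=> pm pn; apply: (eq_polytime (f := fun x => [seq m x + i | i <- iota 0 (n x)])).
  by move=> x; rewrite -iotaDl addn0.
apply: (polytime_map (F := fun x i => m x + i)); last exact: polytime_iota0.
by apply: polytime_addn; polytime.
Qed.

Section Selection.
Variable Sigma : finType.
Local Notation encodable := (encodable Sigma).
Local Notation polytime := (@polytime Sigma _ _ _ _).
Variables (X Y : Type) (eX : encodable X) (eY : encodable Y).

Lemma polytime_last (y0 : Y) (s : X -> seq Y) :
  polytime s -> polytime (fun x => last y0 (s x)).
Proof.
move=> ps; apply: (eq_polytime (f := fun x => nth y0 (rev (s x)) 0)).
  by move=> x; case/lastP: (s x) => // t y; rewrite rev_rcons last_rcons.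
by apply: (polytime_nth y0 (k := fun=> 0)); polytime.
Qed.

Lemma polytime_mask (m : X -> seq bool) (s : X -> seq Y) :
  polytime m -> polytime s -> polytime (fun x => mask (m x) (s x)).
Proof.
move=> pm ps.
pose select (u : seq bool * seq Y) (y : Y) :=
  (behead u.1, if nth false u.1 0 then y :: u.2 else u.2).
apply: (eq_polytime (f := fun x => rev (foldl select (m x, [::]) (s x)).2)).
  have selectE t u v : rev (foldl select (u, v) t).2 = rev v ++ mask u t.
    elim: t u v => [|y t IH] [|b u] v; rewrite ?cats0 //= IH ?mask0s ?cats0 //.
    by case: b => //=; rewrite rev_cons cat_rcons.
  by move=> x; rewrite selectE.
apply: polytime_rev; apply: polytime_snd.
apply: (polytime_foldl_step (h := fun _ => select) (r := fun n => n + 1)).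
- by poly_bound.
- move=> x [u v] y; rewrite /select !enc_size_pair /=.
  have := enc_size_behead (encodable_bool Sigma) u.
  by case: (nth false u 0); rewrite ?enc_size_cons; lia.
- have pb : polytime (fun p : X * (seq bool * seq Y) * Y => nth false p.1.2.1 0).
    by apply: (polytime_nth false (k := fun=> 0)); polytime.
  by rewrite /select; polytime.
- by polytime.
- by [].
Qed.

Lemma polytime_eqn (a b : X -> nat) :
  polytime a -> polytime b -> polytime (fun x => a x == b x).
Proof.
move=> pa pb; apply: (eq_polytime (f := fun x => nseq (a x) true == nseq (b x) true)).
  by move=> x; apply/eqP/eqP => [/(congr1 size)|->//]; rewrite !size_nseq.
by apply: polytime_eq_bits; polytime.
Qed.

Lemma polytime_mem_bits (a : X -> seq bool) (s : X -> seq (seq bool)) :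
  polytime a -> polytime s -> polytime (fun x => a x \in s x).
Proof.
move=> pa ps; apply: (eq_polytime (f := fun x => has (fun b => b == a x) (s x))).
  by move=> x; rewrite -has_pred1; apply: eq_has.
by apply: (polytime_has (a := fun x b => b == a x)) => //; apply: polytime_eq_bits; polytime.
Qed.

End Selection.

Ltac polytime_fun ::= match goal with
  | |- polytime (fun x => S (@?a x)) => apply: (polytime_succ (a := a))
  | |- polytime (fun x => addn (@?a x) (@?b x)) => apply: (polytime_addn (a := a) (b := b))
  | |- polytime (fun x => muln (@?a x) (@?b x)) => apply: (polytime_muln (a := a) (b := b))
  | |- polytime (fun x => iota (@?m x) (@?n x)) => apply: (polytime_iota (m := m) (n := n))
  | |- polytime (fun x => nth ?y0 (@?s x) (@?k x)) =>
      apply: (polytime_nth y0 (s := s) (k := k))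
  | |- polytime (fun x => @eq_op _ (@?a x) (@?b x)) =>
      first [ apply: (polytime_eqb (f := a) (g := b))
            | apply: (polytime_eqn (a := a) (b := b))
            | apply: (polytime_eq_bits (a := a) (b := b)) ]
  | |- polytime (fun x => @?a x \in @?s x) =>
      apply: (polytime_mem_bits (a := a) (s := s))
  | |- polytime (fun x => last ?y0 (@?s x)) => apply: (polytime_last y0 (s := s))
  | |- polytime (fun x => mask (@?m x) (@?s x)) => apply: (polytime_mask (m := m) (s := s))
  | |- polytime (fun x => ?h (@?f x)) =>
      match type of f with _ -> token => apply: (@polytime_of_token _ _ _ _ _ h f) end
  end.

(** * From programs to Turing machines *)

Section Words.
Variables (Sigma : finType) (X : Type) (eX : encodable Sigma X) (lx : X -> label Sigma).
Hypothesis tree_of_letter : forall x, tree_of x = Leaf (lx x).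

Local Notation symbol := (option (label Sigma)).
Local Notation letters := (map (fun x => Some (lx x))).
Local Arguments quad_tab X f /.

Definition read_loop : program symbol :=
  prog_while (fun t => isSome (quad_nth t 1))
    (prog_do (fun t _ => if quad_nth t 1 is Some a then (Push a, Pop, Keep, Keep)
                         else keep_all _) ;; prog_push None).

Definition prog_read : program symbol :=
  prog_move 0 [:: 1] ;; prog_push (Some (nil_label Sigma)) ;; read_loop.

Definition write_loop : program symbol :=
  prog_while (fun t => quad_nth t 0 == Some None)
    (prog_pop ;;
     prog_do (fun t _ => if quad_nth t 0 is Some a then (Pop, Push a, Keep, Keep)
                         else keep_all _)).

Definition prog_write : program symbol := write_loop ;; prog_pop ;; prog_move 1 [:: 0].

Lemma runs_read_loop d u v P : P (stored (catrev u v) [::]) ->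
  runs read_loop d (serialize (tree_of v), letters u, [::], [::]) (3 * size u + 1) P.
Proof.
elim: u v => [|x u IH] v Puv.
  by apply: runs_while_exit => //; move: Puv; rewrite /stored cats0.
rewrite /= mulnS -addnA; apply: (@runs_while_iter _ _ _ _ _ 2) => //.
apply: (@runs_seq _ _ _ _ _ 1 1); apply: runs_do_const; apply: runs_do_const.
by rewrite (_ : act _ _ = (serialize (tree_of (x :: v)), letters u, [::], [::]));
  [exact: IH|rewrite /= tree_of_letter].
Qed.

Lemma runs_read d (w : seq X) P : P (stored w [::]) ->
  runs prog_read d (main_store (letters w)) (5 * size w + 3) P.
Proof.
move=> Pw; apply: (runs_le (n := (2 * size w + 1) + (1 + (3 * size w + 1)))).
  by lia.
apply: runs_seq; apply: runs_move; rewrite //= ?size_map //.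
apply: runs_seq; apply: runs_do_const; rewrite -(size_rev w).
rewrite (_ : act _ _ = (serialize (tree_of ([::] : seq X)), letters (rev w), [::], [::])).
  by apply: runs_read_loop; rewrite -/(rev _) revK.
by rewrite /= /act /quad_tab /= cats0 map_rev.
Qed.

Lemma runs_write_loop d u v P :
  P ([:: Some (nil_label Sigma)], letters (catrev u v), [::], [::]) ->
  runs write_loop d (serialize (tree_of u), letters v, [::], [::]) (3 * size u + 1) P.
Proof.
elim: u v => [|x u IH] v Puv; first exact: runs_while_exit.
rewrite [tree_of _]/= /= tree_of_letter mulnS -addnA.
apply: (@runs_while_iter _ _ _ _ _ 2) => //.
apply: (@runs_seq _ _ _ _ _ 1 1); apply: runs_do_const; apply: runs_do_const.
exact: (IH (x :: v)).
Qed.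

Lemma runs_write d (w : seq X) P : P (main_store (letters w)) ->
  runs prog_write d (stored w [::]) (5 * size w + 3) P.
Proof.
move=> Pw; apply: (runs_le (n := (3 * size w + 1) + (1 + (2 * size w + 1)))).
  by lia.
rewrite /stored cats0; apply: runs_seq; apply: (@runs_write_loop d w [::]).
apply: runs_seq; apply: runs_do_const; apply: runs_move; rewrite //= ?size_map ?size_rev //.
by rewrite -map_rev -/(rev w) revK cats0.
Qed.

Lemma enc_size_word (w : seq X) : enc_size w = (size w).*2.+1.
Proof.
elim: w => // x w IH; rewrite enc_size_cons IH (_ : enc_size x = 1) ?doubleS //.
by rewrite /enc_size tree_of_letter.
Qed.

Lemma polytime_on_words Y (eY : encodable Sigma Y) (f : seq X -> Y) : polytime f ->
  exists F q, [/\ det_prog F, poly_bounded q, forall w, enc_size (f w) <= q (size w) &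
    forall d w P, P (stored (f w) [::]) ->
      runs F d (main_store (letters w)) (q (size w)) P].
Proof.
case/polytimeE=> F [q [dF pq mq compF size_f]].
have pn : poly_bounded (fun n => n * 2 + 1) by poly_bound.
have [q' pq' qq'] := poly_bounded_comp pq pn.
have qw (w : seq X) : q (enc_size w) <= q' (size w) by apply: qq'; rewrite enc_size_word; lia.
exists (prog_read ;; F), (fun n => (5 * n + 3) + q' n); split.
- by rewrite /prog_read /read_loop; det_program.
- by poly_bound.
- by move=> w; have := size_f w; have := qw w; rewrite enc_size_word; lia.
- move=> d w P Pf; apply: runs_seq; apply: runs_read.
  by apply: runs_le (qw w) _; apply: compF.
Qed.

End Words.

Lemma poly_bounded_poly (q : nat -> nat) : poly_bounded q ->
  exists p : {poly nat}, forall n, (q n).*2.+1 <= p.[n]%R.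
Proof.
move=> pq; have [c qc] : poly_bounded (fun n => 2 * q n + 1) by poly_bound.
exists (('X + (2%N : nat)%:P) ^+ c)%R => n; rewrite horner_exp hornerD hornerX hornerC.
have -> : (n + (2%N : nat))%R = n.+2 by exact: addn2.
have -> : ((n.+2 : nat) ^+ c)%R = n.+2 ^ c.
  by elim: c {qc} => // c IH; rewrite GRing.exprS expnS IH.
by apply: leq_trans (qc n); lia.
Qed.

Lemma word_of_holds_stack (A : finType) (t : tape A) w :
  holds_stack t w -> word_of_tape t = w.
Proof.
rewrite /word_of_tape => -[k ->].
by elim: w => [|a w IH] /=; [case: k|rewrite IH].
Qed.

Section Computability.
Variable Sigma : finType.

Theorem polytime_computable (f : seq Sigma -> seq token) :
  polytime (Sigma := Sigma) f -> poly_time_computable f.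
Proof.
pose i (a : Sigma) : option (label Sigma) := Some (letter_label a).
pose o (a : token) : option (label Sigma) := Some (token_label Sigma a).
move/(polytime_on_words (lx := @letter_label Sigma) (fun=> erefl)).
case=> F [q [dF pq size_f runF]].
pose G := F ;; prog_write Sigma; pose time n := q n + (5 * q n + 3).
have runG d w P : P (main_store (map o (f w))) ->
    runs G d (main_store (map i w)) (time (size w)) P.
  move=> Pf; apply: runs_seq; apply: runF.
  apply: (runs_le (n := 5 * size (f w) + 3)).
    by have := size_f w; have := ltn_size_enc_size (encodable_token Sigma) (f w); lia.
  exact: (runs_write (lx := token_label Sigma)).
have [p timep] : exists p : {poly nat}, forall n, (time n).*2.+1 <= p.[n]%R.
  by apply: poly_bounded_poly; rewrite /time; poly_bound.
exists (option (label Sigma)), i, o, (machine_of G None), p; split.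
- by move=> a b [].
- by move=> a b [].
- by apply: det_machine; rewrite /G /prog_write /write_loop; det_program.
- move=> w k c st; apply: leq_trans _ (timep _).
  by have [] := machine_demonic (runG true w xpredT isT) (initial_represents _ _ _) st.
- move=> w; have := runG false w (eq (main_store (map o (f w)))) erefl.
  case/machine_angelic/(_ (initial_represents G None _)) => k [c [s [st hc <- top _]]].
  by exists k, c; split=> //; exact: word_of_holds_stack top.
Qed.

End Computability.

Section Guessing.
Variable Sigma : finType.
Local Notation encodable := (encodable Sigma).
Local Arguments quad_tab X f /.

(* The trees differ only in the Booleans at their leaves. *)
Fixpoint bit_variant (x y : tree (label Sigma)) : Prop :=
  match x, y with
  | Leaf (inl (inr _)), Leaf (inl (inr _)) => True
  | Leaf l, Leaf l' => l = l'
  | Node x1 x2, Node y1 y2 => bit_variant x1 y1 /\ bit_variant x2 y2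
  | _, _ => False
  end.

Definition guess_bit (b : bool) (l : label Sigma) : label Sigma :=
  if l is inl (inr _) then bool_label Sigma b else l.

Definition bit_closed (X : Type) (eX : encodable X) : Prop :=
  forall (x : X) t, bit_variant (tree_of x) t -> exists y : X, t = tree_of y.

Lemma bit_closed_bool : bit_closed (encodable_bool Sigma).
Proof. by move=> b [[[|c]|]|] //= _; exists c. Qed.

Lemma bit_closed_pair X Y (eX : encodable X) (eY : encodable Y) :
  bit_closed eX -> bit_closed eY -> bit_closed (encodable_pair eX eY).
Proof.
move=> cX cY [x y] [l|t u] //= [/cX [x' ->] /cY [y' ->]].
by exists (x', y').
Qed.

Lemma bit_closed_seq X (eX : encodable X) : bit_closed eX -> bit_closed (encodable_seq eX).
Proof.
move=> cX; elim=> [|x s IH] [l|t u] //=; first by move=> <-; exists [::].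
by case=> /cX [x' ->] /IH [s' ->]; exists (x' :: s').
Qed.

Lemma bit_variant_nseq X (eX : encodable X) (x : X) n (s : seq X) : size s = n ->
  (forall y, List.In y s -> bit_variant (tree_of x) (tree_of y)) ->
  bit_variant (tree_of (nseq n x)) (tree_of s).
Proof.
elim: n s => [|n IH] [|y s] //= [size_s] xs; split; first by apply: xs; left.
by apply: IH => // z sz; apply: xs; right.
Qed.

Lemma bit_variant_bits n (s : seq bool) : size s = n ->
  bit_variant (tree_of (nseq n false)) (tree_of s).
Proof. by move=> size_s; apply: bit_variant_nseq. Qed.

Lemma tree_size_bit_variant x y : bit_variant x y -> tree_size x = tree_size y.
Proof.
elim: x y => [l|x1 IH1 x2 IH2] [l'|y1 y2] //=; first by case: l => [[]|].
by case=> /IH1 E1 /IH2 E2; rewrite !tree_size_node E1 E2.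
Qed.

Lemma relabel_bit_variant d x (K : tree (label Sigma) -> Prop) :
  relabel d guess_bit x K -> relabel d guess_bit x (fun y => bit_variant x y /\ K y).
Proof.
elim: x K => [[[u|b]|l]|x1 IH1 x2 IH2] K /=; try by apply: branches_mono.
move/IH1; apply: relabel_mono => y1 [v1 /IH2]; apply: relabel_mono => y2 [v2 Ky].
by [].
Qed.

Definition guesses (d : bool) X (eX : encodable X) (x : X) (K : X -> Prop) : Prop :=
  if d then forall y : X, bit_variant (tree_of x) (tree_of y) -> K y
  else exists2 y : X, bit_variant (tree_of x) (tree_of y) & K y.

Lemma guesses_mono d X (eX : encodable X) (x : X) (K K' : X -> Prop) :
  (forall y, bit_variant (tree_of x) (tree_of y) -> K y -> K' y) ->
  guesses d eX x K -> guesses d eX x K'.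
Proof.
move=> KK'; case: d => /= [H y v|[y v Ky]]; first exact/KK'/H.
by exists y => //; apply: KK'.
Qed.

Lemma relabel_guesses d X (eX : encodable X) (x : X) (K : tree (label Sigma) -> Prop) :
  bit_closed eX -> guesses d eX x (fun y => K (tree_of y)) ->
  relabel d guess_bit (tree_of x) K.
Proof.
have demonic t (K' : tree (label Sigma) -> Prop) :
    (forall y, bit_variant t y -> K' y) -> relabel true guess_bit t K'.
  elim: t K' => [[[u|b]|l]|t1 IH1 t2 IH2] K' tK /=; try by move=> e; apply: tK.
  by apply: IH1 => y1 v1; apply: IH2 => y2 v2; apply: tK.
have angelic t y (K' : tree (label Sigma) -> Prop) :
    bit_variant t y -> K' y -> relabel false guess_bit t K'.
  elim: t y K' => [[[u|b]|l]|t1 IH1 t2 IH2] [l'|y1 y2] K' //=; try by move=> <-; exists true.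
    by case: l' => [[|e]|] // _ Ky; exists e.
  by case=> v1 v2 Ky; apply: (IH1 y1 _ v1); apply: (IH2 y2 _ v2).
move=> cX; case: d => /= [H|[y v Ky]]; last exact: angelic v Ky.
by apply: demonic => t /[dup] /cX [y ->]; apply: H.
Qed.

Definition prog_guess : program (option (label Sigma)) :=
  prog_pop ;; prog_relabel guess_bit ;; prog_move 1 [:: 0] ;; prog_push None.

Lemma runs_guess d X Y (eX : encodable X) (eY : encodable Y) (x : X) (y : Y) w P :
  bit_closed eX -> guesses d eX x (fun x' => P (stored (x', y) w)) ->
  runs prog_guess d (stored (x, y) w) (4 * enc_size x + 5) P.
Proof.
move=> cX guess; set n := enc_size x.
apply: (runs_le (n := 1 + ((2 * n + 2) + ((2 * n + 1) + 1)))); first by lia.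
apply: runs_seq; apply: runs_pop; rewrite [behead _]/= -catA.
apply: runs_seq; apply: runs_relabel.
pose K t := P (main_store (None :: serialize t ++ serialize (eY y) ++ w)).
apply: (relabel_mono (K := fun t => bit_variant (tree_of x) t /\ K t)).
  move=> t [/tree_size_bit_variant size_t Pt]; rewrite cats0.
  apply: runs_seq; apply: runs_move; rewrite //= ?size_rev -?[size _]size_t // revK.
  exact: runs_push.
apply: relabel_bit_variant; apply: relabel_guesses => //.
apply: guesses_mono guess => x' _.
by rewrite /K /stored /= -catA.
Qed.

Local Notation token_symbol := (fun a => Some (token_label Sigma a)).

Lemma guess_and_verify (C : Type) (eC : encodable C) (template : seq token -> C)
    (verifier : C * seq token -> bool) :
  bit_closed eC -> polytime template -> polytime verifier ->
  exists F time, poly_bounded time /\ forall d w P,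
    guesses d eC (template w) (fun c => P (stored (verifier (c, w)) [::])) ->
    runs F d (main_store (map token_symbol w)) (time (size w)) P.
Proof.
move=> cC pT [G [r [_ pr compG]]].
have : polytime (fun w : seq token => (template w, w)) by polytime.
move/(polytime_on_words (lx := token_label Sigma) (fun=> erefl)).
case=> F [q [_ pq size_c runF]]; have [r' pr' rr'] := poly_bounded_comp pr pq.
exists (F ;; prog_guess ;; G), (fun n => q n + ((4 * q n + 5) + r' n)).
split=> [|d w P guess]; first by poly_bound.
apply: runs_seq; apply: runF; apply: runs_seq.
apply: (runs_le (n := 4 * enc_size (template w) + 5)).
  by have := size_c w; rewrite enc_size_pair; lia.
apply: runs_guess cC _; apply: guesses_mono guess => c /tree_size_bit_variant size_cT Pc.
apply: (runs_le (n := r (enc_size (c, w)))); last exact: compG.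
apply: rr'; apply: leq_trans (size_c w).
by rewrite !enc_size_pair /enc_size size_cT.
Qed.

Theorem NP_of_verifier (A : language token) (C : Type) (eC : encodable C)
    (template : seq token -> C) (verifier : C * seq token -> bool) :
  bit_closed eC -> polytime template -> polytime verifier ->
  (forall w, A w <-> exists2 c : C,
     bit_variant (tree_of (template w)) (tree_of c) & verifier (c, w)) ->
  NP A.
Proof.
move=> cC pT pV AE; have [F [time [ptime runF]]] := guess_and_verify cC pT pV.
pose yes : option (label Sigma) := Some (bool_label Sigma true).
have [p timep] := poly_bounded_poly ptime.
have demonic w (P : C -> Prop) :
    (forall c, bit_variant (tree_of (template w)) (tree_of c) -> P c) ->
    runs F true (main_store (map token_symbol w)) (time (size w))
      (fun s => exists2 c, P c & s = stored (verifier (c, w)) [::]).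
  by move=> H; apply: runF => c /H Pc; exists c.
exists (option (label Sigma)), token_symbol, (machine_of F yes), p; split.
- by move=> a b [].
- move=> w k c st; apply: leq_trans _ (timep _).
  by have [] := machine_demonic (demonic w xpredT (fun _ _ => isT))
    (initial_represents _ _ _) st.
- move=> w; rewrite AE; split.
    case=> c cT Vc; have : runs F false (main_store (map token_symbol w)) (time (size w))
        (eq (main_store [:: yes])).
      by apply: runF; exists c; rewrite ?Vc.
    case/machine_angelic/(_ (initial_represents F yes _)) => k [c' [s [st hc <- _ ac]]].
    by exists k, c'; split=> //; rewrite ac eqxx.
  case=> k [c' [st hc ac]].
  have [_ /(_ hc ac) [s [c cT ->]]] := machine_demonic (demonic w _ (fun c cT => cT))
    (initial_represents _ _ _) st.
  by move=> [Vc]; exists c.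
Qed.

End Guessing.

(** * Sampling an interpretation at finitely many points *)

Fixpoint bool_eval (v : nat -> bool) (t : term) : bool :=
  match t with
  | Var i => v i
  | Zero => false
  | One => true
  | Add t1 t2 => bool_eval v t1 || bool_eval v t2
  | Mul t1 t2 => bool_eval v t1 && bool_eval v t2
  | Opp t1 => ~~ bool_eval v t1
  end.

Fixpoint var_bound (t : term) : nat :=
  match t with
  | Var i => i.+1
  | Zero | One => 0
  | Add t1 t2 | Mul t1 t2 => maxn (var_bound t1) (var_bound t2)
  | Opp t1 => var_bound t1
  end.

Fixpoint atoms (phi : formula) : seq formula :=
  match phi with
  | Equal _ _ | IntConn _ => [:: phi]
  | And phi1 phi2 => atoms phi1 ++ atoms phi2
  | Not phi1 => atoms phi1
  end.

Fixpoint bool_models (c : formula -> bool) (phi : formula) : bool :=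
  match phi with
  | Equal _ _ | IntConn _ => c phi
  | And phi1 phi2 => bool_models c phi1 && bool_models c phi2
  | Not phi1 => ~~ bool_models c phi1
  end.

Definition is_conn (a : formula) : bool := if a is IntConn _ then true else false.

Definition atom_var_bound (a : formula) : nat :=
  match a with
  | Equal t u => maxn (var_bound t) (var_bound u)
  | IntConn t => var_bound t
  | _ => 0
  end.

Definition nth_atom (A : seq formula) (k : nat) : formula :=
  nth (Equal Zero Zero) A k.

Lemma nth_atomP phi k : k < size (atoms phi) ->
  (exists t u, nth_atom (atoms phi) k = Equal t u) \/
  (exists t, nth_atom (atoms phi) k = IntConn t).
Proof.
rewrite /nth_atom; elim: phi k => [t u|t|f IHf g IHg|f IHf] k //=.
- by case: k => // _; left; exists t, u.
- by case: k => // _; right; exists t.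
- rewrite size_cat nth_cat; case: (ltnP k (size (atoms f))) => [kf _|fk kg]; first exact: IHf.
  by apply: IHg; lia.
- exact: IHf.
Qed.

Lemma models_bool (T : topologicalType) (I : interpretation T) phi :
  models I phi <-> bool_models (fun a => `[< models I a >]) phi.
Proof.
elim: phi => [t u|t|f IHf g IHg|f IHf] /=; try by split=> /asboolP.
- by rewrite IHf IHg; split=> [[-> ->]|/andP].
- by rewrite IHf; split=> /negP.
Qed.

(* A sample point [p] with [value p k] for the truth of the [k]-th atom at [p]
   ([t] for the atom c°(t), both sides agreeing for an equation) and [side p k]
   for the part of a splitting of the interior of [t] in which [p] lies. *)
Section Consistency.
Variables (S : Type) (value side : S -> nat -> bool).
Variables (conn : seq bool) (truth : nat -> bool) (P : seq S).

Definition split_witnessed (k : nat) : bool :=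
  [&& has (fun p => value p k && side p k) P,
      has (fun p => value p k && ~~ side p k) P,
      has (fun p => ~~ value p k) P &
      all (fun i => nth false conn i && truth i ==>
           [|| has (fun p => value p i && ~~ value p k) P,
               all (fun p => value p i ==> side p k) P |
               all (fun p => value p i ==> ~~ side p k) P])
        (iota 0 (size conn))].

Definition consistent_at (k : nat) : bool :=
  if nth false conn k then truth k || split_witnessed k
  else truth k == all (fun p => value p k) P.

Definition consistent : bool := all consistent_at (iota 0 (size conn)).

Lemma consistentP : reflect (forall k, k < size conn -> consistent_at k) consistent.
Proof.
by apply: (iffP allP) => H k; have := H k; rewrite mem_iota.
Qed.

End Consistency.

Lemma eq_consistent S S' (f : S -> S') value side value' side' conn truth truth' P :
  (forall x k, k < size conn ->
     value' (f x) k = value x k /\ side' (f x) k = side x k) ->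
  (forall k, k < size conn -> truth' k = truth k) ->
  consistent value' side' conn truth' (map f P) = consistent value side conn truth P.
Proof.
move=> sampleE truthE.
have vE k (kn : k < size conn) x : value' (f x) k = value x k by case: (sampleE x k kn).
have sE k (kn : k < size conn) x : side' (f x) k = side x k by case: (sampleE x k kn).
apply: eq_in_all => k; rewrite mem_iota => kn.
rewrite /consistent_at /split_witnessed truthE //; case: (nth false conn k); last first.
  by rewrite all_map; congr (_ == _); apply: eq_all => x /=; rewrite vE.
rewrite !has_map; congr (_ || [&& _, _, _ & _]);
  try by apply: eq_has => x /=; rewrite ?vE ?sE.
apply: eq_in_all => i; rewrite mem_iota => lt_i; rewrite truthE // has_map !all_map.
congr (_ ==> [|| _, _ | _]).
- by apply: eq_has => x /=; rewrite !vE.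
- by apply: eq_all => x /=; rewrite vE ?sE.
- by apply: eq_all => x /=; rewrite vE ?sE.
Qed.

(* A sample point: the truth values of the variables at a generic point of the
   space, and the side of the splitting of the [k]-th atom on which it lies. *)
Definition point := ((nat -> bool) * (nat -> bool))%type.

Definition atom_value (p : point) (a : formula) : bool :=
  match a with
  | Equal t u => bool_eval p.1 t == bool_eval p.1 u
  | IntConn t => bool_eval p.1 t
  | _ => false
  end.

Definition good_sample (A : seq formula) (P : seq point) (g : nat -> bool) : bool :=
  consistent (fun p k => atom_value p (nth_atom A k)) (fun p k => p.2 k)
    (map is_conn A) g P.

Section OpenSplittings.
Local Open Scope classical_set_scope.
Variable T : topologicalType.
Implicit Types O E C : set T.

Lemma connected_or_open_split O : open O -> exists E,
  [/\ open E, E `<=` O, open (O `\` E) &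
      connected O \/ E !=set0 /\ O `\` E !=set0].
Proof.
move=> oO; have [cO|] := pselect (connected O).
  by exists set0; split=> //; [exact: open0|rewrite setD0|left].
move=> /existsNP [E /not_implyP [E0 /not_implyP [[C oC EC]]]].
move=> /not_implyP [[D cD ED] EO]; exists E; split.
- by rewrite EC; apply: openI.
- by rewrite EC => z [].
- rewrite ED (_ : O `\` _ = O `&` ~` D); first exact/openI/closed_openC.
  by apply/seteqP; split=> z [Oz nD]; split=> // Dz; [apply: nD|case: Dz].
- right; split=> //; apply: contrapT => /nonemptyPn; rewrite setD_eq0 => OE.
  by apply: EO; apply/seteqP; split=> //; rewrite EC => z [].
Qed.

Lemma open_separated E C : open E -> open C -> E `&` C = set0 -> separated E C.
Proof.
have disj O O' : open O' -> O `&` O' = set0 -> closure O `&` O' = set0.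
  move=> oO' /disjoints_subset OO'; apply/disjoints_subset.
  rewrite [X in _ `<=` X](closure_id _).1; first exact: closureS.
  exact: open_closedC.
by move=> oE oC EC; split; [exact: disj|rewrite setIC; apply: disj; rewrite // setIC].
Qed.

Lemma connected_sub_open_split O E C : open E -> open (O `\` E) -> connected C ->
  C `<=` O -> C `<=` E \/ C `<=` O `\` E.
Proof.
move=> oE oOE cC CO; apply: connected_subset cC.
  by apply: open_separated; rewrite // setDIK.
by move=> z /CO Oz; have [Ez|nEz] := pselect (E z); [left|right].
Qed.

End OpenSplittings.

Section Generic.
Local Open Scope classical_set_scope.
Variables (T : topologicalType) (I : interpretation T).

Lemma regular_closed_closure (O : set T) : open O -> regular_closed (closure O).
Proof. by move=> oO; apply/esym/closure_open_regclosed. Qed.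

Lemma regular_closed_closed (X : set T) : regular_closed X -> closed X.
Proof. by move=> ->; exact: closed_closure. Qed.

Lemma eval_regular t : regular_closed (eval I t).
Proof.
elim: t => [v|||t1 IH1 t2 IH2|t1 IH1 t2 IH2|t1 IH1] /=.
- exact: val_varP.
- by rewrite /regular_closed interior0 closure0.
- by rewrite /regular_closed interiorT closureT.
- rewrite /regular_closed /rc_add; apply/seteqP; split.
    rewrite {1}IH1 {1}IH2 -closureU; apply: closureS.
    by move=> z [] h; apply: interiorS h => y ?; [left|right].
  rewrite [X in _ `<=` X](closure_id _).1; first by apply: closureS; exact: interior_subset.
  by apply: closedU; exact: regular_closed_closed.
- by apply: regular_closed_closure; exact: open_interior.
- apply: regular_closed_closure; apply: closed_openC; exact: regular_closed_closed.
Qed.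

Lemma eval_closed t : closed (eval I t).
Proof. by apply: regular_closed_closed; exact: eval_regular. Qed.

Lemma open_evalD t u : open ((eval I t)° `\` eval I u).
Proof. by apply: openI; [exact: open_interior|apply: closed_openC; exact: eval_closed]. Qed.

Lemma eval_subset t u : (eval I t)° `<=` eval I u -> eval I t `<=` eval I u.
Proof.
move=> tu; rewrite [X in X `<=` _]eval_regular [X in _ `<=` X](closure_id _).1.
  exact: closureS.
exact: eval_closed.
Qed.

Definition generic N (z : T) : Prop := forall v, v < N -> (I v)° z \/ ~ I v z.

Lemma generic_bool_eval N z t : generic N z -> var_bound t <= N ->
  if bool_eval (fun v => `[< I v z >]) t then (eval I t)° z else ~ eval I t z.
Proof.
move=> Nz; have open_cl (O : set T) : open O -> O z -> (closure O)° z.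
  by move=> oO; have := @subset_closure _ O; rewrite open_subsetE //; apply.
elim: t => [v|||t1 IH1 t2 IH2|t1 IH1 t2 IH2|t1 IH1] /=.
- by move=> vN; case: asboolP => [Iz|//]; case: (Nz v vN).
- by move=> _ [].
- by move=> _; rewrite interiorT.
- rewrite geq_max => /andP [/IH1 {}IH1 /IH2 {}IH2].
  case: (bool_eval _ t1) IH1 => /= h1; first by apply: interiorS h1 => y; left.
  case: (bool_eval _ t2) IH2 => /= h2; first by apply: interiorS h2 => y; right.
  by case.
- rewrite geq_max => /andP [/IH1 {}IH1 /IH2 {}IH2].
  have sub : rc_mul (eval I t1) (eval I t2) `<=` eval I t1 `&` eval I t2.
    rewrite [X in _ `<=` X](closure_id _).1; first by apply: closureS; exact: interior_subset.
    by apply: closedI; exact: eval_closed.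
  case: (bool_eval _ t1) IH1 => /= h1; last by move=> /sub [].
  case: (bool_eval _ t2) IH2 => /= h2; last by move=> /sub [].
  by apply: open_cl; [exact: open_interior|rewrite interiorI].
- move=> /IH1 {}IH1; case: (bool_eval _ t1) IH1 => /= h1.
    by rewrite /rc_opp closure_setC => /(_ h1).
  by apply: open_cl => //; apply: closed_openC; exact: eval_closed.
Qed.

Lemma generic_eval N z t : generic N z -> var_bound t <= N ->
  bool_eval (fun v => `[< I v z >]) t = `[< eval I t z >].
Proof.
move=> Nz tN; have := generic_bool_eval Nz tN.
case: (bool_eval _ t) => h; apply/esym; last exact: asboolF.
by apply: asboolT; exact: interior_subset h.
Qed.

Lemma generic_interior N z t : generic N z -> var_bound t <= N ->
  eval I t z -> (eval I t)° z.
Proof.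
move=> Nz tN tz; have := generic_bool_eval Nz tN.
by rewrite (generic_eval Nz tN) asboolT.
Qed.

Lemma generic_exists N (O : set T) : open O -> O !=set0 -> exists2 z, O z & generic N z.
Proof.
move=> oO O0; suff [W [_ [z Wz] WO gW]] : exists W : set T, [/\ open W, W !=set0,
    W `<=` O & forall z, W z -> generic N z] by exists z; [exact: WO|exact: gW].
elim: N => [|N [W [oW W0 WO gW]]]; first by exists O; split.
have [WI|] := pselect (W `&` (I N)° !=set0).
  exists (W `&` (I N)°); split=> //; first by apply: openI => //; exact: open_interior.
    by move=> z [/WO].
  move=> z [Wz Iz] v; rewrite ltnS leq_eqVlt => /orP [/eqP ->|]; first by left.
  exact: gW.
move/nonemptyPn => WI0; exists (W `\` I N); split.
- apply: openI => //; apply: closed_openC; apply: regular_closed_closed.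
  exact: val_varP.
- apply: contrapT => /nonemptyPn; rewrite setD_eq0 open_subsetE // => WI.
  by case: W0 => z Wz; have : (W `&` (I N)°) z by [split=> //; exact: WI]; rewrite WI0.
- by move=> z [/WO].
- move=> z [Wz Iz] v; rewrite ltnS leq_eqVlt => /orP [/eqP ->|]; first by right.
  exact: gW.
Qed.

Lemma generic_points N (Os : seq (set T)) : [set: T] !=set0 ->
  {in Os, forall O, open O} -> exists zs : seq T,
  [/\ size zs = size Os, {in zs, forall z, generic N z} &
      {in Os, forall O, O !=set0 -> exists2 z, z \in zs & O z}].
Proof.
move=> T0; elim: Os => [|O Os IH] oOs; first by exists [::].
have [|zs [size_zs gzs Ozs]] := IH; first by move=> O' O'Os; apply: oOs; rewrite inE O'Os orbT.
have [z gz Oz] : exists2 z, generic N z & O !=set0 -> O z.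
  have [ne|ne] := pselect (O !=set0).
    have [|z Oz gz] := @generic_exists N O _ ne; last by exists z.
    by apply: oOs; rewrite inE eqxx.
  by have [z _ gz] := generic_exists N openT T0; exists z.
exists (z :: zs); split=> /=; first by rewrite size_zs.
- by move=> z'; rewrite inE => /predU1P [->|/gzs].
- move=> O'; rewrite inE => /predU1P [->|O'Os] O'0.
    by exists z; [rewrite inE eqxx|exact: Oz].
  by have [z' z's Oz'] := Ozs _ O'Os O'0; exists z' => //; rewrite inE z's orbT.
Qed.

End Generic.

Section Sample.
Local Open Scope classical_set_scope.
Variables (T : topologicalType) (I : interpretation T) (phi : formula).
Hypothesis T_connected : connected [set: T].

Local Notation A := (atoms phi).
Local Notation n := (size A).

Definition vars_bound : nat := foldr maxn 0 (map atom_var_bound A).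
Local Notation N := vars_bound.

Definition conn_term (a : formula) : term := if a is IntConn t then t else Zero.
Local Notation tau k := (conn_term (nth_atom A k)).

Lemma atom_var_bound_le k : k < n -> atom_var_bound (nth_atom A k) <= N.
Proof.
rewrite /vars_bound /nth_atom; elim: A k => [|a s IH] [|k] //= kn.
  exact: leq_maxl.
exact: leq_trans (IH _ kn) (leq_maxr _ _).
Qed.

Variable E : nat -> set T.
Hypothesis E_split : forall k, [/\ open (E k), E k `<=` (eval I (tau k))°,
  open ((eval I (tau k))° `\` E k) &
  connected (eval I (tau k))° \/ E k !=set0 /\ (eval I (tau k))° `\` E k !=set0].

Definition atom_probes (k : nat) : seq (set T) :=
  match nth_atom A k with
  | Equal t u => [:: (eval I t)° `\` eval I u; (eval I u)° `\` eval I t; set0]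
  | IntConn t => [:: E k; (eval I t)° `\` E k; ~` eval I t]
  | _ => [:: set0; set0; set0]
  end.

Definition probes : seq (set T) :=
  setT :: flatten [seq atom_probes k | k <- iota 0 n] ++
  [seq (eval I (tau i))° `\` eval I (tau k) | i <- iota 0 n, k <- iota 0 n].

Lemma size_probes : size probes = n * n + 3 * n + 1.
Proof.
have size3 s : size (flatten [seq atom_probes k | k <- s]) = 3 * size s.
  elim: s => //= k s IH; rewrite size_cat IH mulnS; congr addn.
  by rewrite /atom_probes; case: nth_atom.
by rewrite /= size_cat size3 size_allpairs size_iota; lia.
Qed.

Lemma atom_probes_sub k : k < n -> {subset atom_probes k <= probes}.
Proof.
move=> kn O OO; rewrite inE mem_cat; apply/orP; right; apply/orP; left.
by apply/flattenP; exists (atom_probes k) => //; apply/mapP; exists k; rewrite ?mem_iota.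
Qed.

Lemma pair_probe_in i k : i < n -> k < n ->
  (eval I (tau i))° `\` eval I (tau k) \in probes.
Proof.
move=> i_n kn; rewrite inE mem_cat; apply/orP; right; apply/orP; right.
by apply/allpairsP; exists (i, k); rewrite !mem_iota.
Qed.

Lemma probes_open : {in probes, forall O, open O}.
Proof.
move=> O; rewrite inE mem_cat => /predU1P [->|]; first exact: openT.
case/orP=> [/flattenP [s /mapP [k _ ->]]|/allpairsP [[i k] [_ _ ->]]]; last first.
  exact: open_evalD.
have [oE _ oE' _] := E_split k; move: oE'; rewrite /atom_probes.
case: nth_atom => [t u|t|f g|f] /= oE'; rewrite !inE => /or3P [] /eqP ->;
  first [ exact: open_evalD | exact: open0 | by []
        | by apply: closed_openC; exact: eval_closed ].
Qed.

Variable zs : seq T.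
Hypothesis zs_generic : {in zs, forall z, generic I N z}.
Hypothesis zs_hits : {in probes, forall O, O !=set0 -> exists2 z, z \in zs & O z}.

Definition sample_point (z : T) : point :=
  (fun v => `[< I v z >], fun k => `[< E k z >]).

Local Notation P := (map sample_point zs).

Lemma has_sample_point (Q : pred point) O : O \in probes -> O !=set0 ->
  (forall z, generic I N z -> O z -> Q (sample_point z)) -> has Q P.
Proof.
move=> Op O0 OQ; have [z z_zs Oz] := zs_hits Op O0.
by rewrite has_map; apply/hasP; exists z => //=; apply: OQ Oz; exact: zs_generic.
Qed.

Lemma sample_point_equal t u : var_bound t <= N -> var_bound u <= N ->
  (eval I t)° `\` eval I u \in probes ->
  all (fun p => bool_eval p.1 t == bool_eval p.1 u) P -> eval I t `<=` eval I u.
Proof.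
move=> tN uN probe tu; apply: eval_subset; rewrite -setD_eq0; apply/nonemptyPn => O0.
suff : has (predC (fun p : point => bool_eval p.1 t == bool_eval p.1 u)) P.
  by rewrite has_predC tu.
apply: has_sample_point probe O0 _ => z gz [/interior_subset tz nuz] /=.
by rewrite (generic_eval gz tN) (generic_eval gz uN) asboolT // asboolF.
Qed.

Lemma sample_equation k t u : k < n -> nth_atom A k = Equal t u ->
  `[< models I (nth_atom A k) >] = all (fun p => atom_value p (nth_atom A k)) P.
Proof.
move=> kn Ek; have := atom_var_bound_le kn; rewrite Ek /= geq_max => /andP [tN uN].
have probes_k : {subset atom_probes k <= probes} := atom_probes_sub kn.
apply/asboolP/idP => [tu|tu].
  rewrite all_map; apply/allP => z /zs_generic gz /=.
  by rewrite (generic_eval gz tN) (generic_eval gz uN) tu.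
apply/seteqP; split; apply: sample_point_equal => //.
- by apply: probes_k; rewrite /atom_probes Ek inE eqxx.
- by apply: probes_k; rewrite /atom_probes Ek !inE eqxx orbT.
- by under eq_all do rewrite eq_sym.
Qed.

Lemma atom_value_sample k z : k < n -> is_conn (nth_atom A k) -> generic I N z ->
  atom_value (sample_point z) (nth_atom A k) = `[< eval I (tau k) z >].
Proof.
move=> kn; have := atom_var_bound_le kn; case: nth_atom => // t tN _ gz.
exact: generic_eval gz tN.
Qed.

Lemma generic_interior_tau k z : k < n -> generic I N z ->
  eval I (tau k) z -> (eval I (tau k))° z.
Proof.
move=> kn gz; have := atom_var_bound_le kn; case: nth_atom => //= t tN.
exact: generic_interior gz tN.
Qed.

Lemma sample_conn_pair i k : i < n -> k < n ->
  is_conn (nth_atom A i) -> is_conn (nth_atom A k) -> connected (eval I (tau i))° ->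
  [|| has (fun p => atom_value p (nth_atom A i) && ~~ atom_value p (nth_atom A k)) P,
      all (fun p => atom_value p (nth_atom A i) ==> p.2 k) P |
      all (fun p => atom_value p (nth_atom A i) ==> ~~ p.2 k) P].
Proof.
move=> i_n kn ci ck conn_i; have [oE sE oE' _] := E_split k.
have [ne|/nonemptyPn] := pselect ((eval I (tau i))° `\` eval I (tau k) !=set0).
  apply/or3P/Or31; apply: (has_sample_point (pair_probe_in i_n kn) ne) => z gz [iz nkz].
  rewrite !atom_value_sample // asboolT ?asboolF //; exact: interior_subset iz.
rewrite setD_eq0 open_subsetE; last exact: open_interior.
move=> /(connected_sub_open_split oE oE' conn_i) [sub|sub]; apply/or3P;
  [apply: Or32|apply: Or33]; rewrite all_map; apply/allP => z /zs_generic gz /=;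
  rewrite atom_value_sample //; apply/implyP => /asboolP /(generic_interior_tau i_n gz) /sub.
- by move=> Ez; apply/asboolP.
- by case=> _ nEz; apply/asboolP.
Qed.

Lemma sample_split k : k < n -> is_conn (nth_atom A k) ->
  ~ models I (nth_atom A k) ->
  split_witnessed (fun p k => atom_value p (nth_atom A k)) (fun p k => p.2 k)
    (map is_conn A) (fun k => `[< models I (nth_atom A k) >]) P k.
Proof.
move=> kn ck nck; have [_ sE _ []] := E_split k.
  by case: (nth_atom A k) ck nck.
have probes_k : {subset atom_probes k <= probes} := atom_probes_sub kn.
have Ek : atom_probes k =
    [:: E k; (eval I (tau k))° `\` E k; ~` eval I (tau k)].
  by rewrite /atom_probes; case: nth_atom ck.
move=> [E0 E0']; apply/and4P; split.
- apply: (has_sample_point (O := E k)) => // [|z gz Ez].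
    by apply: probes_k; rewrite Ek inE eqxx.
  rewrite atom_value_sample // asboolT /=; first exact/asboolP.
  exact: interior_subset (sE _ Ez).
- apply: (has_sample_point (O := (eval I (tau k))° `\` E k)) => // [|z gz [tz nEz]].
    by apply: probes_k; rewrite Ek !inE eqxx orbT.
  rewrite atom_value_sample // asboolT /=; first exact/asboolPn.
  exact: interior_subset.
- apply: (has_sample_point (O := ~` eval I (tau k))) => [||z gz ntz].
  + by apply: probes_k; rewrite Ek !inE eqxx !orbT.
  + apply: contrapT => /nonemptyPn t0; have tT : eval I (tau k) = setT.
      by rewrite -[LHS]setCK t0 setC0.
    by case: (nth_atom A k) ck nck tT => //= t _ nct tT; apply: nct; rewrite tT interiorT.
  + by rewrite atom_value_sample // asboolF.
- apply/allP => i; rewrite mem_iota size_map => /= i_n; apply/implyP => /andP [ci /asboolP mi].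
  rewrite (nth_map (Equal Zero Zero)) // -/(nth_atom A i) in ci.
  apply: sample_conn_pair => //.
  by move: mi; case: (nth_atom A i) ci.
Qed.

Lemma good_sample_points :
  good_sample A P (fun k => `[< models I (nth_atom A k) >]).
Proof.
apply/consistentP => k; rewrite size_map => kn; rewrite /consistent_at.
rewrite (nth_map (Equal Zero Zero)) // -/(nth_atom A k).
have [[t [u Ek]]|[t Ek]] := nth_atomP kn.
  by rewrite {1}Ek /= (sample_equation kn Ek) eqxx.
rewrite {1}Ek /=; case: asboolP => //= nmk.
by apply: sample_split => //; rewrite Ek.
Qed.

End Sample.

Theorem good_sample_exists (T : topologicalType) (I : interpretation T) phi :
  connected [set: T] -> ([set: T] !=set0)%classic ->
  let n := size (atoms phi) in exists2 P : seq point, size P = n * n + 3 * n + 1 &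
    good_sample (atoms phi) P (fun k => `[< models I (nth_atom (atoms phi) k) >]).
Proof.
move=> cT T0 n; pose X k := eval I (conn_term (nth_atom (atoms phi) k)).
have [E E_split] := choice (fun k => connected_or_open_split (@open_interior _ (X k))).
have [zs [size_zs gzs hits]] := generic_points I (vars_bound phi) T0 (probes_open E_split).
exists (map (sample_point I E) zs); first by rewrite size_map size_zs size_probes.
exact: good_sample_points.
Qed.

(** * A self-similar colouring of the integer lattice *)

Section Lattice.

Import Order.TTheory GRing.Theory Num.Theory.
Local Open Scope ring_scope.

Definition axis0 : 'I_3 := @Ordinal 3 0 isT.
Definition axis1 : 'I_3 := @Ordinal 3 1 isT.
Definition axis2 : 'I_3 := @Ordinal 3 2 isT.

Lemma axis_ind (Q : 'I_3 -> Prop) : Q axis0 -> Q axis1 -> Q axis2 -> forall i, Q i.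
Proof.
move=> Q0 Q1 Q2 [[|[|[|//]]] hi].
- by rewrite (_ : Ordinal hi = axis0) //; apply: val_inj.
- by rewrite (_ : Ordinal hi = axis1) //; apply: val_inj.
- by rewrite (_ : Ordinal hi = axis2) //; apply: val_inj.
Qed.

Lemma third_axis (i i' : 'I_3) : exists j : 'I_3, j != i /\ j != i'.
Proof.
move: i i'; apply: axis_ind; apply: axis_ind;
  by [exists axis1 | exists axis2 | exists axis0].
Qed.

Lemma mulz_digit_adj (m q q' d d' : int) : 3 <= m -> 0 <= d < m -> 0 <= d' < m ->
  `|(m * q + d) - (m * q' + d')| <= 1 ->
  [\/ q = q' /\ `|d - d'| <= 1, [/\ q' = q + 1, d = m - 1 & d' = 0] |
      [/\ q' = q - 1, d = 0 & d' = m - 1]].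
Proof.
move=> m3 hd hd' adj.
have [E|[E|[E|[E|E]]]] : (q = q' \/ q' = q + 1 \/ q' = q - 1 \/ q' >= q + 2 \/ q' <= q - 2).
  by lia.
- by apply: Or31; subst q'; lia.
- by apply: Or32; subst q'; rewrite mulrDr mulr1 in adj; split; lia.
- by apply: Or33; subst q'; rewrite mulrBr mulr1 in adj; split; lia.
- have : m * (q + 2) <= m * q' by rewrite ler_pM2l //; lia.
  by rewrite mulrDr; lia.
- have : m * q' <= m * (q - 2) by rewrite ler_pM2l //; lia.
  by rewrite mulrBr; lia.
Qed.

Lemma int_path (joined : int -> int -> Prop) (Q : int -> Prop) v w :
  (forall t, joined t t) -> (forall t t', joined t t' -> joined t' t) ->
  (forall t1 t2 t3, joined t1 t2 -> joined t2 t3 -> joined t1 t3) ->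
  (forall t, Q t -> Q (t + 1) -> joined t (t + 1)) ->
  (forall t, v <= t <= w \/ w <= t <= v -> Q t) -> joined v w.
Proof.
move=> j_refl j_sym j_trans j_step.
wlog vw : v w / v <= w.
  move=> up Qvw; case: (leP v w) => vw; first exact: up.
  by apply: j_sym; apply: up => [|t vtw]; [exact: ltW|apply: Qvw; lia].
have [N EN] : exists N : nat, w = v + N%:Z by exists `|w - v|%N; lia.
subst w => Qvw; elim: N Qvw {vw} => [|N IH] Qvw; first by rewrite addr0.
have -> : v + N.+1%:Z = v + N%:Z + 1 by lia.
by apply: j_trans (IH _) (j_step _ _ _) => [t ht||]; apply: Qvw; lia.
Qed.

Definition even_int (v : int) : bool := ~~ odd `|v|%N.

Lemma even_intS v : even_int (v + 1) = ~~ even_int v.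
Proof.
rewrite /even_int; case: v => v; first by rewrite (_ : absz (Posz v + 1) = v.+1) //; lia.
by rewrite (_ : absz (Negz v + 1) = v) ?negbK //; lia.
Qed.

Definition cube := 'I_3 -> int.

Definition set_coord (x : cube) (i : 'I_3) (v : int) : cube :=
  fun j => if j == i then v else x j.

Lemma set_coord_id x i : set_coord x i (x i) = x.
Proof. by apply/funext => j; rewrite /set_coord; case: eqP => [->|]. Qed.

Lemma set_coord_eq x i v : set_coord x i v i = v.
Proof. by rewrite /set_coord eqxx. Qed.

Lemma set_coord_neq x i v j : j != i -> set_coord x i v j = x j.
Proof. by rewrite /set_coord => /negbTE ->. Qed.

Lemma set_coordK x i v v' : set_coord (set_coord x i v) i v' = set_coord x i v'.
Proof. by apply/funext => j; rewrite /set_coord; case: eqP. Qed.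

Definition adjacent (x y : cube) : Prop := forall j, `|x j - y j| <= 1.

Lemma adjacent_sym x y : adjacent x y -> adjacent y x.
Proof. by move=> xy j; have := xy j; lia. Qed.

(* The cubes [(2 i, 2 i, 2 i)] of the coarsest subdivision carry the tags [i]. *)
Definition seed_tag (x : cube) : option nat :=
  if pselect (exists i : nat, forall j, x j = (i.*2)%:Z) is left h
  then Some (projT1 (cid h)) else None.

Lemma seed_tagP x i : seed_tag x = Some i <-> forall j, x j = (i.*2)%:Z.
Proof.
rewrite /seed_tag; case: pselect => [h|h]; last by split=> // H; case: h; exists i.
case: cid => i' /= H; split=> [[<-] //|H2]; congr Some.
by have := H ord0; rewrite (H2 ord0); lia.
Qed.

Section Coloring.
Variables (n : nat) (e : nat -> 'I_n -> bool).

(* Every cube is divided into [scale]^3 subcubes, the [p]-th diagonal one being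
   the subcube with the three coordinates [center p]. *)
Definition scale : int := (n.*2.+1)%:Z.
Definition center (p : 'I_n) : int := (p.*2.+1)%:Z.

Lemma scale_ge3 (p : 'I_n) : 3 <= scale.
Proof. by rewrite /scale; have := ltn_ord p; lia. Qed.

Lemma center_itv p : 0 < center p < scale - 1.
Proof. by rewrite /scale /center; have := ltn_ord p; lia. Qed.

Lemma center_adj_inj p q : `|center p - center q| <= 1 -> p = q.
Proof. by rewrite /center => pq; apply: val_inj => /=; lia. Qed.

Definition subcube (x d : cube) : cube := fun j => scale * x j + d j.
Definition is_digit (d : cube) : Prop := forall j, 0 <= d j < scale.
Definition parent (y : cube) : cube := fun j => (y j %/ scale)%Z.
Definition digit (y : cube) : cube := fun j => (y j %% scale)%Z.

Lemma subcubeE y : exists x d, is_digit d /\ y = subcube x d.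
Proof.
exists (parent y), (digit y); split.
  by move=> j; rewrite modz_ge0 //= ltz_pmod.
by apply/funext => j; rewrite /subcube mulrC -divz_eq.
Qed.

Lemma parent_subcube x d : is_digit d -> parent (subcube x d) = x.
Proof.
move=> hd; apply/funext => j; have [h0 h1] := andP (hd j).
by rewrite /parent /subcube mulrC divzMDl // divz_small ?addr0 //; apply/andP.
Qed.

Lemma digit_subcube x d : is_digit d -> digit (subcube x d) = d.
Proof.
move=> hd; apply/funext => j; have [h0 h1] := andP (hd j).
by rewrite /digit /subcube mulrC modzMDl modz_small //; apply/andP.
Qed.

Lemma subcube_set_coord x d i v :
  subcube x (set_coord d i v) = set_coord (subcube x d) i (scale * x i + v).
Proof. by apply/funext => j; rewrite /subcube /set_coord; case: eqP => [->|]. Qed.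

Lemma is_digit_set_coord d i v :
  is_digit d -> 0 <= v < scale -> is_digit (set_coord d i v).
Proof. by move=> hd hv j; rewrite /set_coord; case: eqP. Qed.

Lemma adjacent_subcube x d x' d' (p : 'I_n) : is_digit d -> is_digit d' ->
  adjacent (subcube x d) (subcube x' d') ->
  forall j, [\/ x j = x' j /\ `|d j - d' j| <= 1,
    [/\ x' j = x j + 1, d j = scale - 1 & d' j = 0] |
    [/\ x' j = x j - 1, d j = 0 & d' j = scale - 1]].
Proof. by move=> hd hd' xy j; apply: mulz_digit_adj (scale_ge3 p) (hd j) (hd' j) (xy j). Qed.

Lemma adjacent_parent x d x' d' (p : 'I_n) : is_digit d -> is_digit d' ->
  adjacent (subcube x d) (subcube x' d') -> adjacent x x'.
Proof.
by move=> hd hd' xy j; case: (adjacent_subcube p hd hd' xy j) => [[]|[]|[]]; lia.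
Qed.

(* The colours that will occur in an undivided cube with tag [u]. *)
Definition allowed (u : option nat) (p : 'I_n) : bool :=
  if u is Some i then e i p else true.

Definition allows (c : 'I_n + option nat) (p : 'I_n) : bool :=
  match c with inl q => q == p | inr u => allowed u p end.

Definition on_arm (present : cube -> bool) (x d : cube) (p : 'I_n) : bool :=
  [exists i : 'I_3, [&& [forall j, (j != i) ==> (d j == center p)],
    (d i == scale - 1) ==> present (set_coord x i (x i + 1)) &
    (d i == 0) ==> present (set_coord x i (x i - 1))]].

(* [inl p]: the cube has colour [p]; [inr u]: it is still to be subdivided, and
   only the colours allowed by [u] will occur in it.  Inside such a cube colour
   [p] receives the three axis-parallel lines of subcubes through the [p]-th
   diagonal subcube, except where they would run into a region without [p]. *)
Fixpoint color (k : nat) (y : cube) {struct k} : 'I_n + option nat :=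
  if k is k'.+1 then
    let x := parent y in
    match color k' x with
    | inl p => inl p
    | inr u =>
        if [pick p | allowed u p &&
              on_arm (fun x' => allows (color k' x') p) x (digit y) p] is Some p
        then inl p else inr u
    end
  else inr (seed_tag y).

Definition meets k x p := allows (color k x) p.

Lemma color0 y : color 0 y = inr (seed_tag y). Proof. by []. Qed.

Lemma colorS k x d : is_digit d -> color k.+1 (subcube x d) =
  match color k x with
  | inl p => inl p
  | inr u => if [pick p | allowed u p && on_arm (meets k ^~ p) x d p] is Some p
             then inl p else inr u
  end.
Proof. by move=> hd /=; rewrite parent_subcube // digit_subcube. Qed.

Arguments color : simpl never.

Lemma on_armP (present : cube -> bool) x d p :
  reflect (exists i : 'I_3, [/\ forall j, j != i -> d j = center p,
      d i = scale - 1 -> present (set_coord x i (x i + 1)) &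
      d i = 0 -> present (set_coord x i (x i - 1))])
    (on_arm present x d p).
Proof.
apply: (iffP existsP) => -[i].
  case/and3P=> /forallP h1 /implyP h2 /implyP h3; exists i; split.
  - by move=> j ji; apply/eqP; have /implyP := h1 j; apply.
  - by move=> E; apply: h2; apply/eqP.
  - by move=> E; apply: h3; apply/eqP.
case=> h1 h2 h3; exists i; apply/and3P; split.
- by apply/forallP => j; apply/implyP => ji; apply/eqP/h1.
- by apply/implyP => /eqP.
- by apply/implyP => /eqP.
Qed.

Lemma on_arm_uniq present present' x x' d p q :
  on_arm present x d p -> on_arm present' x' d q -> p = q.
Proof.
case/on_armP=> i [di _ _] /on_armP [i' [di' _ _]]; have [j [ji ji']] := third_axis i i'.
by apply: center_adj_inj; rewrite -(di _ ji) -(di' _ ji') subrr.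
Qed.

Lemma colorS_inl k x d p : is_digit d -> color k.+1 (subcube x d) = inl p ->
  color k x = inl p \/
  exists u, [/\ color k x = inr u, allowed u p & on_arm (meets k ^~ p) x d p].
Proof.
move=> hd; rewrite colorS //; case: (color k x) => [q [->]|u]; first by left.
by case: pickP => // q /andP [h1 h2] [<-]; right; exists u.
Qed.

Lemma colorS_arm k x d p u : is_digit d -> color k x = inr u -> allowed u p ->
  on_arm (meets k ^~ p) x d p -> color k.+1 (subcube x d) = inl p.
Proof.
move=> hd E up arm; rewrite colorS // E; case: pickP => [q /andP [_ arm']|/(_ p)].
  by rewrite (on_arm_uniq arm arm').
by rewrite up arm.
Qed.

Lemma colorS_colored k x d p :
  is_digit d -> color k x = inl p -> color k.+1 (subcube x d) = inl p.
Proof. by move=> hd E; rewrite colorS // E. Qed.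

Lemma colorS_inr k x d u :
  is_digit d -> color k.+1 (subcube x d) = inr u -> color k x = inr u.
Proof.
by move=> hd; rewrite colorS //; case: (color k x) => // u'; case: pickP => // _ [->].
Qed.

Lemma meetsS k x d p : is_digit d -> meets k.+1 (subcube x d) p -> meets k x p.
Proof.
move=> hd; rewrite /meets; case E: (color k.+1 _) => [q|u] /=.
  by move/eqP=> <-; case: (colorS_inl hd E) => [-> /=|[u [-> h _]] //]; rewrite eqxx.
by rewrite (colorS_inr hd E).
Qed.

Lemma on_arm_adjacent present x d x' d' p : is_digit d -> is_digit d' ->
  adjacent (subcube x d) (subcube x' d') -> on_arm present x d p -> x = x' \/ present x'.
Proof.
move=> hd hd' xy /on_armP [i [di up down]]; have H := adjacent_subcube p hd hd' xy.
have E j : j != i -> x' j = x j.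
  move=> ji; have := center_itv p.
  by case: (H j) => [[]|[_]|[_]]; rewrite ?(di _ ji) //; lia.
have x'E v : x' i = v -> x' = set_coord x i v.
  by move=> xi; apply/funext => j; rewrite /set_coord; case: eqP => [->//|/eqP/E].
case: (H i) => [[xi _]|[xi ei _]|[xi ei _]].
- by left; apply/funext => j; case: (eqVneq j i) => [->//|/E].
- by right; rewrite (x'E _ xi); apply: up.
- by right; rewrite (x'E _ xi); apply: down.
Qed.

Lemma on_arm_adjacent_inj present present' x d x' d' p q :
  is_digit d -> is_digit d' -> adjacent (subcube x d) (subcube x' d') ->
  on_arm present x d p -> on_arm present' x' d' q -> p = q.
Proof.
move=> hd hd' xy /on_armP [i [di _ _]] /on_armP [i' [di' _ _]].
have [j [ji ji']] := third_axis i i'; apply: center_adj_inj.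
rewrite -(di _ ji) -(di' _ ji'); have := center_itv p; rewrite -(di _ ji).
by case: (adjacent_subcube p hd hd' xy j) => [[]|[_]|[_]]; lia.
Qed.

Lemma color_adjacent k x y p : adjacent x y -> color k x = inl p -> meets k y p.
Proof.
elim: k x y p => [|k IH] y1 y2 p y12; first by rewrite color0.
have [x1 [d1 [hd1 E1]]] := subcubeE y1; have [x2 [d2 [hd2 E2]]] := subcubeE y2.
subst y1 y2; have x12 := adjacent_parent p hd1 hd2 y12.
move=> col1; have arm1 := colorS_inl hd1 col1.
have meets2 : meets k x2 p.
  case: arm1 => [/(IH _ _ _ x12) //|[u [Eu up arm]]].
  by case: (on_arm_adjacent hd1 hd2 y12 arm) => [<-|//]; rewrite /meets Eu.
move: meets2; rewrite /meets; case Ex2: (color k x2) => [q|u] /=.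
  by rewrite (colorS_colored hd2 Ex2).
case Ey2: (color k.+1 (subcube x2 d2)) => [q|u'] /=; last first.
  by have := colorS_inr hd2 Ey2; rewrite Ex2 => -[<-].
move=> _; case: (colorS_inl hd2 Ey2) => [|[u' [_ _ arm2]]]; first by rewrite Ex2.
case: arm1 => [col|[u1 [_ _ arm]]]; last by rewrite (on_arm_adjacent_inj hd1 hd2 y12 arm arm2).
case: (on_arm_adjacent hd2 hd1 (adjacent_sym y12) arm2) => [Ex|].
  by move: col; rewrite -Ex Ex2.
by rewrite /meets col eq_sym.
Qed.

Lemma tag_adjacent k x y u u' (p : 'I_n) : adjacent x y ->
  color k x = inr u -> color k y = inr u' -> [\/ u = u', u = None | u' = None].
Proof.
elim: k x y => [|k IH] y1 y2 y12.
  rewrite !color0; case=> <- [<-]; case E1: (seed_tag y1) => [i|]; last by apply: Or32.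
  case E2: (seed_tag y2) => [i'|]; last by apply: Or33.
  apply: Or31; congr Some; move/seed_tagP: E1 => /(_ ord0) E1.
  by move/seed_tagP: E2 => /(_ ord0) E2; have := y12 ord0; rewrite E1 E2; lia.
have [x1 [d1 [hd1 E1]]] := subcubeE y1; have [x2 [d2 [hd2 E2]]] := subcubeE y2.
subst y1 y2; move=> /(colorS_inr hd1) Ex1 /(colorS_inr hd2) Ex2.
exact: IH (adjacent_parent p hd1 hd2 y12) Ex1 Ex2.
Qed.

Definition center_digit (p : 'I_n) : cube := fun=> center p.

Lemma is_digit_center p : is_digit (center_digit p).
Proof. by move=> j; have := center_itv p; rewrite /center_digit; lia. Qed.

Lemma on_arm_line (present : cube -> bool) x (p : 'I_n) i v :
  (v = scale - 1 -> present (set_coord x i (x i + 1))) ->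
  (v = 0 -> present (set_coord x i (x i - 1))) ->
  on_arm present x (set_coord (center_digit p) i v) p.
Proof.
move=> up down; apply/on_armP; exists i; rewrite set_coord_eq; split=> // j ji.
exact: set_coord_neq.
Qed.

Lemma color_center k x u p : color k x = inr u -> allowed u p ->
  color k.+1 (subcube x (center_digit p)) = inl p.
Proof.
move=> E up; apply: (colorS_arm (is_digit_center p) E up).
rewrite -(set_coord_id (center_digit p) ord0).
by apply: on_arm_line; have := center_itv p; rewrite /center_digit; lia.
Qed.

Section Connections.
Variable p : 'I_n.

(* An abstract form of "the representatives of two cubes meeting colour [p] lie
   in the same component". *)
Variable joined : nat * cube -> nat * cube -> Prop.
Hypothesis joined_refl : forall a, joined a a.
Hypothesis joined_sym : forall a b, joined a b -> joined b a.
Hypothesis joined_trans : forall a b c, joined a b -> joined b c -> joined a c.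
Hypothesis joined_face : forall k x i, color k x = inl p ->
  color k (set_coord x i (x i + 1)) = inl p ->
  joined (k, x) (k, set_coord x i (x i + 1)).
Hypothesis joined_subcube : forall k x d, is_digit d -> color k x = inl p ->
  joined (k.+1, subcube x d) (k, x).

Definition representative k x : nat * cube :=
  if color k x is inl _ then (k, x) else (k.+1, subcube x (center_digit p)).

Lemma joined_line k x i v w :
  (forall t, v <= t <= w \/ w <= t <= v -> color k (set_coord x i t) = inl p) ->
  joined (k, set_coord x i v) (k, set_coord x i w).
Proof.
apply: (@int_path (fun t t' => joined (k, set_coord x i t) (k, set_coord x i t'))).
- by [].
- by move=> t t'; exact: joined_sym.
- by move=> t1 t2 t3; exact: joined_trans.
move=> t Et Et1; have E : set_coord x i (t + 1) =
    set_coord (set_coord x i t) i (set_coord x i t i + 1) by rewrite set_coordK set_coord_eq.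
by rewrite E; apply: joined_face; rewrite -?E.
Qed.

(* [v] is the digit of the subcubes at one end of the arms in direction [i]. *)
Lemma joined_arm_end k x i v : meets k x p ->
  v = scale - 1 /\ meets k (set_coord x i (x i + 1)) p \/
  v = 0 /\ meets k (set_coord x i (x i - 1)) p ->
  color k.+1 (subcube x (set_coord (center_digit p) i v)) = inl p /\
  joined (representative k x) (k.+1, subcube x (set_coord (center_digit p) i v)).
Proof.
move=> xp end_v; have hc := center_itv p.
have hd t : 0 <= t < scale -> is_digit (set_coord (center_digit p) i t).
  by apply: is_digit_set_coord; exact: is_digit_center.
rewrite /representative; move: (xp); rewrite /meets; case E: (color k x) => [q|u] /= h.
  move/eqP: h => h; subst q; have hv : is_digit (set_coord (center_digit p) i v).
    by apply: hd; lia.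
  by split; [exact: colorS_colored E|apply: joined_sym; exact: joined_subcube E].
have line t : center p <= t <= v \/ v <= t <= center p ->
    color k.+1 (subcube x (set_coord (center_digit p) i t)) = inl p.
  move=> ht; apply: colorS_arm E h _; first by apply: hd; lia.
  by apply: on_arm_line => Et; case: end_v => -[Ev] //; lia.
split; first by apply: line; lia.
rewrite -{1}(set_coord_id (center_digit p) i) !subcube_set_coord.
apply: joined_line => t ht; rewrite (_ : t = scale * x i + (t - scale * x i)); last by lia.
by rewrite -subcube_set_coord; apply: line; move: ht; rewrite /center_digit; lia.
Qed.

Lemma joined_step k x i : meets k x p -> meets k (set_coord x i (x i + 1)) p ->
  joined (representative k x) (representative k (set_coord x i (x i + 1))).
Proof.
move=> xp; set y := set_coord x i (x i + 1) => yp.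
have Ex : set_coord y i (y i - 1) = x by rewrite /y set_coordK set_coord_eq addrK set_coord_id.
have [|color_x join_x] := @joined_arm_end k x i (scale - 1) xp; first by left.
have [|color_y join_y] := @joined_arm_end k y i 0 yp; first by right; rewrite Ex.
apply: joined_trans join_x _; apply: joined_trans _ (joined_sym join_y).
set z := subcube x _ in color_x *.
have E : subcube y (set_coord (center_digit p) i 0) = set_coord z i (z i + 1).
  rewrite /z !subcube_set_coord set_coordK set_coord_eq /y set_coord_eq.
  apply/funext => j; rewrite /set_coord /subcube.
  by case: eqP => // _; lia.
by rewrite E; apply: joined_face; rewrite -?E.
Qed.

Lemma joined_move k x i w :
  (forall t, x i <= t <= w \/ w <= t <= x i -> meets k (set_coord x i t) p) ->
  joined (representative k x) (representative k (set_coord x i w)).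
Proof.
rewrite -[X in joined (representative k X) _](set_coord_id x i).
apply: (@int_path (fun t t' => joined (representative k (set_coord x i t))
  (representative k (set_coord x i t')))).
- by [].
- by move=> t t'; exact: joined_sym.
- by move=> t1 t2 t3; exact: joined_trans.
move=> t xt xt1; have E : set_coord x i (t + 1) =
    set_coord (set_coord x i t) i (set_coord x i t i + 1) by rewrite set_coordK set_coord_eq.
by rewrite E; apply: joined_step; rewrite -?E.
Qed.

(* A subcube two of whose digits are safe lies on no arm of a colour other than
   [p], the coordinates of diagonal subcubes being odd. *)
Definition safe (v : int) : Prop := even_int v \/ v = center p.

Section InsideCube.
Variables (k : nat) (x : cube) (u : option nat).
Hypothesis x_tag : color k x = inr u.
Hypothesis u_allows : allowed u p.

Lemma meets_safe d i : is_digit d -> (forall j, j != i -> safe (d j)) ->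
  meets k.+1 (subcube x d) p.
Proof.
move=> hd safe_d; rewrite /meets; case Ed: (color k.+1 _) => [q|u'] /=; last first.
  by have := colorS_inr hd Ed; rewrite x_tag => -[<-].
case: (colorS_inl hd Ed) => [|[u' [_ _ /on_armP [i' [di' _ _]]]]]; first by rewrite x_tag.
have [j [ji ji']] := third_axis i i'; case: (safe_d _ ji); rewrite (di' _ ji').
  by rewrite /even_int /center /= odd_double.
by move=> Eq; apply/eqP/center_adj_inj; rewrite Eq subrr.
Qed.

Lemma joined_move_center d i : is_digit d -> (forall j, j != i -> safe (d j)) ->
  joined (representative k.+1 (subcube x d))
    (representative k.+1 (subcube x (set_coord d i (center p)))).
Proof.
move=> hd safe_d; rewrite subcube_set_coord; apply: joined_move => t ht.
rewrite (_ : t = scale * x i + (t - scale * x i)); last by lia.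
rewrite -subcube_set_coord; apply: (meets_safe (i := i)) => [|j ji].
  apply: is_digit_set_coord => //; have := hd i; have := center_itv p.
  by move: ht; rewrite /subcube; lia.
by rewrite set_coord_neq //; exact: safe_d.
Qed.

Lemma representative_center :
  representative k.+1 (subcube x (center_digit p)) = (k.+1, subcube x (center_digit p)).
Proof. by rewrite /representative (color_center x_tag u_allows). Qed.

Lemma joined_safe_center d : is_digit d -> (forall j, safe (d j)) ->
  joined (representative k.+1 (subcube x d)) (k.+1, subcube x (center_digit p)).
Proof.
move=> hd safe_d; have hc := center_itv p.
have digit_c d' i : is_digit d' -> is_digit (set_coord d' i (center p)).
  by move=> hd'; apply: is_digit_set_coord => //; lia.
have safe_c d' i : (forall j, safe (d' j)) -> forall j, safe (set_coord d' i (center p) j).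
  by move=> safe_d' j; rewrite /set_coord; case: eqP => // _; right.
pose d1 := set_coord d axis0 (center p); pose d2 := set_coord d1 axis1 (center p).
have Ed : set_coord d2 axis2 (center p) = center_digit p by apply/funext; exact: axis_ind.
rewrite -representative_center -Ed.
have move0 := joined_move_center hd (fun j (_ : j != axis0) => safe_d j).
have hd1 := digit_c _ axis0 hd; have safe1 := safe_c _ axis0 safe_d.
have move1 := joined_move_center hd1 (fun j (_ : j != axis1) => safe1 j).
have hd2 := digit_c _ axis1 hd1; have safe2 := safe_c _ axis1 safe1.
apply: joined_trans move0 _; apply: joined_trans move1 _.
exact: joined_move_center hd2 (fun j (_ : j != axis2) => safe2 j).
Qed.

Lemma uncolored_pred d i : is_digit d -> color k.+1 (subcube x d) = inr u ->
  ~~ even_int (d i) -> let d' := set_coord d i (d i - 1) in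
  is_digit d' /\ color k.+1 (subcube x d') = inr u.
Proof.
move=> hd Ed odd_di d'; have hd' : is_digit d'.
  apply: is_digit_set_coord => //; have := hd i; move: odd_di; rewrite /even_int.
  by case: (d i) => [[|v]|v] //=; lia.
split=> //; case Ed': (color k.+1 _) => [q|u'].
  case: (colorS_inl hd' Ed') => [|[u' []]]; rewrite x_tag // => -[<-] uq.
  case/on_armP=> i' [d'E _ _]; case: (eqVneq i i') => [ii|ii]; last first.
    have := d'E _ ii; rewrite /d' set_coord_eq => H; move: odd_di.
    have -> : d i = (q.+1.*2)%:Z by rewrite /center in H; lia.
    by rewrite /even_int /= odd_double.
  subst i'; have arm : on_arm (meets k ^~ q) x d q.
    apply/on_armP; exists i; split=> [j ji||].
    - by rewrite -(d'E _ ji) /d' set_coord_neq.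
    - move=> di; move: odd_di; rewrite di -even_intS subrK.
      by rewrite /even_int /scale /= odd_double.
    - by move=> di; move: odd_di; rewrite di.
  by move: Ed; rewrite (colorS_arm hd x_tag uq arm).
by have := colorS_inr hd' Ed'; rewrite x_tag => -[<-].
Qed.

Lemma joined_even_digit d i : is_digit d -> color k.+1 (subcube x d) = inr u ->
  exists d', [/\ is_digit d', color k.+1 (subcube x d') = inr u,
    joined (representative k.+1 (subcube x d)) (representative k.+1 (subcube x d')),
    even_int (d' i) & forall j, j != i -> d' j = d j].
Proof.
move=> hd Ed; have [ev|od] := boolP (even_int (d i)); first by exists d; split.
have [hd' Ed'] := uncolored_pred hd Ed od; exists (set_coord d i (d i - 1)); split=> //.
- apply: joined_sym; set y := subcube x _.
  have Ey : subcube x d = set_coord y i (y i + 1).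
    rewrite /y; apply/funext => j; rewrite /subcube /set_coord eqxx.
    by case: eqP => [->|_] //; lia.
  by rewrite Ey; apply: joined_step; rewrite -?Ey /meets ?Ed ?Ed'.
- rewrite set_coord_eq; move: od; rewrite -[X in even_int X](subrK 1) even_intS.
  by rewrite negbK.
- by move=> j ji; rewrite set_coord_neq.
Qed.

Lemma joined_center d : is_digit d -> meets k.+1 (subcube x d) p ->
  joined (representative k.+1 (subcube x d)) (k.+1, subcube x (center_digit p)).
Proof.
move=> hd; rewrite /meets; case Ed: (color k.+1 (subcube x d)) => [q|u'] /=.
  move/eqP=> qp; subst q.
  case: (colorS_inl hd Ed) => [|[u' [_ _ /on_armP [i [di _ _]]]]]; first by rewrite x_tag.
  have E : set_coord d i (center p) = center_digit p.
    by apply/funext => j; rewrite /set_coord; case: eqP => // /eqP ji; rewrite di.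
  rewrite -representative_center -E; apply: joined_move_center => // j ji.
  by right; rewrite di.
have := colorS_inr hd Ed; rewrite x_tag => -[Eu] _; subst u'.
have [d1 [hd1 E1 join1 ev1 _]] := joined_even_digit axis0 hd Ed.
have [d2 [hd2 E2 join2 ev2 d12]] := joined_even_digit axis1 hd1 E1.
have [d3 [hd3 E3 join3 ev3 d23]] := joined_even_digit axis2 hd2 E2.
apply: joined_trans join1 _; apply: joined_trans join2 _; apply: joined_trans join3 _.
apply: joined_safe_center => //.
by apply: axis_ind; left; [rewrite d23 // d12|rewrite d23|].
Qed.

End InsideCube.

Definition origin : cube := fun=> 1.

Lemma meets0_odd x i : ~~ even_int (x i) -> meets 0 x p.
Proof.
rewrite /meets color0 /=; case E: (seed_tag x) => [t|] //=.
by move/seed_tagP: E => /(_ i) ->; rewrite /even_int /= odd_double.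
Qed.

Lemma joined_origin0 x : meets 0 x p ->
  joined (representative 0 x) (representative 0 origin).
Proof.
move=> xp; have [y [oy xy]] : exists y, ~~ even_int (y axis0) /\
    joined (representative 0 x) (representative 0 y).
  have [ev|od] := boolP (even_int (x axis0)); last by exists x.
  exists (set_coord x axis0 (x axis0 + 1)); rewrite set_coord_eq even_intS ev.
  split=> //; apply: joined_step => //; apply: (meets0_odd (i := axis0)).
  by rewrite set_coord_eq even_intS ev.
pose y1 := set_coord y axis1 1; pose y2 := set_coord y1 axis2 1.
have -> : origin = set_coord y2 axis0 1 by apply/funext; exact: axis_ind.
apply: joined_trans xy _; apply: joined_trans (_ : joined _ (representative 0 y1)) _.
  by apply: joined_move => t _; apply: (meets0_odd (i := axis0)).
apply: joined_trans (_ : joined _ (representative 0 y2)) _.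
  by apply: joined_move => t _; apply: (meets0_odd (i := axis0)).
by apply: joined_move => t _; apply: (meets0_odd (i := axis1)).
Qed.

Lemma joined_origin k x : meets k x p ->
  joined (representative k x) (representative 0 origin).
Proof.
elim: k x => [|k IH] y yp; first exact: joined_origin0.
have [x [d [hd E]]] := subcubeE y; subst y.
have xp := meetsS hd yp; apply: joined_trans _ (IH _ xp).
move: (xp); rewrite /meets {2}/representative; case E: (color k x) => [q|u] /= h.
  move/eqP: h => h; subst q; rewrite /representative (colorS_colored hd E).
  exact: joined_subcube.
exact: (joined_center E h hd yp).
Qed.

End Connections.
End Coloring.
End Lattice.

(** * Lakes of Wada *)

Section Lakes.

Import Order.TTheory GRing.Theory Num.Theory.

Local Open Scope classical_set_scope.
Local Open Scope ring_scope.

Lemma connected_between (T : topologicalType) (A B : set T) :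
  connected A -> A `<=` B -> B `<=` closure A -> connected B.
Proof.
move=> cA AB BA; apply/connectedP => E [E0 EU sE].
have not_sub b : A `<=` E b -> False.
  move=> AE; have [y Ey] := E0 (~~ b).
  have By : B y by rewrite EU; case: b {AE} Ey => /= ?; [left|right].
  have cy : closure (E b) y by apply: closureS AE _ (BA _ By).
  by case: sE => h1 h2; case: b {AE} Ey cy => /= Ey cy;
    [have : (E false `&` closure (E true)) y by []; rewrite h2
    |have : (closure (E false) `&` E true) y by []; rewrite h1].
have [] : A `<=` E false \/ A `<=` E true.
- by apply: connected_subset sE _ cA; rewrite -EU.
- exact: not_sub.
- exact: not_sub.
Qed.

(* Disjoint domains such that every other point is adherent either to all of them
   or exactly to those in one of the sets [e i], the latter occurring for each [i]. *)
Record wada_lakes (T : topologicalType) n (e : nat -> 'I_n -> bool)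
    (U : 'I_n -> set T) : Prop := WadaLakes {
  wada_open : forall p, open (U p);
  wada_nonempty : forall p, U p !=set0;
  wada_connected : forall p, connected (U p);
  wada_disjoint : forall p q z, U p z -> U q z -> p = q;
  wada_trichotomy : forall z, [\/ exists p, U p z, forall p, closure (U p) z |
    exists i, forall p, closure (U p) z <-> e i p];
  wada_tag_point : forall i, exists z, forall p, closure (U p) z <-> e i p }.

Section Analysis.
Variable R : realType.

Lemma nbhs_coordP n (z : 'rV[R]_n.+1) (P : set 'rV[R]_n.+1) : nbhs z P <->
  exists2 r : R, 0 < r & forall y : 'rV_n.+1, (forall j, `|z ord0 j - y ord0 j| < r) -> P y.
Proof.
split.
  case/nbhs_ballP=> r /= r0 zP; exists r => // y yr; apply: zP; split=> // i j.
  by rewrite ord1 -ball_normE /ball_ /=; apply: yr.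
case=> r r0 zP; apply/nbhs_ballP; exists r => //= y [_ yr]; apply: zP => j.
by have := yr ord0 j; rewrite -ball_normE.
Qed.

Lemma segment_connected_component (V : normedModType R) (A : set V) (z z' : V) :
  (forall t : R, 0 <= t <= 1 -> A (z + t *: (z' - z))) -> connected_component A z z'.
Proof.
move=> zA; pose f (t : R) : V := z + t *: (z' - z).
have f0 : f 0 = z by rewrite /f scale0r addr0.
have f1 : f 1 = z' by rewrite /f scale1r addrC subrK.
have cf : continuous f.
  by move=> t; apply: cvgD; [exact: cvg_cst|exact: scalel_continuous].
apply: (@connected_component_max _ _ (f @` `[0, 1])).
- by exists 0; rewrite ?f0 //= in_itv /= lexx ler01.
- by move=> _ [t + <-]; rewrite /= in_itv /=; apply: zA.
- apply: connected_continuous_connected; first exact: segment_connected.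
  exact: continuous_subspaceT.
- by exists 1; rewrite ?f1 //= in_itv /= lexx ler01.
Qed.

Lemma lt_convex_comb (l a b t : R) :
  0 <= t <= 1 -> l < a -> l < b -> l < (1 - t) * a + t * b.
Proof.
case/andP=> t0 t1 la lb; case: (eqVneq t 0) => [->|tn].
  by rewrite subr0 mul1r mul0r addr0.
have : 0 < t * (b - l) by rewrite mulr_gt0 ?subr_gt0 // lt_neqAle eq_sym tn.
have : 0 <= (1 - t) * (a - l) by rewrite mulr_ge0 ?subr_ge0 // ltW.
by nra.
Qed.

Lemma convex_comb_lt (l a b t : R) :
  0 <= t <= 1 -> a < l -> b < l -> (1 - t) * a + t * b < l.
Proof.
move=> ht al bl; have := @lt_convex_comb (- l) (- a) (- b) t ht.
by rewrite !ltrN2 !mulrN -opprD ltrN2; apply.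
Qed.

End Analysis.

Section Wada.
Variables (R : realType) (n : nat) (e : nat -> 'I_n -> bool).
Hypothesis n_gt0 : (0 < n)%N.
Local Notation V := 'rV[R]_3.
Local Notation color := (color e).
Local Notation meets := (meets e).
Local Notation scale := (scale n).
Local Notation is_digit := (@is_digit n).
Local Notation subcube := (@subcube n).
Local Notation representative := (representative e).

Definition scaleR : R := scale%:~R.

Lemma scaleR_ge3 : 3 <= scaleR.
Proof. by rewrite /scaleR -[3]/((3%:Z)%:~R) ler_int; exact: scale_ge3 (Ordinal n_gt0). Qed.

Lemma scaleR_gt0 : 0 < scaleR. Proof. exact: lt_le_trans scaleR_ge3. Qed.

Lemma scaleRX_gt0 k : 0 < scaleR ^+ k. Proof. exact/exprn_gt0/scaleR_gt0. Qed.

Lemma scaleRX_large (r : R) : 0 < r -> exists k, 1 < r * scaleR ^+ k.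
Proof.
move=> r0; set k := Num.bound r^-1; exists k.
have rk : r^-1 < k%:R by apply: archi_boundP; rewrite invr_ge0 ltW.
have kX : k%:R <= scaleR ^+ k.
  apply: le_trans (_ : (2 ^ k)%:R <= _); first by rewrite ler_nat ltnW // ltn_expl.
  by rewrite natrX lerXn2r ?nnegrE ?ltW ?scaleR_gt0 //; have := scaleR_ge3; lra.
rewrite -(ltr_pM2l (_ : 0 < r^-1)) ?invr_gt0 // mulr1 mulKf ?gt_eqF //.
exact: lt_le_trans rk kX.
Qed.

Definition cube_at k (z : V) : cube := fun j => Num.floor (scaleR ^+ k * z ord0 j).

Lemma cube_atS k z : exists2 d, is_digit d & cube_at k.+1 z = subcube (cube_at k z) d.
Proof.
have [x [d [hd E]]] := subcubeE n (cube_at k.+1 z); exists d => //.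
rewrite E; congr subcube; apply/funext => j; apply/esym/floor_def.
have [d0 d1] := andP (hd j); set t := scaleR ^+ k * z ord0 j.
have Et : Num.floor (scaleR * t) = scale * x j + d j.
  by rewrite /t mulrA -exprS -/(cube_at k.+1 z j) E.
have := floor_le (scaleR * t); have := floorD1_gt (scaleR * t); rewrite Et => lt_t le_t.
apply/andP; split.
  by rewrite -(ler_pM2l scaleR_gt0); apply: le_trans le_t; rewrite /scaleR -intrM ler_int; lia.
rewrite -(ltr_pM2l scaleR_gt0); apply: lt_le_trans lt_t _.
by rewrite /scaleR -intrM ler_int; lia.
Qed.

Definition color_at k z := color k (cube_at k z).

Lemma color_at_colored k l z p : color_at k z = inl p -> color_at (k + l) z = inl p.
Proof.
elim: l => [|l IH]; first by rewrite addn0.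
move/IH; rewrite addnS /color_at; have [d hd ->] := cube_atS (k + l) z.
exact: colorS_colored.
Qed.

Lemma color_at_uncolored k l z u : color_at (k + l) z = inr u -> color_at k z = inr u.
Proof.
elim: l => [|l IH]; first by rewrite addn0.
rewrite addnS /color_at; have [d hd ->] := cube_atS (k + l) z.
by move/(colorS_inr hd); apply: IH.
Qed.

Lemma color_at_allowed k l z u p :
  color_at k z = inr u -> color_at (k + l) z = inl p -> allowed e u p.
Proof.
move=> E; elim: l => [|l IH]; first by rewrite addn0 E.
rewrite addnS /color_at; have [d hd ->] := cube_atS (k + l) z.
case/(colorS_inl hd); first exact: IH.
by case=> u' [E' up _]; have := color_at_uncolored E'; rewrite E => -[->].
Qed.

Lemma color_at_uniq k k' z p q : color_at k z = inl p -> color_at k' z = inl q -> p = q.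
Proof.
move=> /(@color_at_colored _ k') h1 /(@color_at_colored _ k) h2.
by move: h1 h2; rewrite addnC => -> -[].
Qed.

Definition lake p : set V := \bigcup_k [set z | color_at k z = inl p]°.

Lemma lake_open p : open (lake p).
Proof. by apply: bigcup_open => k _; exact: open_interior. Qed.

Lemma lake_color p z : lake p z -> exists k, color_at k z = inl p.
Proof. by case=> k _ /interior_subset; exists k. Qed.

Lemma lake_disjoint p q z : lake p z -> lake q z -> p = q.
Proof. by move=> /lake_color [k h1] /lake_color [k' h2]; apply: color_at_uniq h1 h2. Qed.

(* The interior of the union of the cubes with indices in [lo, hi[. *)
Definition box k (lo hi : cube) : set V :=
  [set z | forall j, (lo j)%:~R < scaleR ^+ k * z ord0 j < (hi j)%:~R].

Definition colored_box k (lo hi : cube) p : Prop :=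
  forall x, (forall j, lo j <= x j < hi j) -> color k x = inl p.

Lemma box_cube_at k lo hi z : box k lo hi z -> forall j, lo j <= cube_at k z j < hi j.
Proof.
by move=> hz j; have /andP [h1 h2] := hz j; rewrite /cube_at floor_ge_int floor_lt_int h2 ltW.
Qed.

Lemma box_open k lo hi : open (box k lo hi).
Proof.
rewrite openE => z hz; rewrite /interior.
pose dist j := Num.min (scaleR ^+ k * z ord0 j - (lo j)%:~R)
   ((hi j)%:~R - scaleR ^+ k * z ord0 j).
pose D := \big[Num.min/1]_(j < 3) dist j.
have D0 : 0 < D.
  apply: (big_ind (fun x => 0 < x)) => // [x y x0 y0|j _]; first by rewrite lt_min x0.
  by have /andP [h1 h2] := hz j; rewrite lt_min !subr_gt0 h1.
apply/nbhs_coordP; exists (D / scaleR ^+ k); first by rewrite divr_gt0 // scaleRX_gt0.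
move=> y hy j; have := hy j; rewrite ltr_pdivlMr ?scaleRX_gt0 // => hj.
have : D <= dist j by rewrite /D (bigD1 j) //= ge_min lexx.
have : `|scaleR ^+ k * z ord0 j - scaleR ^+ k * y ord0 j| < D.
  by rewrite -mulrBr normrM ger0_norm ?ltW ?scaleRX_gt0 // mulrC.
rewrite /dist le_min ltr_norml => /andP [b1 b2] /andP [a1 a2].
by apply/andP; split; lra.
Qed.

Lemma colored_box_lake k lo hi p : colored_box k lo hi p -> box k lo hi `<=` lake p.
Proof.
move=> col z hz; exists k => //; apply: (interiorS (A := box k lo hi)).
  by move=> y hy; apply: col; exact: box_cube_at.
by rewrite (interior_id _).1 //; exact: box_open.
Qed.

Lemma colored_box_joined k lo hi p z z' : colored_box k lo hi p ->
  box k lo hi z -> box k lo hi z' -> connected_component (lake p) z z'.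
Proof.
move=> col hz hz'; apply: segment_connected_component => t t01.
apply: (colored_box_lake col) => j.
rewrite !mxE; have /andP [a1 a2] := hz j; have /andP [b1 b2] := hz' j.
have -> : scaleR ^+ k * (z ord0 j + t * (z' ord0 j - z ord0 j)) =
  (1 - t) * (scaleR ^+ k * z ord0 j) + t * (scaleR ^+ k * z' ord0 j) by ring.
by rewrite lt_convex_comb //= convex_comb_lt.
Qed.

Definition midpoint k (x : cube) : V := \row_j (((x j)%:~R + 2^-1) / scaleR ^+ k).

Lemma midpointE k x j : scaleR ^+ k * (midpoint k x) ord0 j = (x j)%:~R + 2^-1.
Proof. by rewrite mxE mulrC divfK // gt_eqF // scaleRX_gt0. Qed.

Lemma midpoint_box k x lo hi : (forall j, lo j <= x j < hi j) -> box k lo hi (midpoint k x).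
Proof.
move=> hx j; rewrite midpointE; have /andP [h1 h2] := hx j.
have {}h1 : (lo j)%:~R <= (x j)%:~R :> R by rewrite ler_int.
have {}h2 : (x j)%:~R + 1 <= (hi j)%:~R :> R by rewrite -[1]/(1%:~R) -intrD ler_int; lia.
by apply/andP; split; lra.
Qed.

Definition next_corner (x : cube) : cube := fun j => x j + 1.

Lemma unit_box (x y : cube) : (forall j, x j <= y j < next_corner x j) -> y = x.
Proof. by move=> xy; apply/funext => j; have := xy j; rewrite /next_corner; lia. Qed.

Lemma colored_unit_box k x p : color k x = inl p -> colored_box k x (next_corner x) p.
Proof. by move=> E y /unit_box ->. Qed.

Lemma midpoint_unit_box k x : box k x (next_corner x) (midpoint k x).
Proof. by apply: midpoint_box => j; rewrite /next_corner; lia. Qed.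

Lemma midpoint_subcube_box k x d : is_digit d ->
  box k x (next_corner x) (midpoint k.+1 (subcube x d)).
Proof.
move=> hd j; have := midpointE k.+1 (subcube x d) j; rewrite exprS -mulrA => E.
have /andP [d0 d1] := hd j; have m0 := scaleR_gt0.
rewrite -(ltr_pM2l m0) -[X in _ && X](ltr_pM2l m0) E /subcube /next_corner.
have -> : (scale * x j + d j)%:~R = scaleR * (x j)%:~R + (d j)%:~R :> R by rewrite intrD intrM.
have {}d0 : 0 <= (d j)%:~R :> R by rewrite -[0]/(0%:~R) ler_int.
have {}d1 : (d j)%:~R + 1 <= scaleR by rewrite /scaleR -[1]/(1%:~R) -intrD ler_int; lia.
by rewrite intrD mulrDr mulr1z mulr1; apply/andP; split; lra.
Qed.

Lemma midpoint_lake k x p : color k x = inl p -> lake p (midpoint k x).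
Proof.
by move/colored_unit_box/colored_box_lake; apply; exact: midpoint_unit_box.
Qed.

Definition lake_joined p (a b : nat * cube) : Prop :=
  a = b \/ connected_component (lake p) (midpoint a.1 a.2) (midpoint b.1 b.2).

Lemma lake_joined_sym p a b : lake_joined p a b -> lake_joined p b a.
Proof. by case=> [->|ab]; [left|right; apply: connected_component_sym]. Qed.

Lemma lake_joined_trans p a b c :
  lake_joined p a b -> lake_joined p b c -> lake_joined p a c.
Proof.
by case=> [->//|ab] [<-|bc]; right=> //; exact: connected_component_trans ab bc.
Qed.

Lemma lake_joined_face p k x i :
  color k x = inl p -> color k (set_coord x i (x i + 1)) = inl p ->
  lake_joined p (k, x) (k, set_coord x i (x i + 1)).
Proof.
set y := set_coord x i _ => Ex Ey; right => /=.
apply: (@colored_box_joined k x (fun j => if j == i then x j + 2 else x j + 1)).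
- move=> w hw; have [wi|wi] : w i = x i \/ w i = x i + 1.
    by have := hw i; rewrite eqxx; lia.
  + rewrite (_ : w = x) //; apply/funext => j; have := hw j.
    by case: eqP => [->|_]; lia.
  + rewrite (_ : w = y) //; apply/funext => j; have := hw j; rewrite /y /set_coord.
    by case: eqP => [->|_]; lia.
- by apply: midpoint_box => j; case: eqP => _; lia.
- by apply: midpoint_box => j; rewrite /y /set_coord; case: eqP => [->|_]; lia.
Qed.

Lemma lake_joined_subcube p k x d : is_digit d -> color k x = inl p ->
  lake_joined p (k.+1, subcube x d) (k, x).
Proof.
move=> hd /colored_unit_box col; right; apply: (colored_box_joined col).
- exact: midpoint_subcube_box.
- exact: midpoint_unit_box.
Qed.

Lemma midpoint_component k z p : color_at k z = inl p -> lake p z ->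
  connected_component (lake p) z (midpoint k (cube_at k z)).
Proof.
move=> E pz; apply: segment_connected_component => t /andP [t0 t1].
case: (eqVneq t 0) => [->|tn]; first by rewrite scale0r addr0.
apply: (colored_box_lake (colored_unit_box E)) => j; rewrite !mxE /next_corner.
have -> : scaleR ^+ k * (z ord0 j +
    t * (((cube_at k z j)%:~R + 2^-1) / scaleR ^+ k - z ord0 j)) =
  (1 - t) * (scaleR ^+ k * z ord0 j) + t * ((cube_at k z j)%:~R + 2^-1).
  by have := scaleRX_gt0 k => /gt_eqF /negbT ?; field.
have tp : 0 < t by rewrite lt_neqAle eq_sym tn.
have := floor_le (scaleR ^+ k * z ord0 j); have := floorD1_gt (scaleR ^+ k * z ord0 j).
rewrite -/(cube_at k z j) intrD mulr1z.
move: (scaleR ^+ k * z ord0 j) (cube_at k z j)%:~R => a c h1 h2.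
by apply/andP; split; nra.
Qed.

Lemma seed_tag_origin : seed_tag origin = None.
Proof.
by case E: (seed_tag _) => [i|] //; move/seed_tagP: E => /(_ ord0); rewrite /origin; lia.
Qed.

Lemma color_origin_center p : color 1 (subcube origin (center_digit p)) = inl p.
Proof. by apply: (@color_center _ _ _ _ None); rewrite // color0 seed_tag_origin. Qed.

Lemma representative_origin p :
  representative p 0 origin = (1%N, subcube origin (center_digit p)).
Proof. by rewrite /representative color0. Qed.

Lemma lake_nonempty p : lake p !=set0.
Proof.
by exists (midpoint 1 (subcube origin (center_digit p))); apply/midpoint_lake/color_origin_center.
Qed.

Lemma lake_connected p : connected (lake p).
Proof.
have joined := joined_origin (fun a => or_introl erefl) (@lake_joined_sym p)
  (@lake_joined_trans p) (@lake_joined_face p) (@lake_joined_subcube p).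
pose b := midpoint 1 (subcube origin (center_digit p)).
suff -> : lake p = connected_component (lake p) b by exact: component_connected.
apply/seteqP; split; last exact: connected_component_sub.
move=> z pz; apply: connected_component_sym; have [k Ek] := lake_color pz.
apply: connected_component_trans (midpoint_component Ek pz) _.
have : meets k (cube_at k z) p by rewrite /meets -/(color_at k z) Ek /= eqxx.
move/joined; rewrite representative_origin {1}/representative -/(color_at k z) Ek.
case=> [[-> ->]|//].
exact/connected_component_refl/midpoint_lake/color_origin_center.
Qed.

Definition coord_ball (z : V) (r : R) : set V :=
  [set y | forall j, `|z ord0 j - y ord0 j| < r].

Lemma coord_ball_center z r : 0 < r -> coord_ball z r z.
Proof. by move=> r0 j; rewrite subrr normr0. Qed.

Lemma coord_ball_le z r r' : r <= r' -> coord_ball z r `<=` coord_ball z r'.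
Proof. by move=> rr' y hy j; apply: lt_le_trans (hy j) rr'. Qed.

Lemma adjacent_cube_at k z r y y' : r * scaleR ^+ k <= 2^-1 ->
  coord_ball z r y -> coord_ball z r y' -> adjacent (cube_at k y) (cube_at k y').
Proof.
move=> hr hy hy' j.
have dist_r : `|y ord0 j - y' ord0 j| < r + r.
  have -> : y ord0 j - y' ord0 j = (z ord0 j - y' ord0 j) - (z ord0 j - y ord0 j) by ring.
  by apply: le_lt_trans (ler_normB _ _) _; rewrite addrC ltrD.
have dist_1 : `|scaleR ^+ k * y ord0 j - scaleR ^+ k * y' ord0 j| < 1.
  rewrite -mulrBr normrM ger0_norm ?ltW ?scaleRX_gt0 // mulrC.
  have : `|y ord0 j - y' ord0 j| * scaleR ^+ k < (r + r) * scaleR ^+ k.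
    by rewrite ltr_pM2r ?scaleRX_gt0.
  by rewrite mulrDl; lra.
rewrite /cube_at; move: dist_1.
set a := scaleR ^+ k * y ord0 j; set b := scaleR ^+ k * y' ord0 j.
rewrite ltr_norml => /andP [h1 h2].
have := floor_le a; have := floorD1_gt a; have := floor_le b; have := floorD1_gt b.
rewrite !intrD !mulr1z => b2 b1 a2 a1.
have : (Num.floor a)%:~R < (Num.floor b + 2)%:~R :> R.
  by rewrite intrD -[2%:~R]/(2 : R); lra.
have : (Num.floor b)%:~R < (Num.floor a + 2)%:~R :> R.
  by rewrite intrD -[2%:~R]/(2 : R); lra.
by rewrite !ltr_int; lia.
Qed.

Lemma small_radius k (r : R) : 0 < r ->
  exists r', [/\ 0 < r', r' <= r & r' * scaleR ^+ k <= 2^-1].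
Proof.
move=> r0; have m0 := scaleRX_gt0 k; exists (Num.min r (2^-1 / scaleR ^+ k)); split.
- by rewrite lt_min r0 divr_gt0.
- by rewrite ge_min lexx.
- apply: le_trans (_ : (2^-1 / scaleR ^+ k) * scaleR ^+ k <= _); last by rewrite divfK ?gt_eqF.
  by rewrite ler_pM2r // ge_min lexx orbT.
Qed.

Lemma uncolored_near z k r : (forall p, ~ lake p z) -> 0 < r ->
  exists y u, coord_ball z r y /\ color_at k y = inr u.
Proof.
move=> no_lake r0; apply: contrapT => H.
have col y : coord_ball z r y -> exists p, color_at k y = inl p.
  by case E: (color_at k y) => [p|u] hy; [exists p|case: H; exists y, u].
have [r' [r'0 r'r hr']] := small_radius k r0.
have [p Ep] := col z (coord_ball_center z r0).
apply: (no_lake p); exists k => //; apply/nbhs_coordP; exists r' => // y hy.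
have [q Eq] := col y (coord_ball_le r'r hy).
have := color_adjacent (adjacent_cube_at hr' (coord_ball_center z r'0) hy) Ep.
by rewrite /meets -/(color_at k y) Eq /= => /eqP <-.
Qed.

Lemma closure_lake z p :
  (forall k r, 0 < r ->
     exists y u, [/\ coord_ball z r y, color_at k y = inr u & allowed e u p]) ->
  closure (lake p) z.
Proof.
move=> H B /nbhs_coordP [r r0 zB]; have r20 : 0 < r / 2 by rewrite divr_gt0.
have [k k_large] := scaleRX_large r20; have [y [u [hy E up]]] := H k _ r20.
pose c := midpoint k.+1 (subcube (cube_at k y) (center_digit p)).
exists c; split; first by apply/midpoint_lake/color_center/up.
apply: zB => j; have := midpoint_subcube_box k (cube_at k y) (@is_digit_center n p).
move/(_ j); rewrite -/c /next_corner => /andP [c1 c2].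
have := floor_le (scaleR ^+ k * y ord0 j); have := floorD1_gt (scaleR ^+ k * y ord0 j).
rewrite -/(cube_at k y j) => y2 y1.
have dist_1 : `|scaleR ^+ k * y ord0 j - scaleR ^+ k * c ord0 j| < 1.
  by rewrite ltr_norml; move: c2 y2; rewrite !intrD !mulr1z => c2 y2; apply/andP; split; lra.
have dist_yc : `|y ord0 j - c ord0 j| < r / 2.
  move: dist_1; rewrite -mulrBr normrM ger0_norm ?ltW ?scaleRX_gt0 // => dist_1.
  by rewrite -(ltr_pM2l (scaleRX_gt0 k)) (lt_trans dist_1) // mulrC.
have -> : z ord0 j - c ord0 j = (z ord0 j - y ord0 j) + (y ord0 j - c ord0 j) by ring.
apply: le_lt_trans (ler_normD _ _) _; rewrite [ltRHS]splitr.
exact: ltrD (hy j) dist_yc.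
Qed.

(* Near a point at which some level of the subdivision shows no [inr None], all
   undivided cubes carry the same tag. *)
Lemma closure_lake_tag z k0 r0 y0 i : (forall p, ~ lake p z) ->
  r0 * scaleR ^+ k0 <= 2^-1 -> 0 < r0 ->
  (forall y, coord_ball z r0 y -> color_at k0 y <> inr None) ->
  coord_ball z r0 y0 -> color_at k0 y0 = inr (Some i) ->
  forall p, closure (lake p) z <-> e i p.
Proof.
move=> no_lake small r0_gt0 no_None hy0 E0 p.
have tag y u : coord_ball z r0 y -> color_at k0 y = inr u -> u = Some i.
  move=> hy Eu; have adj := adjacent_cube_at small hy0 hy.
  case: (tag_adjacent (Ordinal n_gt0) adj E0 Eu) => [<-//|//|Eu'].
  by case: (no_None y hy); rewrite Eu Eu'.
split.
  move=> /(_ (coord_ball z r0)) []; first by apply/nbhs_coordP; exists r0.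
  move=> y [/lake_color [k Ek] hy]; case E: (color_at k0 y) => [q|u].
    have Eqp := color_at_uniq E Ek; subst q.
    have := color_adjacent (adjacent_cube_at small hy hy0) E.
    by rewrite /meets -/(color_at k0 y0) E0.
  have := color_at_allowed E (_ : color_at (k0 + k) y = inl p); rewrite (tag _ _ hy E); apply.
  by rewrite addnC; apply: color_at_colored.
move=> ep; apply: closure_lake => k r r_gt0.
have m_gt0 : 0 < Num.min r r0 by rewrite lt_min r_gt0.
have [y [u [hy E]]] := uncolored_near (k0 + k) no_lake m_gt0.
have hy1 : coord_ball z r y by apply: coord_ball_le hy; rewrite ge_min lexx.
have hy2 : coord_ball z r0 y by apply: coord_ball_le hy; rewrite ge_min lexx orbT.
exists y, u; split=> //; first by apply: (@color_at_uncolored _ k0); rewrite addnC.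
by rewrite (tag _ _ hy2 (color_at_uncolored E)).
Qed.

Lemma lake_trichotomy z : [\/ exists p, lake p z, forall p, closure (lake p) z |
  exists i, forall p, closure (lake p) z <-> e i p].
Proof.
have [|no_lake] := pselect (exists p, lake p z); first exact: Or31.
have {}no_lake p : ~ lake p z by move=> h; apply: no_lake; exists p.
have [H|] := pselect (forall k r, 0 < r ->
    exists y, coord_ball z r y /\ color_at k y = inr None).
  by apply: Or32 => p; apply: closure_lake => k r /(H k) [y [hy E]]; exists y, None.
move/existsNP => [k0 /existsNP [r /not_implyP [r_gt0 H]]]; apply: Or33.
have [r' [r'0 r'r small]] := small_radius k0 r_gt0.
have no_None y : coord_ball z r' y -> color_at k0 y <> inr None.
  by move=> hy E; apply: H; exists y; split=> //; apply: coord_ball_le hy.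
have [y0 [[i|] [hy0 E]]] := uncolored_near k0 no_lake r'0; last by case: (no_None _ hy0).
by exists i; exact: (closure_lake_tag no_lake small r'0 no_None hy0 E).
Qed.

Section TagPoint.
Variable i : nat.

(* All its digits are even, and it lies in the interior of the cube with tag [i]. *)
Definition tag_point : V := \row_j ((i.*2)%:Z%:~R + 2 / scaleR).

Lemma cube_at_tag_point0 y :
  coord_ball tag_point scaleR^-1 y -> cube_at 0 y = fun=> (i.*2)%:Z.
Proof.
move=> hy; apply/funext => j; apply: floor_def; rewrite expr0 mul1r intrD mulr1z.
have := hy j; rewrite mxE ltr_norml.
have c3 : scaleR^-1 <= 3^-1 by rewrite lef_pV2 ?posrE ?scaleR_gt0 // scaleR_ge3.
have c0 : 0 < scaleR^-1 by rewrite invr_gt0 scaleR_gt0.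
by move: (scaleR^-1) c3 c0 => c c3 c0 /andP [h1 h2]; apply/andP; split; lra.
Qed.

Lemma cube_at_tag_point k :
  cube_at k.+1 tag_point = fun=> scale ^+ k * (scale * (i.*2)%:Z + 2).
Proof.
apply/funext => j; rewrite /cube_at mxE.
suff -> : scaleR ^+ k.+1 * ((i.*2)%:Z%:~R + 2 / scaleR) =
    (scale ^+ k * (scale * (i.*2)%:Z + 2))%:~R by rewrite intrKfloor.
rewrite intrM rmorphXn intrD intrM -/scaleR exprSr -mulrA; congr (_ * _).
by rewrite mulrDr mulrCA divff ?mulr1 // gt_eqF // scaleR_gt0.
Qed.

Lemma color_at_tag_point k : color_at k tag_point = inr (Some i).
Proof.
have c_gt0 : 0 < scaleR^-1 by rewrite invr_gt0 scaleR_gt0.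
have at0 := cube_at_tag_point0 (coord_ball_center _ c_gt0).
elim: k => [|k IH]; first by rewrite /color_at at0 color0 (seed_tagP _ i).2.
have [d hd Ed] := cube_atS k tag_point.
have even_d j : d j = if k is 0%N then 2 else 0.
  have := congr1 (fun x => x j) Ed; rewrite cube_at_tag_point /subcube.
  case: k {IH Ed} => [|k]; first by rewrite at0 mul1r; lia.
  by rewrite cube_at_tag_point exprS -mulrA; lia.
rewrite /color_at Ed; case E: (color k.+1 _) => [q|u]; last first.
  by have := colorS_inr hd E; rewrite -/(color_at k _) IH => ->.
case: (colorS_inl hd E) => [|[u [_ _ /on_armP [a [h _ _]]]]].
  by rewrite -/(color_at k _) IH.
have [j [ja _]] := third_axis a a; have := h _ ja; rewrite even_d /center.
by case: k {IH Ed E even_d h} => *; lia.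
Qed.

Lemma closure_lake_tag_point p : closure (lake p) tag_point <-> e i p.
Proof.
have c_gt0 : 0 < scaleR^-1 by rewrite invr_gt0 scaleR_gt0.
apply: (@closure_lake_tag tag_point 0 scaleR^-1 tag_point) => //.
- by move=> q /lake_color [k]; rewrite color_at_tag_point.
- by rewrite expr0 mulr1 lef_pV2 ?posrE ?scaleR_gt0 //; have := scaleR_ge3; lra.
- by move=> y /cube_at_tag_point0 E; rewrite /color_at E color0 (seed_tagP _ i).2.
- exact: coord_ball_center.
- exact: color_at_tag_point.
Qed.

End TagPoint.

End Wada.

Theorem wada_lakes_exist (R : realType) n (e : nat -> 'I_n -> bool) : (0 < n)%N ->
  wada_lakes e (lake (R := R) e).
Proof.
move=> n_gt0; split.
- exact: lake_open.
- exact: lake_nonempty.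
- exact: lake_connected.
- exact: lake_disjoint.
- exact: lake_trichotomy.
- by move=> i; exists (tag_point R n i); exact: closure_lake_tag_point.
Qed.

End Lakes.

(** * Realizing a finite sample in space *)

Section Regions.
Local Open Scope classical_set_scope.
Variables (T : topologicalType) (n : nat) (U : 'I_n -> set T) (e : nat -> 'I_n -> bool).
Hypothesis lakesU : wada_lakes e U.
Hypothesis n_gt0 : 0 < n.
Hypothesis e_nonempty : forall i, exists p, e i p.

Lemma closure_U_eq p q z : U p z -> closure (U q) z -> p = q.
Proof.
move=> Up cq; have [] := cq (U p).
  by apply: open_nbhs_nbhs; split=> //; exact: (wada_open lakesU).
by move=> y [Uq Up']; exact: (wada_disjoint lakesU) Up' Uq.
Qed.

Lemma closure_U_cover z : exists p, closure (U p) z.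
Proof.
case: (wada_trichotomy lakesU z) => [[p Up]|cl|[i cl]].
- by exists p; exact: subset_closure.
- by exists (Ordinal n_gt0).
- by have [p ep] := e_nonempty i; exists p; apply/cl.
Qed.

Definition region (S : pred 'I_n) : set T := \bigcup_(p in [set p | S p]) closure (U p).

Lemma region_closed S : closed (region S).
Proof. by apply: closed_bigcup => [|p _]; [exact: finite_finset|exact: closed_closure]. Qed.

Lemma region_opp S : closure (~` region S) = region (fun p => ~~ S p).
Proof.
apply/seteqP; split.
  rewrite [X in _ `<=` X](closure_id _).1; last exact: region_closed.
  apply: closureS => z nz; have [p cp] := closure_U_cover z; exists p => //.
  by apply/negP => Sp; apply: nz; exists p.
move=> z [p Sp cp]; apply: closureS cp => y Up [q Sq cq].
by move: Sp; rewrite /= (closure_U_eq Up cq) Sq.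
Qed.

Lemma interior_region S : (region S)° = [set z | forall p, closure (U p) z -> S p].
Proof.
rewrite -[X in X°]setCK interiorC region_opp; apply/seteqP; split=> z.
  by move=> nz p cp; apply: contrapT => /negP Sp; apply: nz; exists p.
by move=> Sz [p Sp cp]; move: Sp; rewrite /= (Sz p cp).
Qed.

Lemma eq_region S S' : S =1 S' -> region S = region S'.
Proof. by move=> /funext ->. Qed.

Lemma closure_interior_region S : closure (region S)° = region S.
Proof.
rewrite -[in LHS](setCK (region S)) interiorC !region_opp.
by apply: eq_region => p; rewrite negbK.
Qed.

Lemma region_mul S S' : rc_mul (region S) (region S') = region (fun p => S p && S' p).
Proof.
rewrite /rc_mul interiorI -[RHS]closure_interior_region !interior_region; congr closure.
apply/seteqP; split=> z; first by move=> [Sz S'z] p cp; rewrite Sz ?S'z.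
by move=> SS'z; split=> p /SS'z /andP [].
Qed.

Lemma region_subset S S' : region S `<=` region S' -> forall p, S p -> S' p.
Proof.
move=> SS' p Sp; have [z Uz] := wada_nonempty lakesU p.
have [q S'q cq] : region S' z by apply: SS'; exists p => //; exact: subset_closure.
by rewrite (closure_U_eq Uz cq).
Qed.

Lemma U_sub_interior_region p (S : pred 'I_n) : S p -> U p `<=` (region S)°.
Proof. by move=> Sp z Uz; rewrite interior_region => q cq; rewrite -(closure_U_eq Uz cq). Qed.

(* The interior contains a point at which all the sets of the region meet. *)
Lemma region_connected i : connected (region (e i))°.
Proof.
have [z cl_z] := wada_tag_point lakesU i.
have star : connected (\bigcup_(p in [set p | e i p]) (U p `|` [set z])).
  apply: bigcup_connected; first by exists z => p _; right.
  move=> p ep; refine (@connected_between T (U p) _ (@wada_connected _ _ _ _ lakesU p) _ _).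
    by move=> y; left.
  by move=> y [|->]; [exact: subset_closure|apply/cl_z].
refine (@connected_between T _ _ star _ _).
  move=> y [p ep [Up|->]]; first exact: U_sub_interior_region ep _ Up.
  by rewrite interior_region => q /cl_z.
move=> y /interior_subset [p ep cp]; apply: closureS cp => x Ux.
by exists p => //; left.
Qed.

Section Splitting.
Variables (S l : pred 'I_n).
Hypothesis proper : exists p, ~~ S p.
Hypothesis unsplit : forall i, [\/ exists p, e i p && ~~ S p,
  forall p, e i p -> l p | forall p, e i p -> ~~ l p].

Lemma interior_region_side p q z : (region S)° z ->
  closure (U p) z -> closure (U q) z -> l p = l q.
Proof.
rewrite interior_region => Sz cp cq; have [r nSr] := proper.
case: (wada_trichotomy lakesU z) => [[x Ux]|cl|[i cl]].
- by rewrite -(closure_U_eq Ux cp) -(closure_U_eq Ux cq).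
- by rewrite (Sz r) in nSr.
have [ep eq_] := ((cl p).1 cp, (cl q).1 cq).
case: (unsplit i) => [[x /andP [ex nSx]]|il|il].
- by rewrite (Sz x) // in nSx; apply/cl.
- by rewrite !il.
- by rewrite (negbTE (il p ep)) (negbTE (il q eq_)).
Qed.

Lemma region_disconnected :
  (exists p, S p && l p) -> (exists p, S p && ~~ l p) -> ~ connected (region S)°.
Proof.
move=> [p /andP [Sp lp]] [q /andP [Sq nlq]]; apply/connectedPn.
pose E b := (region S)° `&` region (fun p => l p == b).
have E_disj z : (region S)° z -> region (fun p => l p == false) z ->
    region (fun p => l p == true) z -> False.
  move=> Sz [x /eqP lx cx] [y /eqP ly cy].
  by have := interior_region_side Sz cx cy; rewrite lx ly.
have closed_E b z : closure (E b) z -> region (fun p => l p == b) z.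
  by move/closureI => -[_]; rewrite -(closure_id _).1 //; exact: region_closed.
have E_nonempty b x : S x -> l x = b -> E b !=set0.
  move=> Sx lx; have [z Uz] := wada_nonempty lakesU x; exists z; split.
    exact: U_sub_interior_region Sx _ Uz.
  by exists x; [rewrite /= lx|exact: subset_closure].
exists E; split.
- by case; [exact: E_nonempty lp|exact: E_nonempty (negbTE nlq)].
- apply/seteqP; split=> z; last by case=> -[].
  move=> Sz; have [x cx] := closure_U_cover z.
  by case lx: (l x); [right|left]; split=> //; exists x => //=; rewrite lx.
- split; apply/seteqP; split=> // z.
    by case=> /closed_E fz [Sz tz]; exact: (E_disj z).
  by case=> -[Sz fz] /closed_E tz; exact: (E_disj z).
Qed.

End Splitting.

Lemma region_interpretation (v : 'I_n -> nat -> bool) : exists I : interpretation T,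
  forall t, eval I t = region (fun p => bool_eval (v p) t).
Proof.
exists (@Interpretation T (fun i => region (fun p => v p i))
  (fun i => esym (closure_interior_region (fun p => v p i)))).
elim=> [i|||t1 IH1 t2 IH2|t1 IH1 t2 IH2|t1 IH1] //=.
- by apply/seteqP; split=> // z [].
- by apply/seteqP; split=> // z _; have [p cp] := closure_U_cover z; exists p.
- rewrite IH1 IH2; apply/seteqP; split=> z.
    by case=> -[p Sp cp]; exists p => //=; rewrite Sp ?orbT.
  by case=> p /orP [] Sp cp; [left|right]; exists p.
- by rewrite IH1 IH2 region_mul.
- by rewrite IH1 /rc_opp region_opp.
Qed.

End Regions.

Section Realization.
Variables (T : topologicalType) (A : seq formula) (P : seq point) (g : nat -> bool).
Hypothesis P_nonempty : 0 < size P.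
Hypothesis P_good : good_sample A P g.
Local Notation n := (size P).

Definition nth_point (p : 'I_n) : point := nth (fun=> false, fun=> false) P p.
Local Notation value p k := (atom_value (nth_point p) (nth_atom A k)).

Lemma has_nth_point (Q : pred point) : has Q P -> exists p, Q (nth_point p).
Proof. by case/(has_nthP (fun=> false, fun=> false)) => i ltn Qi; exists (Ordinal ltn). Qed.

Lemma all_nth_point (Q : pred point) : all Q P -> forall p, Q (nth_point p).
Proof. by move/(all_nthP (fun=> false, fun=> false)) => PQ p; exact: PQ. Qed.

Lemma consistent_nth_atom k : k < size A ->
  if is_conn (nth_atom A k) then g k || split_witnessed
    (fun p k => atom_value p (nth_atom A k)) (fun p k => p.2 k) (map is_conn A) g P k
  else g k == all (fun p => atom_value p (nth_atom A k)) P.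
Proof.
move=> kA; have /consistentP/(_ k) := P_good; rewrite size_map => /(_ kA).
by rewrite /consistent_at (nth_map (Equal Zero Zero)).
Qed.

(* The atoms whose nonempty regions are required to be connected. *)
Definition required (k : nat) : bool :=
  [&& k < size A, is_conn (nth_atom A k), g k & [exists p, value p k]].

Definition meeting (k : nat) (p : 'I_n) : bool := required k ==> value p k.

Lemma meeting_nonempty k : exists p, meeting k p.
Proof.
rewrite /meeting; case req: (required k); last by exists (Ordinal P_nonempty).
by case/and4P: req => _ _ _ /existsP [q hq]; exists q.
Qed.

Variables (U : 'I_n -> set T) (I : interpretation T).
Hypothesis lakesU : wada_lakes meeting U.
Hypothesis eval_region : forall t,
  eval I t = region U (fun p => bool_eval (nth_point p).1 t).

Lemma realize_equation k t u : k < size A -> nth_atom A k = Equal t u ->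
  models I (nth_atom A k) <-> g k.
Proof.
move=> kA Ek; have := consistent_nth_atom kA; rewrite Ek /= !eval_region => /eqP ->; split.
  move=> tu; apply/(all_nthP (fun=> false, fun=> false)) => i ltn /=.
  pose p : 'I_n := Ordinal ltn; rewrite -/(nth_point p).
  by apply/eqP; apply/idP/idP; move: p; apply: (region_subset lakesU); rewrite tu.
by move/all_nth_point => tu; apply: eq_region => p; exact/eqP/tu.
Qed.

Lemma realize_connected k t : k < size A -> nth_atom A k = IntConn t -> g k ->
  connected (interior (eval I t)).
Proof.
move=> kA Ek gk; rewrite eval_region; have [/existsP [q kq]|none] := boolP [exists p, value p k].
  rewrite (@eq_region _ _ _ _ (meeting k)).
    exact: (region_connected lakesU P_nonempty meeting_nonempty).
  move=> p; rewrite /meeting /required kA Ek gk /= (_ : [exists _, _]) //.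
  by apply/existsP; exists q; move: kq; rewrite Ek.
rewrite (_ : region _ _ = set0) ?interior0; first exact: connected0.
apply/seteqP; split=> // z [p tp _]; case/existsP: none.
by exists p; rewrite Ek.
Qed.

Lemma realize_disconnected k t : k < size A -> nth_atom A k = IntConn t -> ~~ g k ->
  ~ connected (interior (eval I t)).
Proof.
move=> kA Ek ngk; have := consistent_nth_atom kA; rewrite Ek /= (negbTE ngk) /=.
case/and4P => h1 h2 h3 /allP h4; rewrite eval_region.
rewrite Ek in h1 h2 h3 h4.
apply: (region_disconnected lakesU P_nonempty meeting_nonempty
  (l := fun p => (nth_point p).2 k)) => [|i||].
- exact: has_nth_point h3.
- rewrite /meeting; case req: (required i); last first.
    by have [p hp] := has_nth_point h3; apply: Or31; exists p.
  case/and4P: req => iA ci gi _; have := h4 i; rewrite mem_iota size_map => /(_ iA).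
  rewrite (nth_map (Equal Zero Zero)) // -/(nth_atom A i) ci gi => /or3P [h|h|h].
  + by apply: Or31; exact: has_nth_point h.
  + by apply: Or32 => p; apply/implyP; exact: all_nth_point h p.
  + by apply: Or33 => p; apply/implyP; exact: all_nth_point h p.
- exact: has_nth_point h1.
- exact: has_nth_point h2.
Qed.

End Realization.

Definition atom_truths (T : topologicalType) (I : interpretation T) phi : seq bool :=
  [seq `[< models I a >] | a <- atoms phi].

Lemma nth_atom_truths (T : topologicalType) (I : interpretation T) phi k :
  k < size (atoms phi) ->
  nth false (atom_truths I phi) k = `[< models I (nth_atom (atoms phi) k) >].
Proof. by move=> kA; rewrite (nth_map (Equal Zero Zero)). Qed.

Theorem good_sample_realizable (T : topologicalType) phi (P : seq point) (g : nat -> bool) :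
  (forall n (e : nat -> 'I_n -> bool), 0 < n ->
     exists U : 'I_n -> set T, wada_lakes e U) ->
  0 < size P -> good_sample (atoms phi) P g ->
  exists I : interpretation T, atom_truths I phi = mkseq g (size (atoms phi)).
Proof.
move=> lakes P0 good; have [U lakesU] := lakes _ (meeting (atoms phi) (P := P) g) P0.
have [I eval_region] := region_interpretation lakesU P0 (meeting_nonempty _ _ P0)
  (fun p => (nth_point p).1).
exists I; apply: (@eq_from_nth _ false); rewrite size_map ?size_mkseq // => k kA.
rewrite nth_atom_truths // nth_mkseq //.
have [[t [u Ek]]|[t Ek]] := nth_atomP kA.
  have E := realize_equation good lakesU eval_region kA Ek.
  by apply/asboolP/idP => /E.
have [gk|ngk] := boolP (g k); rewrite Ek /=; [apply: asboolT|apply: asboolF].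
  exact: (realize_connected P0 lakesU eval_region kA Ek gk).
exact: (realize_disconnected P0 good lakesU eval_region kA Ek ngk).
Qed.

(** * Recognizing formulas *)

(* A token other than a digit, with the digits following it. *)
Definition lexeme := (token * seq bool)%type.

Definition is_bit (a : token) : bool := if a is TBit _ then true else false.
Definition bit_of_token (a : token) : bool := if a is TBit b then b else false.

(* Besides the lexemes, the leading digits not yet attached to a token. *)
Definition lex_step (a : token) (s : seq bool * seq lexeme) : seq bool * seq lexeme :=
  if is_bit a then (bit_of_token a :: s.1, s.2) else ([::], (a, s.1) :: s.2).

Definition lex (w : seq token) : seq bool * seq lexeme := foldr lex_step ([::], [::]) w.
Arguments lex w : simpl never.

Definition unlex (l : seq lexeme) : seq token :=
  flatten [seq x.1 :: map TBit x.2 | x <- l].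

Fixpoint term_lexemes (t : term) : seq lexeme :=
  match t with
  | Var v => [:: (TVar, bits_of_nat v)]
  | Zero => [:: (TZero, [::])]
  | One => [:: (TOne, [::])]
  | Add t1 t2 => (TAdd, [::]) :: term_lexemes t1 ++ term_lexemes t2
  | Mul t1 t2 => (TMul, [::]) :: term_lexemes t1 ++ term_lexemes t2
  | Opp t1 => (TOpp, [::]) :: term_lexemes t1
  end.

Fixpoint lexemes (phi : formula) : seq lexeme :=
  match phi with
  | Equal t1 t2 => (TEqual, [::]) :: term_lexemes t1 ++ term_lexemes t2
  | IntConn t => (TIntConn, [::]) :: term_lexemes t
  | And phi1 phi2 => (TAnd, [::]) :: lexemes phi1 ++ lexemes phi2
  | Not phi1 => (TNot, [::]) :: lexemes phi1
  end.

Lemma lex_cons a w : lex (a :: w) = lex_step a (lex w).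
Proof. by []. Qed.

Lemma unlex_lex w : map TBit (lex w).1 ++ unlex (lex w).2 = w.
Proof. by elim: w => // a w IH; rewrite -[in RHS]IH lex_cons; case: a. Qed.

Lemma lex_bits_cat b w : lex (map TBit b ++ w) = (b ++ (lex w).1, (lex w).2).
Proof.
elim: b => [|c b IH]; first by rewrite /=; case: (lex w).
by rewrite /= lex_cons IH.
Qed.

Lemma lex_term_cat t w : (lex w).1 = [::] ->
  lex (encode_term t ++ w) = ([::], term_lexemes t ++ (lex w).2).
Proof.
elim: t w => [v|||t1 IH1 t2 IH2|t1 IH1 t2 IH2|t1 IH1] w w0; rewrite /= lex_cons -?catA.
- by rewrite lex_bits_cat w0 cats0.
- by rewrite /lex_step w0.
- by rewrite /lex_step w0.
- by rewrite IH1 IH2.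
- by rewrite IH1 IH2.
- by rewrite IH1.
Qed.

Lemma lex_encode_cat phi w : (lex w).1 = [::] ->
  lex (encode phi ++ w) = ([::], lexemes phi ++ (lex w).2).
Proof.
elim: phi w => [t1 t2|t|f1 IH1 f2 IH2|f1 IH1] w w0; rewrite /= lex_cons -?catA.
- by rewrite !lex_term_cat.
- by rewrite lex_term_cat.
- by rewrite IH1 IH2.
- by rewrite IH1.
Qed.

Lemma lex_encode phi : lex (encode phi) = ([::], lexemes phi).
Proof. by rewrite -[encode phi]cats0 lex_encode_cat // cats0. Qed.

Definition arity (a : token) : nat :=
  match a with
  | TAdd | TMul | TEqual | TAnd => 2
  | TOpp | TIntConn | TNot => 1
  | _ => 0
  end.

Definition is_var (a : token) : bool := if a is TVar then true else false.
Definition is_connective (a : token) : bool :=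
  match a with TAnd | TNot => true | _ => false end.
Definition is_relation (a : token) : bool :=
  match a with TEqual | TIntConn => true | _ => false end.
Definition is_formula_head (a : token) : bool := is_connective a || is_relation a.

(* The digits of a number do not end with a zero. *)
Definition well_formed_bits (x : lexeme) : bool :=
  if is_var x.1 then last true x.2 else x.2 == [::].

(* A word in prefix notation is scanned from the right.  The stack records for
   each expression read whether it is a formula or a term. *)
Definition parse_step (x : lexeme) (s : bool * seq bool) : bool * seq bool :=
  let n := arity x.1 in
  ([&& s.1, ~~ is_bit x.1, well_formed_bits x &
       s.2 == nseq n (is_connective x.1) ++ drop n s.2],
   is_formula_head x.1 :: drop n s.2).

Definition parse (l : seq lexeme) : bool * seq bool := foldr parse_step (true, [::]) l.
Arguments parse l : simpl never.

Definition well_formed (w : seq token) : bool :=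
  [&& (lex w).1 == [::], (parse (lex w).2).1 & (parse (lex w).2).2 == [:: true]].

Lemma parse_cons x l : parse (x :: l) = parse_step x (parse l). Proof. by []. Qed.

Lemma last_bits_of_nat n : last true (bits_of_nat n).
Proof.
rewrite /bits_of_nat; case: (bin_of_nat n) => // p.
by elim: p true => //= p IH b; apply: IH.
Qed.

Lemma parse_term_cat t l :
  parse (term_lexemes t ++ l) = ((parse l).1, false :: (parse l).2).
Proof.
elim: t l => [v|||t1 IH1 t2 IH2|t1 IH1 t2 IH2|t1 IH1] l;
  rewrite /= -?catA parse_cons ?IH1 ?IH2 /parse_step /= ?drop0 ?eqxx ?andbT //.
by rewrite /well_formed_bits /= last_bits_of_nat andbT.
Qed.

Lemma parse_lexemes_cat phi l :
  parse (lexemes phi ++ l) = ((parse l).1, true :: (parse l).2).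
Proof.
by elim: phi l => [t1 t2|t|f1 IH1 f2 IH2|f1 IH1] l;
  rewrite /= -?catA parse_cons ?IH1 ?IH2 ?parse_term_cat /parse_step /= drop0 eqxx andbT.
Qed.

Lemma well_formed_encode phi : well_formed (encode phi).
Proof. by rewrite /well_formed lex_encode -[lexemes phi]cats0 parse_lexemes_cat. Qed.

(* The number with the given digits and a leading one. *)
Definition nat_of_bits (b : seq bool) : nat :=
  nat_of_bin (Npos (foldr (fun d p => if d then xI p else xO p) xH b)).

Lemma bits_of_natK b : bits_of_nat (nat_of_bits b) = rcons b true.
Proof.
rewrite /bits_of_nat /nat_of_bits nat_of_binK.
by elim: b => //= d b <-; case: d.
Qed.

Lemma nat_of_bits_inj : injective nat_of_bits.
Proof. by move=> b c /(congr1 bits_of_nat); rewrite !bits_of_natK => /rcons_inj []. Qed.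

Lemma bits_of_nat_surj b : last true b -> exists v, bits_of_nat v = b.
Proof.
case/lastP: b => [|b c]; first by exists 0.
by rewrite last_rcons => ->; exists (nat_of_bits b); rewrite bits_of_natK.
Qed.

Definition expression := (term + formula)%type.
Definition encode_expression (e : expression) : seq token :=
  match e with inl t => encode_term t | inr phi => encode phi end.
Definition is_formula (e : expression) : bool := if e is inr _ then true else false.

Lemma parse_sound l : (parse l).1 -> exists es : seq expression,
  unlex l = flatten (map encode_expression es) /\ (parse l).2 = map is_formula es.
Proof.
elim: l => [|[a b] l IH]; first by exists [::].
rewrite parse_cons /parse_step /well_formed_bits => /= /and4P [/IH [es [lE sE]] nb bits args].
rewrite /unlex /= -/(unlex l) lE; move: args bits nb; rewrite sE.
case: a => [|c|||||||||] //= /eqP.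
- move=> _ /bits_of_nat_surj [v <-] _; exists (inl (Var v) :: es).
  by rewrite /= drop0.
- by move=> _ /eqP -> _; exists (inl Zero :: es); rewrite /= drop0.
- by move=> _ /eqP -> _; exists (inl One :: es); rewrite /= drop0.
- case: es {lE sE} => [|[t1|?] [|[t2|?] es]] //= _ /eqP -> _.
  by exists (inl (Add t1 t2) :: es); rewrite /= drop0 -catA.
- case: es {lE sE} => [|[t1|?] [|[t2|?] es]] //= _ /eqP -> _.
  by exists (inl (Mul t1 t2) :: es); rewrite /= drop0 -catA.
- case: es {lE sE} => [|[t1|?] es] //= _ /eqP -> _.
  by exists (inl (Opp t1) :: es); rewrite /= drop0.
- case: es {lE sE} => [|[t1|?] [|[t2|?] es]] //= _ /eqP -> _.
  by exists (inr (Equal t1 t2) :: es); rewrite /= drop0 -catA.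
- case: es {lE sE} => [|[t1|?] es] //= _ /eqP -> _.
  by exists (inr (IntConn t1) :: es); rewrite /= drop0.
- case: es {lE sE} => [|[?|f1] [|[?|f2] es]] //= _ /eqP -> _.
  by exists (inr (And f1 f2) :: es); rewrite /= drop0 -catA.
- case: es {lE sE} => [|[?|f1] es] //= _ /eqP -> _.
  by exists (inr (Not f1) :: es); rewrite /= drop0.
Qed.

Lemma well_formedP w : reflect (exists phi, w = encode phi) (well_formed w).
Proof.
apply: (iffP and3P) => [[/eqP no_bits /parse_sound [es [lE ->]] /eqP]|[phi ->]]; last first.
  by apply/and3P; exact: well_formed_encode.
have := unlex_lex w; rewrite no_bits lE /= => <-.
by case: es {lE} => [|[?|phi] [|? ?]] // _; exists phi; rewrite /= cats0.
Qed.

(** * Evaluating formulas in prefix notation *)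

Definition is_term_head (a : token) : bool :=
  match a with TVar | TZero | TOne | TAdd | TMul | TOpp => true | _ => false end.

(* The truth value of an expression with head [a], given those of its arguments
   and, if [a] is [TVar], the value [v] of the variable. *)
Definition token_value (a : token) (v b1 b2 : bool) : bool :=
  match a with
  | TVar => v
  | TOne => true
  | TAdd => b1 || b2
  | TMul | TAnd => b1 && b2
  | TOpp | TNot => ~~ b1
  | TEqual => b1 == b2
  | TIntConn => b1
  | _ => false
  end.

(* [X] lists the names of the true variables; the second component of the state
   collects the values of the atoms. *)
Definition eval_step (X : seq (seq bool)) (x : lexeme) (s : seq bool * seq bool) :
    seq bool * seq bool :=
  let v := token_value x.1 (x.2 \in X) (nth false s.1 0) (nth false s.1 1) in
  let rest := if is_connective x.1 then s.1 else drop (arity x.1) s.1 in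
  (if is_term_head x.1 then v :: rest else rest,
   if is_relation x.1 then v :: s.2 else s.2).

Definition eval_lexemes (X : seq (seq bool)) (l : seq lexeme) : seq bool * seq bool :=
  foldr (eval_step X) ([::], [::]) l.
Arguments eval_lexemes X l : simpl never.

Definition valuation_of (X : seq (seq bool)) (v : nat) : bool := bits_of_nat v \in X.

Lemma eval_lexemes_cons X x l :
  eval_lexemes X (x :: l) = eval_step X x (eval_lexemes X l).
Proof. by []. Qed.

Lemma eval_term_cat X t l : eval_lexemes X (term_lexemes t ++ l) =
  (bool_eval (valuation_of X) t :: (eval_lexemes X l).1, (eval_lexemes X l).2).
Proof.
by elim: t l => [v|||t1 IH1 t2 IH2|t1 IH1 t2 IH2|t1 IH1] l;
  rewrite /= -?catA eval_lexemes_cons ?IH1 ?IH2 /eval_step /= drop0.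
Qed.

Lemma eval_lexemes_cat X phi l : eval_lexemes X (lexemes phi ++ l) =
  ((eval_lexemes X l).1,
   [seq atom_value (valuation_of X, fun=> false) a | a <- atoms phi] ++ (eval_lexemes X l).2).
Proof.
by elim: phi l => [t1 t2|t|f1 IH1 f2 IH2|f1 IH1] l;
  rewrite /= -?catA eval_lexemes_cons ?IH1 ?IH2 ?eval_term_cat /eval_step /= ?drop0
    ?map_cat -?catA.
Qed.

Lemma eval_lexemes_atoms X phi : (eval_lexemes X (lexemes phi)).2 =
  [seq atom_value (valuation_of X, fun=> false) a | a <- atoms phi].
Proof. by rewrite -[lexemes phi]cats0 eval_lexemes_cat /= cats0. Qed.

(* The second component of the state lists the truth values of the atoms not
   yet read. *)
Definition truth_step (x : lexeme) (s : seq bool * seq bool) : seq bool * seq bool :=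
  if is_relation x.1 then (nth false s.2 0 :: s.1, behead s.2)
  else if is_connective x.1 then
    (token_value x.1 false (nth false s.1 0) (nth false s.1 1) :: drop (arity x.1) s.1, s.2)
  else s.

Definition truth_lexemes (g : seq bool) (l : seq lexeme) : seq bool * seq bool :=
  foldr truth_step ([::], g) l.
Arguments truth_lexemes g l : simpl never.

Lemma truth_lexemes_cons g x l :
  truth_lexemes g (x :: l) = truth_step x (truth_lexemes g l).
Proof. by []. Qed.

Lemma truth_term_cat g t l : truth_lexemes g (term_lexemes t ++ l) = truth_lexemes g l.
Proof.
by elim: t l => [v|||t1 IH1 t2 IH2|t1 IH1 t2 IH2|t1 IH1] l;
  rewrite /= -?catA truth_lexemes_cons ?IH1 ?IH2.
Qed.

Lemma truth_lexemes_cat (c : formula -> bool) phi l g r :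
  (truth_lexemes g l).2 = rev [seq c a | a <- atoms phi] ++ r ->
  truth_lexemes g (lexemes phi ++ l) = (bool_models c phi :: (truth_lexemes g l).1, r).
Proof.
elim: phi l r => [t1 t2|t|f1 IH1 f2 IH2|f1 IH1] l r /= bits;
  rewrite -?catA truth_lexemes_cons ?truth_term_cat.
- by rewrite /truth_step bits.
- by rewrite /truth_step bits.
- move: bits; rewrite map_cat rev_cat -catA => /IH2 bits.
  by rewrite (IH1 _ r) bits // /truth_step /= drop0.
- by rewrite (IH1 _ r) // /truth_step /= drop0.
Qed.

Lemma truth_lexemes_atoms (c : formula -> bool) phi :
  (truth_lexemes (rev [seq c a | a <- atoms phi]) (lexemes phi)).1 = [:: bool_models c phi].
Proof. by rewrite -[lexemes phi]cats0 (@truth_lexemes_cat c _ _ _ [::]) ?cats0. Qed.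

Definition is_int_conn (a : token) : bool := if a is TIntConn then true else false.

Definition conn_lexemes (l : seq lexeme) : seq bool :=
  [seq is_int_conn x.1 | x <- l & is_relation x.1].

Lemma conn_lexemes_atoms phi : conn_lexemes (lexemes phi) = map is_conn (atoms phi).
Proof.
have conn_cat l l' : conn_lexemes (l ++ l') = conn_lexemes l ++ conn_lexemes l'.
  by rewrite /conn_lexemes filter_cat map_cat.
have conn_cons x l : conn_lexemes (x :: l) =
    if is_relation x.1 then is_int_conn x.1 :: conn_lexemes l else conn_lexemes l.
  by rewrite /conn_lexemes /=; case: ifP.
have conn_term t : conn_lexemes (term_lexemes t) = [::].
  by elim: t => //= t1 IH1 t2 IH2; rewrite conn_cons /= conn_cat IH1 IH2.
by elim: phi => [t1 t2|t|f1 IH1 f2 IH2|f1 IH1] /=;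
  rewrite conn_cons /= ?conn_cat ?conn_term ?IH1 ?IH2 ?map_cat.
Qed.

Lemma eq_atom_value (p q : point) phi :
  (forall v, bits_of_nat v \in [seq x.2 | x <- lexemes phi] -> p.1 v = q.1 v) ->
  [seq atom_value p a | a <- atoms phi] = [seq atom_value q a | a <- atoms phi].
Proof.
have agree_cons b (l : seq lexeme) (a : token) c :
    b \in [seq x.2 | x <- l] -> b \in [seq x.2 | x <- (a, c) :: l].
  by rewrite /= inE => ->; rewrite orbT.
have agree_cat b (l l' : seq lexeme) :
    (b \in [seq x.2 | x <- l ++ l']) = (b \in map snd l) || (b \in map snd l').
  by rewrite map_cat mem_cat.
have agree_term t : (forall v, bits_of_nat v \in [seq x.2 | x <- term_lexemes t] ->
    p.1 v = q.1 v) -> bool_eval p.1 t = bool_eval q.1 t.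
  elim: t => [v|||t1 IH1 t2 IH2|t1 IH1 t2 IH2|t1 IH1] pq //=.
  - by apply: pq; rewrite inE.
  - by rewrite IH1 ?IH2 // => v vt; apply: pq; apply: agree_cons; rewrite agree_cat vt ?orbT.
  - by rewrite IH1 ?IH2 // => v vt; apply: pq; apply: agree_cons; rewrite agree_cat vt ?orbT.
  - by rewrite IH1 // => v vt; apply: pq; exact: agree_cons.
elim: phi => [t1 t2|t|f1 IH1 f2 IH2|f1 IH1] pq /=.
- congr [:: _ == _]; apply: agree_term => v vt; apply: pq; apply: agree_cons.
    by rewrite agree_cat vt.
  by rewrite agree_cat vt orbT.
- by congr [:: _]; apply: agree_term => v vt; apply: pq; exact: agree_cons.
- by rewrite !map_cat IH1 ?IH2 // => v vt; apply: pq; apply: agree_cons;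
    rewrite agree_cat vt ?orbT.
- by apply: IH1 => v vt; apply: pq; exact: agree_cons.
Qed.

(** * Membership in NP *)

(* The first component of a row marks the lexemes of the true variables. *)
Definition row := (seq bool * seq bool)%type.
Definition certificate := (seq row * seq bool)%type.

Definition row_values (l : seq lexeme) (r : row) : row :=
  ((eval_lexemes (mask r.1 [seq x.2 | x <- l]) l).2, r.2).

Definition consistent_rows (conn truth : seq bool) (rows : seq row) : bool :=
  consistent (fun r k => nth false r.1 k) (fun r k => nth false r.2 k) conn
    (nth false truth) rows.

Definition verifier (p : certificate * seq token) : bool :=
  let l := (lex p.2).2 in
  let conn := conn_lexemes l in
  [&& well_formed p.2, 0 < size p.1.1,
      consistent_rows conn p.1.2 [seq row_values l r | r <- p.1.1] &
      nth false (truth_lexemes (rev (mkseq (nth false p.1.2) (size conn))) l).1 0].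

Definition template (w : seq token) : certificate :=
  let l := (lex w).2 in let n := size (conn_lexemes l) in
  (nseq (n * n + 3 * n + 1) (nseq (size l) false, nseq n false), nseq n false).

Section PolynomialTime.
Variable Sigma : finType.
Local Notation encodable := (encodable Sigma).
Local Notation polytime := (@polytime Sigma _ _ _ _).

Lemma polytime_of_token_bits X (eX : encodable X) (h : token -> bool -> bool -> bool -> bool)
    (a : X -> token) (b c d : X -> bool) :
  polytime a -> polytime b -> polytime c -> polytime d ->
  polytime (fun x => h (a x) (b x) (c x) (d x)).
Proof.
move=> pa pb pc pd; apply: (eq_polytime (f := fun x => if b x
  then if c x then if d x then h (a x) true true true else h (a x) true true false
       else if d x then h (a x) true false true else h (a x) true false false
  else if c x then if d x then h (a x) false true true else h (a x) false true false
       else if d x then h (a x) false false true else h (a x) false false false)).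
  by move=> x; case: (b x); case: (c x); case: (d x).
by polytime; apply: (@polytime_of_token _ _ _ _ _ (fun t => h t _ _ _)).
Qed.

Variables (X : Type) (eX : encodable X).

Lemma polytime_lex (w : X -> seq token) : polytime w -> polytime (fun x => lex (w x)).
Proof.
move=> pw; rewrite /lex.
apply: (polytime_foldr (h := fun _ => lex_step) (r := fun n => n + 4)) => //.
- by poly_bound.
- move=> x a [b l]; rewrite /lex_step /=.
  by case: (is_bit a);
    rewrite !enc_size_pair ?enc_size_cons ?enc_size_pair ?enc_size_nil ?enc_size_bool; lia.
- by rewrite /lex_step; polytime.
- by polytime.
Qed.

Lemma polytime_parse (l : X -> seq lexeme) : polytime l -> polytime (fun x => parse (l x)).
Proof.
move=> pl; rewrite /parse.
apply: (polytime_foldr (h := fun _ => parse_step) (r := fun n => n + 4)) => //.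
- by poly_bound.
- move=> x [a b] [c s]; rewrite /parse_step /= !enc_size_pair enc_size_cons !enc_size_bool.
  by have := enc_size_drop (encodable_bool Sigma) (arity a) s; lia.
- by rewrite /parse_step /well_formed_bits; polytime.
- by polytime.
Qed.

Lemma polytime_eval_lexemes (V : X -> seq (seq bool)) (l : X -> seq lexeme) :
  polytime V -> polytime l -> polytime (fun x => eval_lexemes (V x) (l x)).
Proof.
move=> pV pl; rewrite /eval_lexemes.
apply: (polytime_foldr (h := fun x => eval_step (V x)) (r := fun n => n + 4)) => //.
- by poly_bound.
- move=> x [a b] [s t]; rewrite /eval_step /= !enc_size_pair.
  have := enc_size_drop (encodable_bool Sigma) (arity a) s.
  by case: (is_connective a); case: (is_term_head a); case: (is_relation a);
    rewrite ?enc_size_cons ?enc_size_bool; lia.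
- have pv : polytime (fun p : X * lexeme * (seq bool * seq bool) => token_value p.1.2.1
      (p.1.2.2 \in V p.1.1) (nth false p.2.1 0) (nth false p.2.1 1)).
    by apply: polytime_of_token_bits; polytime.
  by rewrite /eval_step; polytime.
- by polytime.
Qed.

Lemma polytime_truth_lexemes (g : X -> seq bool) (l : X -> seq lexeme) :
  polytime g -> polytime l -> polytime (fun x => truth_lexemes (g x) (l x)).
Proof.
move=> pg pl; rewrite /truth_lexemes.
apply: (polytime_foldr (h := fun _ => truth_step) (r := fun n => n + 4)) => //.
- by poly_bound.
- move=> x [a b] [s t]; rewrite /truth_step /=.
  have := enc_size_drop (encodable_bool Sigma) (arity a) s.
  have := enc_size_behead (encodable_bool Sigma) t.
  by case: (is_relation a); case: (is_connective a);
    rewrite !enc_size_pair ?enc_size_cons ?enc_size_bool; lia.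
- have pv : polytime (fun p : X * lexeme * (seq bool * seq bool) => token_value p.1.2.1
      false (nth false p.2.1 0) (nth false p.2.1 1)).
    by apply: polytime_of_token_bits; polytime.
  by rewrite /truth_step; polytime.
- by polytime.
Qed.

Lemma polytime_conn_lexemes (l : X -> seq lexeme) :
  polytime l -> polytime (fun x => conn_lexemes (l x)).
Proof. by move=> pl; rewrite /conn_lexemes; polytime. Qed.

Lemma polytime_well_formed (w : X -> seq token) :
  polytime w -> polytime (fun x => well_formed (w x)).
Proof.
move=> /polytime_lex pw.
have pp : polytime (fun x => parse (lex (w x)).2) by apply: polytime_parse; polytime.
by rewrite /well_formed; polytime.
Qed.

Lemma polytime_consistent_rows (conn truth : X -> seq bool) (rows : X -> seq row) :
  polytime conn -> polytime truth -> polytime rows ->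
  polytime (fun x => consistent_rows (conn x) (truth x) (rows x)).
Proof.
move=> pc pt pr.
by rewrite /consistent_rows /consistent /consistent_at /split_witnessed; polytime.
Qed.

End PolynomialTime.

Lemma polytime_verifier Sigma : polytime (Sigma := Sigma) verifier.
Proof.
have pl : polytime (Sigma := Sigma) (fun p : certificate * seq token => (lex p.2).2).
  by apply: polytime_snd; apply: polytime_lex; polytime.
have pw : polytime (Sigma := Sigma) (fun p : certificate * seq token => well_formed p.2).
  by apply: polytime_well_formed; polytime.
have pc := polytime_conn_lexemes pl.
have pm : polytime (Sigma := Sigma) (fun p : certificate * seq token =>
    [seq row_values (lex p.2).2 r | r <- p.1.1]).
  apply: (polytime_map (F := fun p r => row_values (lex p.2).2 r)); last by polytime.
  have pl' : polytime (Sigma := Sigma)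
      (fun p : certificate * seq token * row => (lex p.1.2).2).
    by apply: (polytime_comp pl); polytime.
  have pe : polytime (Sigma := Sigma) (fun p : certificate * seq token * row =>
      eval_lexemes (mask p.2.1 [seq x.2 | x <- (lex p.1.2).2]) (lex p.1.2).2).
    by apply: polytime_eval_lexemes; polytime.
  by rewrite /row_values; polytime.
have pr : polytime (Sigma := Sigma) (fun p : certificate * seq token =>
    consistent_rows (conn_lexemes (lex p.2).2) p.1.2 [seq row_values (lex p.2).2 r | r <- p.1.1]).
  by apply: polytime_consistent_rows; polytime.
have pt : polytime (Sigma := Sigma) (fun p : certificate * seq token => truth_lexemes
    (rev (mkseq (nth false p.1.2) (size (conn_lexemes (lex p.2).2)))) (lex p.2).2).
  by apply: polytime_truth_lexemes; rewrite /mkseq; polytime.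
by rewrite /verifier; polytime.
Qed.

Lemma polytime_template Sigma : polytime (Sigma := Sigma) template.
Proof.
have pl : polytime (Sigma := Sigma) (fun w : seq token => (lex w).2).
  by apply: polytime_snd; apply: polytime_lex; polytime.
have pc := polytime_conn_lexemes pl.
by rewrite /template; polytime.
Qed.

Lemma consistent_rows_good S (row_of : S -> row) (point_of : S -> point) phi truth g P :
  (forall x k, k < size (atoms phi) ->
     nth false (row_of x).1 k = atom_value (point_of x) (nth_atom (atoms phi) k) /\
     nth false (row_of x).2 k = (point_of x).2 k) ->
  (forall k, k < size (atoms phi) -> nth false truth k = g k) ->
  consistent_rows (conn_lexemes (lexemes phi)) truth (map row_of P) =
    good_sample (atoms phi) (map point_of P) g.
Proof.
move=> rowE truthE; rewrite /consistent_rows /good_sample conn_lexemes_atoms.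
transitivity (consistent (fun x k => atom_value (point_of x) (nth_atom (atoms phi) k))
    (fun x k => (point_of x).2 k) (map is_conn (atoms phi)) g P); [|apply/esym];
  apply: eq_consistent => [x k|k]; rewrite size_map => kA; rewrite ?truthE //;
  by case: (rowE x k kA).
Qed.

Lemma nth_row_values phi r k : k < size (atoms phi) ->
  nth false (row_values (lexemes phi) r).1 k =
    atom_value (valuation_of (mask r.1 [seq x.2 | x <- lexemes phi]), nth false r.2)
      (nth_atom (atoms phi) k).
Proof. by move=> kA; rewrite /= eval_lexemes_atoms (nth_map (Equal Zero Zero)). Qed.

Section Membership.
Local Open Scope classical_set_scope.
Variable T : topologicalType.

Lemma verifier_sound c w :
  (forall n (e : nat -> 'I_n -> bool), 0 < n -> exists U : 'I_n -> set T, wada_lakes e U) ->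
  verifier (c, w) -> Sat_Bc T w.
Proof.
move=> lakes /and4P [/= /well_formedP [phi ->]]; rewrite lex_encode /= => rows_gt0.
rewrite (consistent_rows_good (g := nth false c.2) (point_of := fun r : row =>
  (valuation_of (mask r.1 [seq x.2 | x <- lexemes phi]), nth false r.2))); last 2 first.
- by move=> r k kA; rewrite nth_row_values.
- by [].
case/(good_sample_realizable lakes); first by rewrite size_map.
move=> I truthsI; rewrite conn_lexemes_atoms size_map -truthsI truth_lexemes_atoms /= => phi_true.
by exists phi => //; exists I; apply/models_bool.
Qed.

Definition row_of_point (l : seq lexeme) (n : nat) (p : point) : row :=
  ([seq `[< exists2 v, bits_of_nat v = x.2 & p.1 v >] | x <- l], mkseq p.2 n).

Lemma row_of_pointE phi n p k : k < size (atoms phi) ->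
  nth false (row_values (lexemes phi) (row_of_point (lexemes phi) n p)).1 k =
    atom_value p (nth_atom (atoms phi) k).
Proof.
move=> kA; rewrite /= eval_lexemes_atoms (eq_atom_value (q := p)) ?(nth_map (Equal Zero Zero)) //.
move=> v v_phi; rewrite /= /valuation_of.
pose true_name b := `[< exists2 v, bits_of_nat v = b & p.1 v >].
rewrite (map_comp true_name snd) -filter_mask mem_filter v_phi andbT.
by apply/asboolP/idP => [[v' /bits_of_nat_inj ->]|pv] //; exists v.
Qed.

Lemma verifier_complete w : connected [set: T] -> [set: T] !=set0 -> Sat_Bc T w ->
  exists2 c, bit_variant (tree_of (template w) : tree (label void)) (tree_of c) &
    verifier (c, w).
Proof.
move=> cT T0 [phi -> [I /models_bool phi_true]].
have [P size_P good] := good_sample_exists I phi cT T0; set n := size (atoms phi) in size_P.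
exists (map (row_of_point (lexemes phi) n) P, atom_truths I phi).
  rewrite /template lex_encode /= conn_lexemes_atoms size_map -/n; split; last first.
    by apply: bit_variant_bits; rewrite size_map.
  apply: bit_variant_nseq => [|r /List.in_map_iff [p [<- _]]]; first by rewrite size_map.
  by split; apply: bit_variant_bits; [rewrite size_map|rewrite size_mkseq].
rewrite /verifier lex_encode /=; apply/and4P; split.
- exact: well_formed_encode.
- by rewrite size_map size_P; lia.
- rewrite -map_comp (consistent_rows_good (point_of := id) (g := fun k =>
    `[< models I (nth_atom (atoms phi) k) >])) ?map_id //.
    by move=> p k kA; rewrite row_of_pointE //= nth_mkseq.
  exact: nth_atom_truths.
- rewrite conn_lexemes_atoms size_map -(size_map (fun a => `[< models I a >])) mkseq_nth.
  by rewrite truth_lexemes_atoms.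
Qed.

End Membership.

Lemma normed_space_connected (R : realType) (V : normedModType R) : connected [set: V]%classic.
Proof.
rewrite (_ : [set: V]%classic = connected_component [set: V]%classic 0%R).
  exact: component_connected.
by apply/seteqP; split=> // z _; exact: segment_connected_component.
Qed.

Lemma Sat_Bc_NP (R : realType) : NP (Sat_Bc 'rV[R]_3).
Proof.
apply: (@NP_of_verifier void _ certificate _ template verifier).
- apply: bit_closed_pair; last exact/bit_closed_seq/bit_closed_bool.
  by apply: bit_closed_seq; apply: bit_closed_pair; exact/bit_closed_seq/bit_closed_bool.
- exact: polytime_template.
- exact: polytime_verifier.
- move=> w; split=> [|[c _]].
    by apply: verifier_complete; [exact: normed_space_connected|exists 0%R].
  apply: verifier_sound => n e n_gt0.
  by exists (lake e); exact: wada_lakes_exist.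
Qed.

(** * Equations in the two-element Boolean algebra *)

Definition equation := (term * term)%type.

Definition solves_equation (v : nat -> bool) (e : equation) : bool :=
  bool_eval v e.1 == bool_eval v e.2.
Definition solves (v : nat -> bool) (es : seq equation) : bool := all (solves_equation v) es.

Definition equations_formula (es : seq equation) : formula :=
  foldr And (Equal Zero Zero) [seq Equal e.1 e.2 | e <- es].

Definition const_term (b : bool) : term := if b then One else Zero.
Definition sum_terms (ts : seq term) : term := foldr Add Zero ts.
Definition exclusion (x y : nat) : equation := (Mul (Var x) (Var y), Zero).
Definition implication (x y : nat) : equation := (Mul (Var x) (Opp (Var y)), Zero).

Lemma bool_eval_const v b : bool_eval v (const_term b) = b. Proof. by case: b. Qed.

Lemma bool_eval_sum v ts : bool_eval v (sum_terms ts) = has (bool_eval v) ts.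
Proof. by elim: ts => //= t ts ->. Qed.

Lemma solves_exclusion v x y : solves_equation v (exclusion x y) = ~~ (v x && v y).
Proof. exact: eqbF_neg. Qed.

Lemma solves_implication v x y : solves_equation v (implication x y) = (v x ==> v y).
Proof. by rewrite /solves_equation /=; case: (v x); case: (v y). Qed.

Lemma solves_cat v es es' : solves v (es ++ es') = solves v es && solves v es'.
Proof. exact: all_cat. Qed.

Lemma solves_flatten v ess : solves v (flatten ess) = all (solves v) ess.
Proof. by elim: ess => //= es ess <-; exact: solves_cat. Qed.

Section Satisfiability.
Local Open Scope classical_set_scope.
Variable T : topologicalType.

Definition constant_interpretation (v : nat -> bool) : interpretation T.
Proof.
exists (fun i => if v i then setT else set0) => i; rewrite /regular_closed.
by case: (v i); rewrite ?interiorT ?closureT ?interior0 ?closure0.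
Defined.

Lemma eval_constant v t :
  eval (constant_interpretation v) t = if bool_eval v t then setT else set0.
Proof.
elim: t => [i|||t1 IH1 t2 IH2|t1 IH1 t2 IH2|t1 IH1] //=.
- rewrite IH1 IH2 /rc_add.
  by case: (bool_eval v t1); case: (bool_eval v t2); rewrite ?setTU ?setUT ?setU0.
- rewrite IH1 IH2 /rc_mul; case: (bool_eval v t1); case: (bool_eval v t2);
    by rewrite ?setTI ?set0I ?interiorT ?closureT ?interior0 ?closure0.
- by rewrite IH1 /rc_opp; case: (bool_eval v t1); rewrite /= ?setCT ?setC0 ?closureT ?closure0.
Qed.

Lemma satisfiable_equations es : [set: T] !=set0 ->
  satisfiable T (equations_formula es) <-> exists v, solves v es.
Proof.
move=> T0; split=> [[I Ies]|[v v_es]]; last first.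
  exists (constant_interpretation v); elim: es v_es => //= e es IH /andP [/eqP E /IH es_true].
  by split=> //; rewrite !eval_constant E.
pose bound e := maxn (var_bound e.1) (var_bound e.2).
have [N le_N] : exists N, foldr maxn 0 (map bound es) <= N by eexists.
have [z _ gz] := generic_exists I N openT T0; exists (fun i => `[< I i z >]).
elim: es Ies le_N => //= e es IH [E /IH {}IH]; rewrite !geq_max => /andP [/andP [e1 e2] /IH ->].
by rewrite andbT /solves_equation !(generic_eval gz) // E.
Qed.

End Satisfiability.

(** * Trajectories of a machine *)

Section Cells.
Variable A : finType.
Implicit Type t : tape A.

(* Positions are relative to the head, which is at position [W]. *)
Definition cell (W : nat) t (z : nat) : option A :=
  if z < W then nth None (tleft t) (W - z.+1)
  else nth None (thead t :: tright t) (z - W).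

(* The former position of the cell at [z.+1] after a move. *)
Definition source (d : direction) (z : nat) : nat :=
  match d with Left => z | Stay => z.+1 | Right => z.+2 end.

Lemma cell_head W t : cell W t W = thead t.
Proof. by rewrite /cell ltnn subnn. Qed.

Lemma cell_shift W d b t z : cell W (shift d (write b t)) z.+1 =
  if source d z == W then b else cell W t (source d z).
Proof.
have nth_head s : head None s = nth (None : option A) s 0 by case: s.
rewrite /cell; case: d => /=; case: t => l h r /=; rewrite ?nth_head ?nth_behead.
- case: (ltngtP z W) => [zW|zW|->]; last by rewrite ltnNge leqnSn /= (_ : W.+1 - W = 1) //; lia.
    case: ltnP => Wz; first by rewrite (_ : (W - z.+2).+1 = W - z.+1) //; lia.
    have -> : z.+1 - W = 0 by lia.
    by have -> : W - z.+1 = 0 by lia.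
  rewrite ltnNge (_ : W <= z.+1) /=; last by lia.
  have -> : z.+1 - W = (z - W.+1).+2 by lia.
  by have -> : z - W = (z - W.+1).+1 by lia.
- case: (ltngtP z.+1 W) => [zW|zW|<-] //; last by rewrite subnn.
  by rewrite (_ : z.+1 - W = (z - W).+1) //; lia.
- case: (ltngtP z.+2 W) => [zW|zW|<-]; last by rewrite subnn.
  + by rewrite (_ : W - z.+2 = (W - z.+3).+1) //; lia.
  + rewrite (_ : z.+2 - W = (z.+1 - W).+1) /=; last by lia.
    by case E: (z.+1 - W) => [|k] //=; rewrite nth_behead.
Qed.

Lemma cell_blank W z : cell W (blank_tape A) z = None.
Proof.
rewrite /cell /= !nth_nil; case: ltnP => // _.
by case: (z - W) => //= k; rewrite nth_nil.
Qed.

Lemma cell_word_left W (w : seq A) z : z < W -> cell W (tape_of_word w) z = None.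
Proof. by rewrite /cell => ->; case: w => [|a w] /=; rewrite nth_nil. Qed.

Lemma cell_word_right W (w : seq A) z : cell W (tape_of_word w) (W + z) = ohead (drop z w).
Proof.
rewrite /cell ltnNge leq_addr /= addKn; case: w => [|a w] /=.
  by case: z => //= k; rewrite nth_nil.
by case: z => //= z; elim: w z => [|b w IH] [|z] /=.
Qed.

End Cells.

Section Trajectories.
Variables (A : finType) (M : machine A).
Local Notation K := (tapes M).+1.
Local Notation action := (state M * {ffun 'I_K -> option A * direction})%type.

(* A state, the symbols under the heads, and the action taken, [None] standing
   for no action, which is possible only when the machine has halted. *)
Definition view : finType := (state M * {ffun 'I_K -> option A} * option action)%type.

Definition possible (h : view) : bool :=
  if h.2 is Some a then a \in trans h.1.1 h.1.2 else trans h.1.1 h.1.2 == finset.set0.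

Definition views : seq view := seq.filter possible (enum view).

Definition next_state (h : view) : state M := if h.2 is Some a then a.1 else h.1.1.
Definition written (h : view) (j : 'I_K) : option A :=
  if h.2 is Some a then (a.2 j).1 else h.1.2 j.
Definition head_move (h : view) (j : 'I_K) : direction :=
  if h.2 is Some a then (a.2 j).2 else Stay.

Definition successor (h : view) (c : config M) : config M :=
  (next_state h, [ffun j => shift (head_move h j) (write (written h j) (c.2 j))]).

Definition view_of (c : config M) (h : view) : Prop :=
  [/\ h \in views, h.1.1 = c.1 & h.1.2 = heads c].

Lemma mem_views h : (h \in views) = possible h.
Proof. by rewrite mem_filter mem_enum andbT. Qed.

Lemma successor_step h c : view_of c h ->
  step c (successor h c) \/ halted c /\ successor h c = c.
Proof.
case: h => -[q s] o [h_views /= Eq Es]; move: h_views; rewrite mem_views /possible /= Eq Es.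
case: o => [a c_a|/eqP hc]; [by left; exists a|right; split=> //].
case: c {Eq Es hc} => q' tp; congr (_, _).
by apply/ffunP=> j; rewrite !ffunE /written /= ffunE; case: (tp j).
Qed.

Lemma step_successor c c' : step c c' -> exists2 h, view_of c h & successor h c = c'.
Proof.
by case=> a c_a ->; exists (c.1, heads c, Some a) => //; split=> //; rewrite mem_views.
Qed.

Lemma halted_successor c : halted c -> exists2 h, view_of c h & successor h c = c.
Proof.
move=> hc; pose h : view := (c.1, heads c, None).
have ch : view_of c h by split=> //; rewrite mem_views; apply/eqP.
by exists h => //; case: (successor_step ch) => [/(halted_step hc)|[]].
Qed.

Lemma steps_trajectory k c c' : steps k c c' -> halted c' ->
  exists (f : nat -> config M) (h : nat -> view), [/\ f 0 = c,
    forall t, view_of (f t) (h t) /\ f t.+1 = successor (h t) (f t) &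
    forall t, k <= t -> f t = c'].
Proof.
move=> + hc'; elim: k c => [|k IH] c /=.
  by move=> ->; have [h ch ch'] := halted_successor hc'; exists (fun=> c'), (fun=> h).
case=> c1 /step_successor [h0 ch0 succ_c] /IH [f [h [f0 fS fk]]].
exists (fun t => if t is t'.+1 then f t' else c), (fun t => if t is t'.+1 then h t' else h0).
split=> //; first by case=> [|t] //; rewrite f0 succ_c.
by case=> // t; apply: fk.
Qed.

Lemma steps_rcons k (c c1 c2 : config M) : steps k c c1 -> step c1 c2 -> steps k.+1 c c2.
Proof.
elim: k c => [|k IH] c /=; first by move=> -> s; exists c2.
by case=> d sd /IH H /H ?; exists d.
Qed.

End Trajectories.

(** * The tableau of a computation *)

Section Tableau.
Variables (Sigma A : finType) (i : Sigma -> A) (M : machine A).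
Local Notation K := (tapes M).+1.

(* The variables state which view the machine has at a given time, which state
   it is in, and which symbol a cell holds, positions being relative to the
   heads. *)
Definition fact : finType := (view M + (state M + 'I_K * option A))%type.

Definition fact_name (t z : nat) (k : fact) : seq bool :=
  nseq t true ++ false :: nseq z true ++ false :: nseq (enum_rank k) true.

Definition fact_var (t z : nat) (k : fact) : nat := nat_of_bits (fact_name t z k).

Definition view_var t (h : view M) := fact_var t 0 (inl h).
Definition state_var t (q : state M) := fact_var t 0 (inr (inl q)).
Definition cell_var t (j : 'I_K) z (a : option A) := fact_var t z (inr (inr (j, a))).

Lemma nseq_false_inj m n s s' :
  nseq m true ++ false :: s = nseq n true ++ false :: s' -> m = n /\ s = s'.
Proof. by elim: m n => [|m IH] [|n] //= [] // /IH [-> ->]. Qed.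

Lemma fact_var_inj t z k t' z' k' :
  fact_var t z k = fact_var t' z' k' -> [/\ t = t', z = z' & k = k'].
Proof.
move/nat_of_bits_inj/nseq_false_inj=> [-> /nseq_false_inj [-> /(congr1 size)]].
by rewrite !size_nseq => /val_inj /enum_rank_inj ->.
Qed.

Definition view_equations t : seq equation :=
  (sum_terms [seq Var (view_var t h) | h <- views M], One) ::
  [seq exclusion (view_var t h) (view_var t h') |
    h <- views M, h' <- [seq h' <- views M | h' != h]].

(* The value of [F] at the view at time [t]. *)
Definition at_view t (F : view M -> term) : term :=
  sum_terms [seq Mul (Var (view_var t h)) (F h) | h <- views M].

Definition reading_equations W t : seq equation :=
  [seq implication (view_var t h) (state_var t h.1.1) | h <- views M] ++
  [seq implication (view_var t h) (cell_var t j W (h.1.2 j)) | h <- views M, j <- enum 'I_K].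

Definition state_equations t : seq equation :=
  [seq (Var (state_var t.+1 q), at_view t (fun h => const_term (next_state h == q))) |
    q <- enum (state M)].

Definition source_cell W t (x : 'I_K * option A) z (h : view M) : term :=
  if source (head_move h x.1) z == W then const_term (written h x.1 == x.2)
  else Var (cell_var t x.1 (source (head_move h x.1) z) x.2).

Definition cell_equations W t : seq equation :=
  [seq (Var (cell_var t.+1 x.1 z.+1 x.2), at_view t (source_cell W t x z)) |
    x <- enum {: 'I_K * option A}, z <- iota 0 (W + W)].

Definition step_equations W t : seq equation :=
  view_equations t ++ reading_equations W t ++ state_equations t ++ cell_equations W t.

Definition initial_symbol (j : 'I_K) (w : seq Sigma) : option A :=
  if j == ord0 then omap i (ohead w) else None.

Definition initial_equations W (w : seq Sigma) : seq equation :=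
  [seq (Var (state_var 0 q), const_term (start M == q)) | q <- enum (state M)] ++
  [seq (Var (cell_var 0 x.1 z x.2), const_term (None == x.2)) |
    x <- enum {: 'I_K * option A}, z <- iota 0 W] ++
  [seq (Var (cell_var 0 x.1 (W + z) x.2),
        const_term (initial_symbol x.1 (drop z w) == x.2)) |
    x <- enum {: 'I_K * option A}, z <- iota 0 W.+1].

Definition accepting_view (h : view M) : bool :=
  accepting h.1.1 && (trans h.1.1 h.1.2 == finset.set0).

Definition tableau (p : {poly nat}) (w : seq Sigma) : seq equation :=
  let W := p.[size w]%R in
  initial_equations W w ++ flatten [seq step_equations W t | t <- iota 0 W.+1] ++
  [:: (at_view W (fun h => const_term (accepting_view h)), One)].

Section Solutions.
Variable v : nat -> bool.

Definition view_at t (h : view M) : Prop :=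
  h \in views M /\ {in views M, forall h', v (view_var t h') = (h' == h)}.

Lemma view_equationsP t : solves v (view_equations t) <-> exists h, view_at t h.
Proof.
split=> [/andP [/eqP /= some /all_allpairsP excl]|[h [hM only_h]]].
  move: some; rewrite bool_eval_sum has_map => /hasP [h hM vh]; exists h; split=> // h' h'M.
  apply/idP/eqP => [vh'|-> //]; apply/eqP; apply: contraTT vh' => h'h.
  have := excl h h' hM; rewrite mem_filter h'h => /(_ h'M).
  by rewrite solves_exclusion; move: vh => /= ->.
apply/andP; split.
  rewrite /solves_equation /= bool_eval_sum has_map; apply/eqP/hasP; exists h => //=.
  by rewrite only_h.
apply/all_allpairsP => h1 h2 h1M; rewrite mem_filter => /andP [h21 h2M].
rewrite solves_exclusion !only_h //; apply/negP => /andP [/eqP E1 /eqP E2].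
by rewrite E1 E2 eqxx in h21.
Qed.

Lemma bool_eval_at_view t h F : view_at t h -> bool_eval v (at_view t F) = bool_eval v (F h).
Proof.
move=> [hM only_h]; rewrite bool_eval_sum has_map; apply/hasP/idP => [[h' h'M /=]|Fh].
  by rewrite only_h // => /andP [/eqP ->].
by exists h; rewrite //= only_h ?eqxx.
Qed.

Lemma bool_eval_source_cell W t x z h : bool_eval v (source_cell W t x z h) =
  if source (head_move h x.1) z == W then written h x.1 == x.2
  else v (cell_var t x.1 (source (head_move h x.1) z) x.2).
Proof. by rewrite /source_cell; case: ifP => //; rewrite bool_eval_const. Qed.

Lemma step_equationsP W t : solves v (step_equations W t) <-> exists2 h, view_at t h &
  [/\ v (state_var t h.1.1), forall j, v (cell_var t j W (h.1.2 j)),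
      forall q, v (state_var t.+1 q) = (next_state h == q) &
      forall j a z, z < W + W -> v (cell_var t.+1 j z.+1 a) =
        if source (head_move h j) z == W then written h j == a
        else v (cell_var t j (source (head_move h j) z) a)].
Proof.
rewrite /step_equations /reading_equations !solves_cat; split.
  case/and3P => /view_equationsP [h h_t] /andP [state_h cell_h] /andP [state_t cell_t].
  have [hM only_h] := h_t; have vh : v (view_var t h) by rewrite only_h ?eqxx.
  exists h => //; split.
  - by move: state_h; rewrite /solves all_map => /allP /(_ _ hM) /=; rewrite solves_implication vh.
  - move=> j; have /all_allpairsP /(_ _ _ hM (mem_enum _ j)) := cell_h.
    by rewrite solves_implication vh.
  - move=> q; move: state_t; rewrite /solves all_map => /allP /(_ q (mem_enum _ q)) /eqP /= ->.
    by rewrite (bool_eval_at_view _ h_t) bool_eval_const.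
  - move=> j a z zW; have /all_allpairsP /(_ (j, a) z (mem_enum _ _)) := cell_t.
    rewrite mem_iota => /(_ zW) /eqP /= ->.
    by rewrite (bool_eval_at_view _ h_t) bool_eval_source_cell.
case=> h h_t [state_h cell_h state_t cell_t]; have [hM only_h] := h_t; apply/and3P; split.
- by apply/view_equationsP; exists h.
- apply/andP; split; last first.
    apply/all_allpairsP => h' j h'M _; rewrite solves_implication only_h //.
    by apply/implyP => /eqP ->.
  rewrite /solves all_map; apply/allP => h' h'M /=; rewrite solves_implication only_h //.
  by apply/implyP => /eqP ->.
- apply/andP; split.
    rewrite /solves all_map; apply/allP => q _; apply/eqP.
    by rewrite (bool_eval_at_view _ h_t) bool_eval_const /= state_t.
  apply/all_allpairsP => x z _; rewrite mem_iota => /= zW; apply/eqP.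
  by rewrite (bool_eval_at_view _ h_t) bool_eval_source_cell /= cell_t.
Qed.

(* The equations say nothing about the two outermost cells, so one cell is lost
   at either end of the window [0 .. 2 W] at every step. *)
Definition describes W t (c : config M) : Prop :=
  (forall q, v (state_var t q) = (c.1 == q)) /\
  (forall j z a, t <= z -> z + t <= W + W -> v (cell_var t j z a) = (cell W (c.2 j) z == a)).

Lemma cell_initial W w j z : cell W ((initial M (map i w)).2 j) (W + z) =
  initial_symbol j (drop z w).
Proof.
rewrite /initial_symbol ffunE; case: ifP => _; last exact: cell_blank.
by rewrite cell_word_right -map_drop; case: (drop z w).
Qed.

Lemma cell_initial_left W w j z : z < W -> cell W ((initial M (map i w)).2 j) z = None.
Proof. by move=> zW; rewrite ffunE; case: ifP => _; rewrite ?cell_blank // cell_word_left. Qed.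

Lemma initial_equationsP W w :
  solves v (initial_equations W w) <-> describes W 0 (initial M (map i w)).
Proof.
rewrite /initial_equations !solves_cat; split.
  case/and3P => state_0 /all_allpairsP left_0 /all_allpairsP right_0; split.
    move=> q; move: state_0; rewrite /solves all_map => /allP /(_ q (mem_enum _ q)) /eqP /= ->.
    by rewrite bool_eval_const.
  move=> j z a _ zW; case: (ltnP z W) => [lt|le].
    have := left_0 (j, a) z (mem_enum _ _); rewrite mem_iota => /(_ lt) /eqP /= ->.
    by rewrite cell_initial_left // bool_eval_const.
  have := right_0 (j, a) (z - W) (mem_enum _ _).
  rewrite mem_iota -(cell_initial W) subnKC // => /(_ _) /eqP /= ->; last by lia.
  by rewrite bool_eval_const.
case=> state_0 cell_0; apply/and3P; split.
- rewrite /solves all_map; apply/allP => q _; apply/eqP.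
  by rewrite /= bool_eval_const state_0.
- apply/all_allpairsP => x z _; rewrite mem_iota => /= zW; apply/eqP.
  by rewrite /= bool_eval_const cell_0 ?cell_initial_left //; lia.
- apply/all_allpairsP => x z _; rewrite mem_iota => /= zW; apply/eqP.
  by rewrite /= bool_eval_const cell_0 -?(cell_initial W) //; lia.
Qed.

Lemma tableauP p w : let W := p.[size w]%R in solves v (tableau p w) <->
  [/\ describes W 0 (initial M (map i w)),
      forall t, t <= W -> solves v (step_equations W t) &
      exists2 h, view_at W h & accepting_view h].
Proof.
move=> W; rewrite /tableau -/W solves_cat [solves v (flatten _ ++ _)]solves_cat.
have stepsP : reflect (forall t, t <= W -> solves v (step_equations W t))
    (solves v (flatten [seq step_equations W t | t <- iota 0 W.+1])).
  rewrite solves_flatten all_map.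
  by apply: (iffP allP) => H t; have := H t; rewrite mem_iota.
have finalE h : view_at W h -> solves v
    [:: (at_view W (fun h => const_term (accepting_view h)), One)] = accepting_view h.
  by move=> h_W; rewrite /= /solves_equation (bool_eval_at_view _ h_W) bool_eval_const andbT eqb_id.
split=> [/and3P [/initial_equationsP init /stepsP step_t final]|[init step_t [h h_W h_acc]]].
  split=> //; have /step_equationsP [h h_W _] := step_t W (leqnn W).
  by exists h; rewrite // -finalE.
apply/and3P; split; [exact/initial_equationsP|exact/stepsP|by rewrite (finalE h)].
Qed.

Lemma describes_step W t c : t <= W -> solves v (step_equations W t) -> describes W t c ->
  exists h, [/\ view_at t h, view_of c h & describes W t.+1 (successor h c)].
Proof.
move=> tW /step_equationsP [h h_t [state_h cell_h state_t cell_t]] [state_c cell_c].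
exists h; split=> //.
  have [hM _] := h_t; split=> //; first by move: state_h; rewrite state_c => /eqP.
  apply/ffunP => j; rewrite ffunE -(cell_head W); apply/esym/eqP.
  by rewrite -cell_c ?cell_h //; lia.
split=> [q|j [|z] a]; [exact: state_t|by []|move=> tz zW].
rewrite cell_t; last by lia.
rewrite ffunE cell_shift; case: eqP => // _.
by apply: cell_c; case: (head_move h j) => /=; lia.
Qed.

Lemma tableau_sound p w : solves v (tableau p w) -> accepts M (map i w).
Proof.
move/tableauP; set W := p.[size w]%R => -[init step_t [h h_W /andP [h_acc /eqP h_halt]]].
have reach t : t <= W ->
    exists c k, steps k (initial M (map i w)) c /\ describes W t c.
  elim: t => [|t IH] tW; first by exists (initial M (map i w)), 0.
  have [c [k [w_c c_t]]] := IH (ltnW tW).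
  have [h' [_ c_h' c_t']] := describes_step (ltnW tW) (step_t t (ltnW tW)) c_t.
  exists (successor h' c).
  have [c_step|[_ c_halt]] := successor_step c_h'; last by exists k; rewrite {1}c_halt.
  by exists k.+1; split=> //; exact: steps_rcons w_c c_step.
have [c [k [w_c c_W]]] := reach W (leqnn W).
have [h' [[h'M only_h'] [_ state_c heads_c] _]] :=
  describes_step (leqnn W) (step_t W (leqnn W)) c_W.
have [hM only_h] := h_W; have Eh : h = h'.
  by apply/eqP; rewrite -only_h' // only_h ?eqxx.
exists k, c; split=> //; last by rewrite -state_c -Eh.
by rewrite /halted /enabled -state_c -[[ffun _ => _]]heads_c -Eh.
Qed.

End Solutions.

Lemma tableau_complete p w : runs_in_time M i p -> accepts M (map i w) ->
  exists v, solves v (tableau p w).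
Proof.
move=> in_time [k [c [w_c c_halt c_acc]]]; have kW := in_time _ _ _ w_c.
have [f [h [f0 fS fk]]] := steps_trajectory w_c c_halt.
set W := p.[size w]%R in kW.
pose fact_value t z (x : fact) : bool := match x with
  | inl h' => h' == h t
  | inr (inl q) => (f t).1 == q
  | inr (inr (j, a)) => cell W ((f t).2 j) z == a end.
pose v n := `[< exists t z x, n = fact_var t z x /\ fact_value t z x >].
have vE t z x : v (fact_var t z x) = fact_value t z x.
  apply/asboolP/idP => [[t' [z' [x' [/fact_var_inj [-> -> ->]]]]]|val] //.
  by exists t, z, x.
have h_t t : view_at v t (h t).
  by have [[hM _ _] _] := fS t; split=> // h' _; exact: vE.
exists v; apply/tableauP; split.
- by rewrite -f0; split=> [q|j z a _ _]; exact: vE.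
- move=> t _; have [[_ state_h heads_h] succ_t] := fS t.
  apply/step_equationsP; exists (h t) => //; split.
  + by rewrite vE /= state_h.
  + by move=> j; rewrite vE /= cell_head heads_h ffunE.
  + by move=> q; rewrite vE /= succ_t.
  + by move=> j a z _; rewrite !vE /= succ_t ffunE cell_shift; case: ifP.
- have [[_ state_h heads_h] _] := fS W; exists (h W) => //.
  by rewrite /accepting_view state_h heads_h fk // c_acc; exact/eqP.
Qed.

End Tableau.

(** * Computing the tableau in polynomial time *)

Section Terms.
Variable Sigma : finType.
Local Notation encodable := (encodable Sigma).
Local Notation polytime := (@polytime Sigma _ _ _ _).
Variables (X : Type) (eX : encodable X).

Lemma polytime_encode_term (t : X -> term) :
  polytime t -> polytime (fun x => encode_term (t x)).
Proof. exact: polytime_recode. Qed.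

Lemma polytime_var (b : X -> seq bool) :
  polytime b -> polytime (fun x => Var (nat_of_bits (b x))).
Proof.
move=> pb; apply: (polytime_recode (g := fun x => TVar :: map TBit (b x ++ [:: true]))).
  by move=> x; rewrite /tree_of /encodable_term /= bits_of_natK cats1.
have pT : polytime (fun p : X * bool => TBit p.2) by apply: polytime_of_bool; polytime.
by polytime; apply: (polytime_map (F := fun _ => TBit)); polytime.
Qed.

Lemma polytime_add (t u : X -> term) :
  polytime t -> polytime u -> polytime (fun x => Add (t x) (u x)).
Proof.
move=> /polytime_encode_term pt /polytime_encode_term pu.
apply: (polytime_recode (g := fun x => TAdd :: encode_term (t x) ++ encode_term (u x))) => //.
by polytime.
Qed.

Lemma polytime_mul (t u : X -> term) :
  polytime t -> polytime u -> polytime (fun x => Mul (t x) (u x)).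
Proof.
move=> /polytime_encode_term pt /polytime_encode_term pu.
apply: (polytime_recode (g := fun x => TMul :: encode_term (t x) ++ encode_term (u x))) => //.
by polytime.
Qed.

Lemma polytime_opp (t : X -> term) : polytime t -> polytime (fun x => Opp (t x)).
Proof.
move=> /polytime_encode_term pt.
by apply: (polytime_recode (g := fun x => TOpp :: encode_term (t x))) => //; polytime.
Qed.

Lemma polytime_sum_terms C (s : seq C) (F : C -> X -> term) :
  (forall c, polytime (F c)) -> polytime (fun x => sum_terms [seq F c x | c <- s]).
Proof. by move=> pF; elim: s => [|c s IH] /=; [exact: polytime_const|exact: polytime_add]. Qed.

Lemma polytime_map_const C Y (eY : encodable Y) (s : seq C) (F : C -> X -> Y) :
  (forall c, polytime (F c)) -> polytime (fun x => [seq F c x | c <- s]).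
Proof. by move=> pF; elim: s => [|c s IH] /=; polytime. Qed.

End Terms.

Lemma polytime_encode_equations Sigma X (eX : encodable Sigma X) (es : X -> seq equation) :
  polytime es -> polytime (fun x => encode (equations_formula (es x))).
Proof.
move=> pe; apply: (eq_polytime (f := fun x => flatten [seq TAnd :: TEqual ::
    encode_term e.1 ++ encode_term e.2 | e <- es x] ++ encode (Equal Zero Zero))).
  by move=> x; elim: (es x) => //= e s <-; rewrite !catA.
have p1 : polytime (Sigma := Sigma) (fun q : X * equation => encode_term q.2.1).
  by apply: polytime_encode_term; polytime.
have p2 : polytime (Sigma := Sigma) (fun q : X * equation => encode_term q.2.2).
  by apply: polytime_encode_term; polytime.
by polytime.
Qed.

Section Tableau.
Variables (Sigma A : finType) (i : Sigma -> A) (M : machine A).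
Local Notation encodable := (encodable Sigma).
Local Notation polytime := (@polytime Sigma _ _ _ _).

Section Facts.
Variables (X : Type) (eX : encodable X).

Lemma polytime_fact_var (t z : X -> nat) (k : fact M) :
  polytime t -> polytime z -> polytime (fun x => Var (fact_var (t x) (z x) k)).
Proof. by move=> pt pz; apply: polytime_var; rewrite /fact_name; polytime. Qed.

Lemma polytime_source d (z : X -> nat) : polytime z -> polytime (fun x => source d (z x)).
Proof. by case: d => pz /=; polytime. Qed.

Lemma polytime_at_view (t : X -> nat) (F : view M -> X -> term) : polytime t ->
  (forall h, polytime (F h)) -> polytime (fun x => at_view (t x) (fun h => F h x)).
Proof.
move=> pt pF; apply: polytime_sum_terms => h; apply: polytime_mul => //.
by apply: polytime_fact_var; polytime.
Qed.

End Facts.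

Ltac polytime_term ::= lazymatch goal with
  | |- polytime (fun x => Var (view_var (@?t x) ?h)) =>
      apply: (polytime_fact_var (t := t) (z := fun=> 0))
  | |- polytime (fun x => Var (state_var (@?t x) ?q)) =>
      apply: (polytime_fact_var (t := t) (z := fun=> 0))
  | |- polytime (fun x => Var (cell_var (@?t x) ?j (@?z x) ?a)) =>
      apply: (polytime_fact_var (t := t) (z := z))
  | |- polytime (fun x => Mul (@?t x) (@?u x)) => apply: (polytime_mul (t := t) (u := u))
  | |- polytime (fun x => Opp (@?t x)) => apply: (polytime_opp (t := t))
  | |- polytime (fun x => source ?d (@?z x)) => apply: (polytime_source d (z := z))
  | |- polytime (fun x => at_view (@?t x) (fun h => @?F x h)) =>
      eapply (@polytime_at_view _ _ t (fun h x => F x h)); [|intro]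
  | |- polytime (fun x => sum_terms (map (@?F x) ?s)) =>
      eapply (@polytime_sum_terms _ _ _ _ s (fun c x => F x c)); intro
  | |- polytime (fun x => map (@?F x) ?s) =>
      eapply (@polytime_map_const _ _ _ _ _ _ s (fun c x => F x c)); intro
  end.

Lemma polytime_step_equations X (eX : encodable X) (W t : X -> nat) :
  polytime W -> polytime t -> polytime (fun x => step_equations M (W x) (t x)).
Proof.
move=> pW pt; rewrite /step_equations /view_equations /reading_equations /state_equations.
by rewrite /cell_equations /source_cell /exclusion /implication; polytime.
Qed.

Lemma polytime_initial_equations X (eX : encodable X) (W : X -> nat) (w : X -> seq Sigma) :
  polytime W -> polytime w -> polytime (fun x => initial_equations i M (W x) (w x)).
Proof.
move=> pW pw; rewrite /initial_equations.
have p_symbol (x : 'I_(tapes M).+1 * option A) :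
    polytime (fun u : seq Sigma => initial_symbol i x.1 u == x.2).
  pose value o := (if x.1 == ord0 then o else None) == x.2.
  apply: (eq_polytime (f := fun u => if u is a :: _ then value (Some (i a)) else value None)).
    by case.
  apply: (polytime_list_case (g := fun a _ _ => value (Some (i a)))); [by polytime..|].
  by apply: (@polytime_of_letter _ _ _ _ _ (fun a => value (Some (i a)))); polytime.
by polytime; apply: (polytime_comp (p_symbol _)); polytime.
Qed.

Lemma polytime_tableau (p : {poly nat}) : polytime (tableau i M p).
Proof.
have pW : polytime (fun w : seq Sigma => p.[size w]%R).
  by apply: polytime_horner; apply: polytime_size; polytime.
have p_init := polytime_initial_equations pW (polytime_id _).
have p_step : polytime (fun q : seq Sigma * nat => step_equations M p.[size q.1]%R q.2).
  by apply: polytime_step_equations; [apply: (polytime_comp pW)|]; polytime.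
by rewrite /tableau; polytime.
Qed.

End Tableau.

Lemma Sat_Bc_NP_hard (T : topologicalType) : ([set: T] !=set0)%classic -> NP_hard (Sat_Bc T).
Proof.
move=> T0 Sigma L [A [i [M [p [_ in_time LE]]]]].
exists (fun w => encode (equations_formula (tableau i M p w))).
  exact/polytime_computable/polytime_encode_equations/polytime_tableau.
move=> w; rewrite LE; split=> [/(tableau_complete in_time) w_sat|].
  by exists (equations_formula (tableau i M p w)); rewrite ?satisfiable_equations.
case=> phi /encode_inj <- /(satisfiable_equations _ T0) [v].
exact: tableau_sound.
Qed.

Theorem theorem4 (R : realType) : NP_complete (Sat_Bc 'rV[R]_3).
Proof. by split; [exact: Sat_Bc_NP|apply: Sat_Bc_NP_hard; exists 0%R]. Qed.
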